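(* Let $(x_\star,u_\star,\rho)$ be an $s$-parameterization, on $\mathcal{S}=[s_\alpha,s_\omega]$, of a point-to-point maneuver of the control system $\dot x=f(x)+B(x)u$, with orbit $\mathcal{O}=x_\star(\mathcal{S})$, and let $p:\mathfrak{X}\to\mathcal{S}$ be a projection operator for $\mathcal{O}$ (both notions as defined in the context). Let $K:\mathcal{S}\to\mathbb{R}^{m\times n}$ be smooth, and consider the closed-loop system obtained with the (locally Lipschitz) control law $$u=u_\star(p(x))+K(p(x))\,e(x),\qquad e(x):=x-x_\star(p(x)).$$ Put $A_{cl}(s):=A(x_\star(s),u_\star(s))+B(x_\star(s))K(s)$. Suppose there exists a $\mathcal{C}^1$ matrix function $R:\mathcal{S}\to\mathbb{M}^n_{\succ0}$ such that 1. for some $Q_\alpha,Q_\omega\in\mathbb{M}^n_{\succ0}$, the matrices $R_\alpha=R(s_\alpha)$ and $R_\omega=R(s_\omega)$ satisfy $$A_{cl}^{\mathsf T}(s_\alpha)R_\alpha+R_\alpha A_{cl}(s_\alpha)=-Q_\alpha,\qquad A_{cl}^{\mathsf T}(s_\omega)R_\omega+R_\omega A_{cl}(s_\omega)=-Q_\omega;$$ 2. for some smooth $Q_\perp:\mathcal{S}\to\mathbb{M}^n_{\succ0}$, the function $R_\perp(s):=\mathcal{E}_\perp^{\mathsf T}(s)R(s)\mathcal{E}_\perp(s)$ satisfies, for all $s\in\mathcal{S}$, $$\mathcal{E}_\perp^{\mathsf T}(s)\big[A_{cl}^{\mathsf T}(s)R_\perp(s)+R_\perp(s)A_{cl}(s)+\rho(s)R_\perp'(s)+Q_\perp(s)\big]\mathcal{E}_\perp(s)=0_{n\times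 n}.$$ Then for the closed-loop system: a) the final equilibrium $x_\omega=x_\star(s_\omega)$ is asymptotically stable; b) the one-dimensional manifold $\mathcal{O}$ is invariant and exponentially stable; c) there exist $\mu,\nu>0$ such that the time derivative (along closed-loop solutions) of the locally Lipschitz function $V(x)=e^{\mathsf T}(x)R(p(x))e(x)$ satisfies $\dot V(x)\le-\mu V(x)$ for almost all $x$ in $\mathfrak{T}=\{x\in\mathfrak{X}:V(x)<\nu\}$.
   Context: Notation: $\mathbb{M}^n_{\succ0}$ (resp. $\mathbb{M}^n_{\succeq0}$) is the set of real symmetric positive definite (resp. semidefinite) $n\times n$ matrices; $D h$ is the Jacobian matrix of $h$ and $D^2h$ the Hessian of a scalar $h$; a prime denotes $d/ds$; $\mathcal{B}_\epsilon(x)$ is the open ball of radius $\epsilon$; $\mathrm{cl}$, $\mathrm{int}$ denote closure and interior; ''smooth'' means $\mathcal{C}^\infty$. System: $\dot x=f(x)+B(x)u$, $x\in\mathbb{R}^n$, $u\in\mathbb{R}^m$, $m\le n$, where $f:\mathbb{R}^n\to\mathbb{R}^n$ and the columns $b_1,\dots,b_m$ of the full-rank matrix function $B:\mathbb{R}^n\to\mathbb{R}^{n\times m}$ are $\mathcal{C}^2$. Put $A(x,u):=Df(x)+\sum_{i=1}^m Db_i(x)u_i$. A pair $(x_e,u_e)$ with $f(x_e)+B(x_e)u_e=0$ is a linearly stabilizable equilibrium if there is $\hat K\in\mathbb{R}^{m\times n}$ with $A(x_e,u_e)+B(x_e)\hat K$ Hurwitz. $s$-parameterization of a point-to-point (PtP)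 maneuver: let $(x_\alpha,u_\alpha),(x_\omega,u_\omega)$, $x_\alpha\ne x_\omega$, be linearly stabilizable equilibria and $\mathcal{S}=[s_\alpha,s_\omega]\subset\mathbb{R}$, $s_\alpha<s_\omega$. It is a triplet $x_\star:\mathcal{S}\to\mathbb{R}^n$, $u_\star:\mathcal{S}\to\mathbb{R}^m$, $\rho:\mathcal{S}\to\mathbb{R}_{\ge0}$ such that: (P1) $x_\star$ is $\mathcal{C}^2$ and traces out a non-self-intersecting curve, $u_\star$ and $\rho$ are $\mathcal{C}^1$; (P2) $(x_\star(s_i),u_\star(s_i))=(x_i,u_i)$ for $i\in\{\alpha,\omega\}$; (P3) $\rho(s_\alpha)=\rho(s_\omega)=0$ and $\rho(s)>0$ for $s\in\mathrm{int}\,\mathcal{S}$; (P4) $\|\mathcal{F}(s)\|>0$ for all $s\in\mathcal{S}$, where $\mathcal{F}(s):=x_\star'(s)$; (P5) $\mathcal{F}(s)\rho(s)=f(x_\star(s))+B(x_\star(s))u_\star(s)$ for all $s\in\mathcal{S}$. Its orbit is $\mathcal{O}:=\{x_\star(s):s\in\mathcal{S}\}$. Projection operator for $\mathcal{O}$: let $\mathfrak{X}\subset\mathbb{R}^n$ be a simply connected neighborhood of $\mathcal{O}$ whose interior can be partitioned into three subsets $\mathcal{H}_\alpha,\mathcal{T},\mathcal{H}_\omega$ (that is, $\mathrm{cl}(\mathfrak{X})=\mathrm{cl}(\mathcal{H}_\alpha\cup\mathcal{T}\cup\mathcal{H}_\omega)$), with $\mathcal{H}_\alpha,\mathcal{H}_\omega$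 open, such that: $\mathcal{T}$ is a tubular neighborhood of $\mathcal{O}$ (a tube of everywhere nonzero radius around the curve $x_\star(\mathrm{int}\,\mathcal{S})$, a connected set foliated by the disjoint hypersurface pieces $\Pi(s)\cap\mathcal{T}$, $s\in\mathrm{int}\,\mathcal{S}$, with $\Pi(s):=\{x\in\mathfrak{X}:p(x)=s\}$, on which $Dp$ is nonzero and bounded); for some $\epsilon>0$, $\mathcal{B}_\epsilon(x_i)\setminus\mathcal{T}\subset\mathrm{cl}(\mathcal{H}_i)$ for $i\in\{\alpha,\omega\}$; $\mathrm{cl}(\mathcal{T})\cap\mathrm{cl}(\mathcal{H}_i)\neq\emptyset$ for $i\in\{\alpha,\omega\}$ and $\mathrm{cl}(\mathcal{H}_\alpha)\cap\mathrm{cl}(\mathcal{H}_\omega)=\emptyset$. A map $p:\mathfrak{X}\to\mathcal{S}$ is a projection operator for $\mathcal{O}$ if it is well defined and Lipschitz continuous on $\mathfrak{X}$ and: (C1) $p(x_\star(s))=s$ for all $s\in\mathcal{S}$; (C2) $p\equiv s_\alpha$ on $\mathcal{H}_\alpha$, $p\equiv s_\omega$ on $\mathcal{H}_\omega$, and $p(\mathrm{int}\,\mathcal{T})\subset\mathrm{int}\,\mathcal{S}$; (C3) $p$ is $\mathcal{C}^r$, $r\ge2$, within each of $\mathcal{H}_\alpha,\mathcal{T},\mathcal{H}_\omega$. Along the orbit, $\mathcal{P}(s):=Dp(x_\star(s))$ (a row vector; derivatives of $p$ on $\mathcal{O}$ are those taken inside $\mathcal{T}$, at the endpoints $s_\alpha,s_\omega$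 as limits from within $\mathcal{T}$), so $\mathcal{P}(s)\mathcal{F}(s)=1$, and $\mathcal{E}_\perp(s):=I_n-\mathcal{F}(s)\mathcal{P}(s)$. Stability of the set $\mathcal{O}$ is with respect to $\mathrm{dist}(\mathcal{O},x)=\inf_{y\in\mathcal{O}}\|x-y\|$; exponentially stable means that for solutions starting sufficiently close to $\mathcal{O}$ this distance is bounded by a constant times its initial value times a decaying exponential in time. *)

(* Defs.v *)
From mathcomp Require Import all_boot all_order all_algebra.
From mathcomp.real_closed Require Import complex.
From mathcomp Require Import all_classical all_reals all_analysis.

Set Implicit Arguments.
Unset Strict Implicit.
Unset Printing Implicit Defensive.

Import Order.TTheory GRing.Theory Num.Theory.
Import numFieldNormedType.Exports.

Local Open Scope classical_set_scope.
Local Open Scope ring_scope.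

(** Vectors of R^n are column vectors ['cV[R]_n].  Topological notions are
    those of MathComp-Analysis (its norm on matrices is the maximum norm, which
    induces the usual topology); wherever the value of a norm matters, the
    Euclidean norm [enorm] is used.

    A map defined on a subset (an interval [S], the set [X]) is a total
    function of which only the values on that subset are ever referred to. *)

Section Euclidean.
Context {R : realType} {n : nat}.
Implicit Types (x y v : 'cV[R]_n) (A : set 'cV[R]_n).

Definition enorm v : R := Num.sqrt (\sum_i v i 0 ^+ 2).

Definition eball x (r : R) : set 'cV[R]_n := [set y | enorm (y - x) < r].

Definition dist A x : R := inf [set enorm (x - y) | y in A].

Definition posdef (M : 'M[R]_n) : Prop :=
  M^T = M /\ forall v, v != 0 -> 0 < (v^T *m M *m v) 0 0.

Definition hurwitz (M : 'M[R]_n) : Prop :=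
  forall z : R[i], eigenvalue (map_mx (real_complex R) M) z -> complex.Re z < 0.

(** Lebesgue-null subsets of R^n: for every [eps > 0] there is a countable
    cover by closed boxes of total volume at most [eps]. *)
Definition lebesgue_null (N : set 'cV[R]_n) : Prop :=
  forall eps : R, 0 < eps -> exists a b : nat -> 'cV[R]_n,
  [/\ forall k i, a k i 0 <= b k i 0,
      N `<=` \bigcup_k [set x | forall i, a k i 0 <= x i 0 <= b k i 0]
    & forall j : nat, \sum_(k < j) \prod_i (b k i 0 - a k i 0) <= eps].

Definition path_connected A : Prop :=
  forall x y, A x -> A y -> exists g : R -> 'cV[R]_n,
  [/\ {within `[0, 1], continuous g}, g @` `[0, 1] `<=` A, g 0 = x & g 1 = y].

(** [h (t, l)]: [t] is the parameter along the loop and [l] the homotopy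
    parameter; base points are kept fixed. *)
Definition simply_connected A : Prop :=
  path_connected A /\
  forall g : R -> 'cV[R]_n, {within `[0, 1], continuous g} ->
    g @` `[0, 1] `<=` A -> g 0 = g 1 ->
  exists h : R * R -> 'cV[R]_n,
  [/\ {within `[0, 1] `*` `[0, 1], continuous h},
      h @` (`[0, 1] `*` `[0, 1]) `<=` A,
      forall t, `[0, 1]%classic t -> h (t, 0) = g t,
      forall t, `[0, 1]%classic t -> h (t, 1) = g 0
    & forall l, `[0, 1]%classic l -> h (0, l) = g 0 /\ h (1, l) = g 0].

End Euclidean.

Section Smoothness.
Context {R : realType}.

(** Derivative at [s] of a map that is only considered on [S : set R]: one-sided
    at the endpoints of an interval, two-sided in its interior. *)
Definition diff_quotient {W : normedModType R} (S : set R) (g : R -> W) (s : R) :=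
  (t - s)^-1 *: (g t - g s) @[t --> within S s^'].

Definition derive_on {W : normedModType R} (S : set R) (g : R -> W) (s : R) : W :=
  lim (diff_quotient S g s).

(** C^k on an interval [S] of the real line, up to the endpoints in [S]. *)
Fixpoint Ck_on {W : normedModType R} (S : set R) (k : nat) (g : R -> W) : Prop :=
  if k is k'.+1 then
    (forall s, S s -> cvg (diff_quotient S g s)) /\ Ck_on S k' (derive_on S g)
  else {within S, continuous g}.

Definition smooth_on {W : normedModType R} (S : set R) (g : R -> W) : Prop :=
  forall k, Ck_on S k g.

(** C^k on an open subset [U] of a (finite-dimensional) normed space. *)
Fixpoint Ck {V W : normedModType R} (U : set V) (k : nat) (g : V -> W) : Prop :=
  if k is k'.+1 then
    (forall x, U x -> differentiable g x) /\ forall v, Ck U k' ('D_v g)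
  else forall x, U x -> {for x, continuous g}.

Definition jac {n k : nat} (g : 'cV[R]_n -> 'cV[R]_k) (x : 'cV[R]_n) : 'M[R]_(k, n) :=
  \matrix_(i, j) ('D_(delta_mx j 0) g x) i 0.

Definition grad_row {n : nat} (g : 'cV[R]_n -> R) (x : 'cV[R]_n) : 'rV[R]_n :=
  \row_j 'D_(delta_mx j 0) g x.

End Smoothness.

Section ControlSystem.
Context {R : realType} {n m : nat}.
Variables (f : 'cV[R]_n -> 'cV[R]_n) (B : 'cV[R]_n -> 'M[R]_(n, m)).

Definition control_system : Prop :=
  [/\ Ck setT 2 f, forall i, Ck setT 2 (fun x => col i (B x))
    & forall x, \rank (B x) = m].

(** The linearization A(x,u) = Df(x) + sum_i u_i Db_i(x). *)
Definition Alin (x : 'cV[R]_n) (u : 'cV[R]_m) : 'M[R]_n :=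
  jac f x + \sum_i u i 0 *: jac (fun y => col i (B y)) x.

Definition stabilizable_equilibrium (xe : 'cV[R]_n) (ue : 'cV[R]_m) : Prop :=
  f xe + B xe *m ue = 0 /\
  exists Kh : 'M[R]_(m, n), hurwitz (Alin xe ue + B xe *m Kh).

(** [ptp_maneuver]: (xs, us, rho) is an s-parameterization on [sa, sw] of a
    point-to-point maneuver from (xa, ua) to (xw, uw). *)
Record ptp_maneuver (xa : 'cV[R]_n) (ua : 'cV[R]_m) (xw : 'cV[R]_n) (uw : 'cV[R]_m)
    (sa sw : R) (xs : R -> 'cV[R]_n) (us : R -> 'cV[R]_m) (rho : R -> R) : Prop := {
  ptp_equilibrium_a : stabilizable_equilibrium xa ua;
  ptp_equilibrium_w : stabilizable_equilibrium xw uw;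
  ptp_neq : xa <> xw;
  ptp_lt : sa < sw;
  ptp_xs_C2 : Ck_on `[sa, sw] 2 xs;
  ptp_xs_inj : forall s t, s \in `[sa, sw] -> t \in `[sa, sw] -> xs s = xs t -> s = t;
  ptp_us_C1 : Ck_on `[sa, sw] 1 us;
  ptp_rho_C1 : Ck_on `[sa, sw] 1 rho;
  ptp_start : xs sa = xa /\ us sa = ua;
  ptp_end : xs sw = xw /\ us sw = uw;
  ptp_rho_ends : rho sa = 0 /\ rho sw = 0;
  ptp_rho_gt0 : forall s, s \in `]sa, sw[ -> 0 < rho s;
  ptp_regular : forall s, s \in `[sa, sw] -> 0 < enorm (derive_on `[sa, sw] xs s);
  ptp_dynamics : forall s, s \in `[sa, sw] ->
    rho s *: derive_on `[sa, sw] xs s = f (xs s) + B (xs s) *m us s }.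

End ControlSystem.

Section Projection.
Context {R : realType} {n : nat}.
Variables (sa sw : R) (xs : R -> 'cV[R]_n).

Definition maneuver_orbit : set 'cV[R]_n := xs @` `[sa, sw].

(** [T] is not required to be open, so its differential conditions are imposed
    on its interior [T°].  The leaves [X `&` p @^-1` [set s] `&` T] of the
    foliation are pairwise disjoint by construction, and are hypersurface pieces
    because [grad_row p] does not vanish. *)
Record tubular_neighborhood (X T : set 'cV[R]_n) (p : 'cV[R]_n -> R) : Prop := {
  tube_radius : forall s, s \in `]sa, sw[ ->
    exists2 r : R, 0 < r & eball (xs s) r `<=` T;
  tube_connected : connected T;
  tube_foliated :
    T = \bigcup_(s in `]sa, sw[) ([set x | X x /\ p x = s] `&` T);
  tube_grad_neq0 : forall x, T° x -> grad_row p x != 0;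
  tube_grad_bounded : exists M : R, forall x, T° x -> `|grad_row p x| <= M }.

(** [p] is a C^r projection operator for the orbit, with respect to the
    partition [Ha], [T], [Hw] of the interior of [X].  The last two fields say
    that the derivatives of [p] on the orbit make sense at its two endpoints, as
    limits from within the tube; order two is what the derivative of
    s |-> Dp(xs(s)) involves. *)
Record projection_operator (r : nat) (X Ha T Hw : set 'cV[R]_n)
    (p : 'cV[R]_n -> R) : Prop := {
  proj_simply_connected : simply_connected X;
  proj_neighborhood : maneuver_orbit `<=` X°;
  proj_sub : [/\ Ha `<=` X°, T `<=` X° & Hw `<=` X°];
  proj_disjoint : [/\ Ha `&` T = set0, T `&` Hw = set0 & Ha `&` Hw = set0];
  proj_closure : closure X = closure (Ha `|` T `|` Hw);
  proj_open : open Ha /\ open Hw;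
  proj_tube : tubular_neighborhood X T p;
  proj_caps : exists2 eps : R, 0 < eps &
    eball (xs sa) eps `\` T `<=` closure Ha /\
    eball (xs sw) eps `\` T `<=` closure Hw;
  proj_adjacent : (closure T `&` closure Ha !=set0) /\ (closure T `&` closure Hw !=set0);
  proj_separated : closure Ha `&` closure Hw = set0;
  proj_range : forall x, X x -> p x \in `[sa, sw];
  proj_lipschitz : [lipschitz p x | x in X];
  proj_orbit : forall s, s \in `[sa, sw] -> p (xs s) = s;
  proj_Ha : forall x, Ha x -> p x = sa;
  proj_Hw : forall x, Hw x -> p x = sw;
  proj_T : forall x, T° x -> p x \in `]sa, sw[;
  proj_order : (2 <= r)%N;
  proj_Cr : [/\ Ck Ha r p, Ck T° r p & Ck Hw r p];
  proj_D1_ends : forall s v, s = sa \/ s = sw ->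
    cvg ('D_v p x @[x --> within T° (nbhs (xs s))]);
  proj_D2_ends : forall s v w, s = sa \/ s = sw ->
    cvg ('D_w ('D_v p) x @[x --> within T° (nbhs (xs s))]) }.

(** Dp(xs(s)), taken from within the tube; for [s] in the open interval,
    [T] is a neighborhood of [xs s] and this is just [grad_row p (xs s)]. *)
Definition Porb (T : set 'cV[R]_n) (p : 'cV[R]_n -> R) (s : R) : 'rV[R]_n :=
  lim (grad_row p x @[x --> within T° (nbhs (xs s))]).

Definition Eperp (T : set 'cV[R]_n) (p : 'cV[R]_n -> R) (s : R) : 'M[R]_n :=
  1%:M - derive_on `[sa, sw] xs s *m Porb T p s.

End Projection.

Section ClosedLoop.
Context {R : realType} {n m : nat}.
Variables (f : 'cV[R]_n -> 'cV[R]_n) (B : 'cV[R]_n -> 'M[R]_(n, m)).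
Variables (xs : R -> 'cV[R]_n) (us : R -> 'cV[R]_m) (K : R -> 'M[R]_(m, n)).
Variables (p : 'cV[R]_n -> R).

Definition err (x : 'cV[R]_n) : 'cV[R]_n := x - xs (p x).

Definition feedback (x : 'cV[R]_n) : 'cV[R]_m := us (p x) + K (p x) *m err x.

Definition closed_loop (x : 'cV[R]_n) : 'cV[R]_n := f x + B x *m feedback x.

Definition Acl (s : R) : 'M[R]_n := Alin f B (xs s) (us s) + B (xs s) *m K s.

Definition lyap (Rm : R -> 'M[R]_n) (x : 'cV[R]_n) : R :=
  ((err x)^T *m Rm (p x) *m err x) 0 0.

End ClosedLoop.

Section Stability.
Context {R : realType} {n : nat}.
Variables (X : set 'cV[R]_n) (F : 'cV[R]_n -> 'cV[R]_n).

(** [phi] solves x' = F(x) on the interval [J]; the vector field is only defined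
    on [X], so the solution has to stay there. *)
Definition solution (J : interval R) (phi : R -> 'cV[R]_n) : Prop :=
  forall t, t \in J -> X (phi t) /\ diff_quotient [set` J] phi t --> F (phi t).

Definition invariant_set (A : set 'cV[R]_n) : Prop :=
  forall J phi t0 t, solution J phi -> t0 \in J -> t \in J -> A (phi t0) -> A (phi t).

Definition global_solution_from (x0 : 'cV[R]_n) : Prop :=
  exists2 phi, solution `[0, +oo[ phi & phi 0 = x0.

Definition asymptotically_stable (xe : 'cV[R]_n) : Prop :=
  [/\ X xe /\ F xe = 0,
      forall eps : R, 0 < eps -> exists2 delta : R, 0 < delta &
        forall J phi, solution J phi -> 0 \in J -> enorm (phi 0 - xe) < delta ->
        forall t, t \in J -> 0 <= t -> enorm (phi t - xe) < eps
    & exists2 delta : R, 0 < delta &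
        (forall x0, enorm (x0 - xe) < delta -> global_solution_from x0) /\
        (forall phi, solution `[0, +oo[ phi -> enorm (phi 0 - xe) < delta ->
           phi t @[t --> +oo] --> xe)].

Definition exponentially_stable_set (A : set 'cV[R]_n) : Prop :=
  exists delta C lambda : R, [/\ 0 < delta, 0 < C, 0 < lambda,
      forall x0, dist A x0 < delta -> global_solution_from x0
    & forall J phi, solution J phi -> 0 \in J -> dist A (phi 0) < delta ->
      forall t, t \in J -> 0 <= t ->
        dist A (phi t) <= C * dist A (phi 0) * expR (- lambda * t)].

(** The time derivative of [V] along solutions exists at [x] and is at most [c];
    the first conjunct excludes that this holds for want of solutions. *)
Definition time_derivative_le (V : 'cV[R]_n -> R) (x : 'cV[R]_n) (c : R) : Prop :=
  (exists tau phi, [/\ 0 < tau, solution `](- tau), tau[ phi & phi 0 = x]) /\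
  forall tau phi, 0 < tau -> solution `](- tau), tau[ phi -> phi 0 = x ->
    derivable (V \o phi) 0 1 /\ derive1 (V \o phi) 0 <= c.

Definition locally_lipschitz (V : 'cV[R]_n -> R) : Prop :=
  forall x, X x -> exists2 U, nbhs x U & [lipschitz V y | y in X `&` U].

End Stability.

(* Main.v *)
(** In the coordinates (p x, e x) the closed loop reads s' = rho s + O(|e|),
    e' = L(s) e + o(|e|) near the orbit.  Two linear facts hold along the orbit,
    up to its ends: P(s) e x = o(|e x|), because x and xs (p x) lie on the same
    level of p, and, on the kernel of P(s), the derivative of V has quadratic part
    - e^T Q_perp e by hypothesis 2.  On the two caps, where p is constant, V is a
    quadratic form handled by hypothesis 1.  By compactness of the orbit the
    resulting local bounds - C|e|^2 <= V' <= - c|e|^2 hold on a uniform tube.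
    A solution may cross the boundary between the tube and a cap arbitrarily
    often, so the decay of V along it is obtained by a Dini-type comparison that
    only uses one-sided information at the crossing times.  Exponential stability
    follows; the final equilibrium is attractive because e decays exponentially
    while s' = rho s + O(|e|) pushes s to sw.  The exceptional null set
    consists of the cap boundaries, which are Lipschitz graphs since p has a
    nonzero, almost constant gradient near each end of the orbit. *)

(* The main obstacle is regularity at the two ends of the orbit. There [p] is only Lipschitz across
   the boundary between tube and cap, its derivatives have limits from within [T°] only, and [T°]
   need not be convex. Yet every expansion compares two moving points, [x] and [xs (p x)], so
   differentiability must be strict up to the end. The identity [P F = 1] provides this: the tangent
   raises [p] at a definite speed, so a ray along it cannot leave the tube, and points of the tube
   near an end are joined by broken lines of comparable length.

   Hypothesis 2 concerns [R_perp], whereas [V] is built on [R]. The two forms agree on the kernel of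
   [P], and differentiating the projector inside [R_perp] yields Hessian terms of [p] which are
   exactly those that [p' - rho (p)] brings into the error dynamics; symmetry of the Hessian closes
   the match.

   Solutions are produced by Picard iteration for a globally Lipschitz truncation of the field; the
   decay of [V] confines the flow to the region where the truncation changes nothing. The lower
   bound on [V'] serves invariance of the orbit in backward time. *)
Require Import Defs.
From mathcomp Require Import all_boot all_order all_algebra.
From mathcomp Require Import all_classical all_reals all_analysis.
From mathcomp Require Import ring lra.

Set Implicit Arguments.
Unset Strict Implicit.
Unset Printing Implicit Defensive.

Import Order.TTheory GRing.Theory Num.Theory.
Import numFieldNormedType.Exports.

Local Open Scope classical_set_scope.
Local Open Scope ring_scope.

(** * Comparison on an interval *)

Section RealInduction.
Context {R : realType}.

(** Connectedness of a segment in inductive form: the supremum of the times up to which [P] holds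
    throughout inherits [P] by the limit clause, and the right-neighbourhood clause prevents it from
    being less than [b]. *)
Lemma real_induction (P : R -> Prop) (a b : R) : a <= b -> P a ->
  (forall t, a <= t < b -> (forall u, a <= u <= t -> P u) ->
     \forall u \near t, t <= u <= b -> P u) ->
  (forall t, a < t <= b -> (forall u, a <= u < t -> P u) -> P t) ->
  forall t, a <= t <= b -> P t.
Proof.
move=> ab Pa Pr Pl t0 /andP[at0 t0b].
pose E := [set t | a <= t <= b /\ forall u, a <= u <= t -> P u].
have Ea : E a.
  split; first by rewrite lexx.
  by move=> u /andP[? ?]; have -> : u = a by apply/eqP; rewrite eq_le; apply/andP.
have Eub : ubound E b by move=> t [/andP[]].
have supE : has_sup E by split; [exists a | exists b].
have sb : sup E <= b by apply: ge_sup => //; exists a.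
have as_ : a <= sup E by apply: ub_le_sup => //; exists b.
have below u : a <= u < sup E -> P u.
  move=> /andP[au /(sup_gt (ex_intro _ a Ea)) [t [_ Et] ut]].
  by apply: Et; rewrite au ltW.
have Es : E (sup E).
  split; first by rewrite as_.
  move=> u /andP[au]; rewrite le_eqVlt => /orP[/eqP ->|us]; last first.
    by apply: below; rewrite au.
  move: as_; rewrite le_eqVlt => /orP[/eqP <- //|as_].
  by apply: Pl => //; rewrite as_.
have [sltb|] := ltP (sup E) b; last first.
  move=> bs; apply: Es.2; rewrite at0 (le_trans t0b) //.
have /nbhs_ballP[d /= d0 hd] := Pr _ (introT andP (conj as_ sltb)) Es.2.
have : E (Num.min b (sup E + d / 2)).
  have lem : a <= Num.min b (sup E + d / 2).
    by rewrite le_min ab /= (le_trans as_)// lerDl divr_ge0// ltW.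
  split; first by rewrite lem /= ge_min lexx.
  move=> u /andP[au]; rewrite le_min => /andP[ub us].
  have [ule|ugt] := leP u (sup E); first by apply: Es.2; rewrite au.
  apply: hd; last by rewrite ltW.
  rewrite /ball /= ltr0_norm; lra.
move=> /(ub_le_sup supE.2); rewrite le_eqVlt => /orP[/eqP e|].
  have : Num.min b (sup E + d/2) <= sup E by rewrite e.
  rewrite ge_min => /orP[|]; lra.
by move=> h; have : Num.min b (sup E + d/2) <= sup E by [exact: ltW];
  rewrite ge_min => /orP[|]; lra.
Qed.

Definition cont_in {W : normedModType R} (S : set R) (g : R -> W) (s : R) :=
  forall e : R, 0 < e -> \forall t \near s, S t -> `|g t - g s| <= e.

(** The growth condition is asked only below the level [c] because derivative estimates are
    available only inside the tube. The slope [e] is taken so small that [g a + e * (t - a)] stays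
    below [c] on the whole interval, so the condition remains applicable all along the induction. *)
Lemma dini (g : R -> R) (a b c : R) : a <= b -> g a < c ->
  (forall t, a <= t <= b -> cont_in [set u | a <= u <= b] g t) ->
  (forall t, a <= t < b -> g t < c -> forall e, 0 < e ->
    \forall u \near t, t <= u <= b -> g u <= g t + e * (u - t)) ->
  g b <= g a.
Proof.
move=> ab gac gc gd; apply/ler_addgt0Pr => e1 e10.
move: ab; rewrite le_eqVlt => /orP[/eqP <-|ab]; first by rewrite lerDl ltW.
pose e := Num.min (e1 / (b - a)) ((c - g a) / (2 * (b - a))).
have e0 : 0 < e by rewrite lt_min !divr_gt0 ?mulr_gt0 ?subr_gt0.
have ee1 : e * (b - a) <= e1.
  by rewrite -ler_pdivlMr ?subr_gt0// /e ge_min lexx.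
have ec : e * (b - a) < c - g a.
  apply: (@le_lt_trans _ _ ((c - g a) / 2)); last lra.
  rewrite -ler_pdivlMr ?subr_gt0// /e ge_min; apply/orP; right.
  by rewrite invfM mulrA.
suff H : forall t, a <= t <= b -> g t <= g a + e * (t - a).
  by apply: (le_trans (H b _)); rewrite ?lexx ?(ltW ab)// lerD2l.
have P_lt t : a <= t <= b -> g t <= g a + e * (t - a) -> g t < c.
  move=> /andP[ta tb] h; have : e * (t - a) <= e * (b - a).
    by rewrite ler_pM2l// lerB.
  lra.
apply: real_induction; first exact: ltW.
- by rewrite subrr mulr0 addr0.
- move=> t /andP[ta tb] /(_ t) /=; rewrite ta lexx => /(_ isT) ht.
  have := gd t; rewrite ta tb => /(_ isT (P_lt _ _ ht) e e0); rewrite ta ltW//.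
  move=> /(_ isT); apply: filterS => u hu tub; move: (hu tub); lra.
- move=> t /andP[ta tb] IH; apply/ler_addgt0Pr => e2 e20.
  have e30 : 0 < e2 / 2 by lra.
  have := gc t; rewrite (ltW ta) tb => /(_ isT _ e30) /nbhs_ballP[d /= d0 hd].
  pose u := Num.max a (t - d / 2).
  have ut : u < t by rewrite /u gt_max ta /=; lra.
  have au : a <= u by rewrite /u le_max lexx.
  have /hd : ball t d u.
    rewrite /ball /= gtr0_norm ?subr_gt0//.
    have : t - d/2 <= u by rewrite /u le_max lexx orbT.
    lra.
  rewrite /= au /= => /(_ (le_trans (ltW ut) tb)); rewrite ler_distl => /andP[h _].
  have := IH u; rewrite au ut => /(_ isT) h2.
  have : e * (u - a) <= e * (t - a) by rewrite ler_pM2l// lerB// ltW.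
  lra.
Qed.

End RealInduction.

Section DiniExceptional.
Context {R : realType}.

(** At a time of the relatively closed set [Z], growth is controlled only towards later times of
    [Z]. That suffices: a later time [u] outside [Z] is reached from the last time of [Z] before it
    through an interval free of [Z], on which [dini] applies. *)
Lemma dini_except (g : R -> R) (Z : set R) (a b c : R) : a <= b -> g a < c ->
  (forall t, a <= t <= b -> cont_in [set u | a <= u <= b] g t) ->
  (forall t, a <= t <= b -> ~ Z t -> \forall u \near t, a <= u <= b -> ~ Z u) ->
  (forall t, a <= t < b -> ~ Z t -> g t < c -> forall e, 0 < e ->
    \forall u \near t, t <= u <= b -> g u <= g t + e * (u - t)) ->
  (forall t, a <= t < b -> Z t -> g t < c -> forall e, 0 < e ->
    \forall u \near t, t <= u <= b -> Z u -> g u <= g t + e * (u - t)) ->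
  g b <= g a.
Proof.
move=> ab gac gc Zcl goff gon.
apply: (@dini _ g a b c) => // t /andP[ta tb] gtc e e0.
have tab : a <= t < b by rewrite ta.
have [Zt|/goff] := pselect (Z t); last by apply.
have near_c : \forall u \near t, t <= u <= b -> g u < c.
  have cg0 : 0 < (c - g t) / 2 by lra.
  have := gc t; rewrite ta ltW// => /(_ isT _ cg0); apply: filterS => u hu /andP[tu ub].
  have := hu _; rewrite /= (le_trans ta tu) ub => /(_ isT).
  rewrite ler_distl => /andP[_]; lra.
have /nbhs_ballP[d1 /= d10 hd1] := near_c.
have /nbhs_ballP[d2 /= d20 hd2] := gon t tab Zt gtc e e0.
exists (Num.min d1 d2); first by rewrite /= lt_min d10.
move=> u /=; rewrite lt_min => /andP[ud1 ud2] /andP[tu ub].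
have [Zu|nZu] := pselect (Z u); first by apply: hd2 => //; rewrite tu.
(* [sup E] is the last time of [Z] before [u]; it belongs to [Z] because the complement is
   relatively open. *)
pose E := [set r | t <= r <= u /\ Z r].
have Et : E t by split; [rewrite lexx | ].
have Eub : ubound E u by move=> r [/andP[]].
have supE : has_sup E by split; [exists t | exists u].
have su : sup E <= u by apply: ge_sup => //; exists t.
have ts : t <= sup E by apply: ub_le_sup => //; exists u.
have Zs : Z (sup E).
  apply: contrapT => nZs.
  have /nbhs_ballP[d /= d0 hd] := Zcl (sup E) (introT andP (conj (le_trans ta ts) (le_trans su ub))) nZs.
  have /(sup_gt (ex_intro _ t Et)) [r Er sr] : sup E - d < sup E by lra.
  have rs : r <= sup E by apply: ub_le_sup => //; exists u.
  case: Er => /andP[tr ru] Zr.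
  apply: (hd r) => //; last by rewrite (le_trans ta tr) (le_trans ru ub).
  by rewrite /ball /= ger0_norm ?subr_ge0//; lra.
have slu : sup E < u.
  by rewrite lt_neqAle su andbT; apply/eqP => h; apply: nZu; rewrite -h.
have gs : g (sup E) <= g t + e * (sup E - t).
  apply: hd2 => //; last by rewrite ts (le_trans su).
  rewrite /ball /=; move: ud2; rewrite !ler0_norm; lra.
apply: (@le_trans _ _ (g (sup E))); last first.
  by apply: (le_trans gs); rewrite lerD2l ler_pM2l// lerB.
apply/ler_addgt0Pr => e1 e10.
have gsc : g (sup E) < c.
  apply: hd1; last by rewrite ts (le_trans su).
  rewrite /ball /=; move: ud1; rewrite !ler0_norm; lra.
have e20 : 0 < Num.min e1 ((c - g (sup E)) / 2) by rewrite lt_min e10 /=; lra.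
have := gc (sup E); rewrite (le_trans ta ts) (le_trans su ub) => /(_ isT _ e20).
move=> /nbhs_ballP[d /= d0 hd].
(* At [sup E] itself nothing is known towards times outside [Z], so the comparison starts just after
   it, at a point where continuity costs at most [e1]. *)
pose v := Num.min u (sup E + d / 2).
have sv : sup E < v by rewrite lt_min slu /=; lra.
have vu : v <= u by rewrite ge_min lexx.
have vs : v <= sup E + d / 2 by rewrite ge_min lexx orbT.
have ts' := le_trans ta ts.
have sdv : ball (sup E) d v by rewrite /ball /= ltr0_norm ?subr_lt0//; lra.
have vab : a <= v <= b by rewrite (le_trans ts' (ltW sv)) (le_trans vu ub).
have := hd v sdv vab; rewrite ler_distl => /andP[_ hv].
have [gv1 gv2] : g v <= g (sup E) + e1 /\ g v < c.
  have m1 : Num.min e1 ((c - g (sup E)) / 2) <= e1 by rewrite ge_min lexx.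
  have m2 : Num.min e1 ((c - g (sup E)) / 2) <= (c - g (sup E)) / 2 by rewrite ge_min lexx orbT.
  split; lra.
apply: le_trans gv1.
apply: (@dini _ g v u c) => //.
- move=> r /andP[vr ru] e3 e30.
  have := gc r; rewrite (le_trans _ vr) ?(le_trans ru)// ?(le_trans _ (ltW sv))//.
  move=> /(_ isT _ e30); apply: filterS => w hw /andP[vw wu]; apply: hw => /=.
  by rewrite (le_trans wu ub) (le_trans _ vw)// (le_trans _ (ltW sv)).
- move=> r /andP[vr ru] grc e3 e30.
  have rab : a <= r < b.
    by rewrite (lt_le_trans ru ub) andbT (le_trans _ vr)// (le_trans _ (ltW sv)).
  have nZr : ~ Z r.
    move=> Zr; suff : r <= sup E by lra.
    apply: ub_le_sup; first by exists u.
    by split=> //; rewrite (ltW ru) andbT; lra.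
  have := goff r rab nZr grc e3 e30; apply: filterS => w hw /andP[rw wu].
  by apply: hw; rewrite rw (le_trans wu).
Qed.

End DiniExceptional.

(** * Derivatives relative to a subset of the line, and the mean value inequality *)

Section HasDerivative.
Context {R : realType}.

Lemma near_dist {W : normedModType R} (s : W) (e : R) : 0 < e -> \forall t \near s, `|t - s| < e.
Proof.
move=> e0; apply/nbhs_ballP; exists e => // t.
by rewrite -ball_normE /= distrC.
Qed.

(** A little-o form without division or limit object: it passes to subsets of [S] at once, and
    covers one-sided and two-sided derivatives together. It determines [d] only where [s] is an
    accumulation point of [S]. *)
Definition hderiv {W : normedModType R} (S : set R) (g : R -> W) (s : R) (d : W) :=
  forall e : R, 0 < e -> \forall t \near s, S t ->
    `|g t - g s - (t - s) *: d| <= e * `|t - s|.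

Section Normed.
Context {W : normedModType R}.
Implicit Types (S : set R) (g h : R -> W) (s : R) (d : W).

Lemma hderiv_sub S S' g s d : S' `<=` S -> hderiv S g s d -> hderiv S' g s d.
Proof. by move=> sub hg e /hg; apply: filterS => t ht /sub. Qed.

Lemma hderiv_near S S' g h s d : hderiv S g s d -> g s = h s ->
  (\forall t \near s, S' t -> S t /\ g t = h t) -> hderiv S' h s d.
Proof.
move=> hg gs gh e /hg hge; apply: filterS2 hge gh => t ht1 ht2 /ht2[St <-].
by rewrite -gs; exact: ht1.
Qed.

Lemma hderiv_bound S g s d : hderiv S g s d ->
  \forall t \near s, S t -> `|g t - g s| <= (`|d| + 1) * `|t - s|.
Proof.
move=> /(_ 1 ltr01); apply: filterS => t ht /ht {}ht.
rewrite -(subrK ((t - s) *: d) (g t - g s)) (le_trans (ler_normD _ _))// normrZ.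
by rewrite mulrDl addrC lerD// mulrC.
Qed.

Lemma hderiv_cont S g s d : hderiv S g s d -> cont_in S g s.
Proof.
move=> /hderiv_bound hb e e0.
have c0 : 0 < `|d| + 1 by rewrite ltr_wpDl.
have hn : \forall t \near s, `|t - s| < e / (`|d| + 1).
  by apply: near_dist; rewrite divr_gt0.
near=> t => St; apply: (@le_trans _ _ ((`|d| + 1) * `|t - s|)).
  by move: St; near: t.
by rewrite mulrC -ler_pdivlMr// ltW//; near: t.
Unshelve. all: by end_near. Qed.

Lemma hderiv_cst S c s : hderiv S (fun=> c) s (0 : W).
Proof.
by move=> e e0; near=> t => _; rewrite scaler0 subrr subr0 normr0 mulr_ge0// ltW.
Unshelve. all: by end_near. Qed.

Lemma hderivD S g h s d d' : hderiv S g s d -> hderiv S h s d' ->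
  hderiv S (fun t => g t + h t) s (d + d').
Proof.
move=> hg hh e e0; have e20 : 0 < e / 2 by rewrite divr_gt0.
apply: filterS2 (hg _ e20) (hh _ e20) => t ht1 ht2 St.
have -> : g t + h t - (g s + h s) - (t - s) *: (d + d') =
  (g t - g s - (t - s) *: d) + (h t - h s - (t - s) *: d').
  by rewrite scalerDr opprD opprD (addrACA (g t)) (addrACA (g t - g s)).
rewrite (le_trans (ler_normD _ _))// (le_trans (lerD (ht1 St) (ht2 St)))//.
by rewrite -mulrDl; lra.
Qed.

Lemma hderivZ S g s d (k : R) : hderiv S g s d -> hderiv S (fun t => k *: g t) s (k *: d).
Proof.
move=> hg e e0; have k0 : 0 < `|k| + 1 by rewrite ltr_wpDl.
have := hg (e / (`|k| + 1)) (divr_gt0 e0 k0); apply: filterS => t ht St.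
rewrite scalerA mulrC -scalerA -!scalerBr normrZ.
apply: (@le_trans _ _ ((`|k| + 1) * `|g t - g s - (t - s) *: d|)).
  by rewrite ler_wpM2r// lerDl.
rewrite mulrC -ler_pdivlMr//; apply: (le_trans (ht St)).
by rewrite mulrAC.
Qed.

Lemma hderivN S g s d : hderiv S g s d -> hderiv S (fun t => - g t) s (- d).
Proof.
move=> /(@hderivZ _ _ _ _ (-1)); rewrite scaleN1r => h e /h.
by apply: filterS => t; rewrite !scaleN1r.
Qed.

Lemma hderivB S g h s d d' : hderiv S g s d -> hderiv S h s d' ->
  hderiv S (fun t => g t - h t) s (d - d').
Proof. by move=> hg /hderivN; exact: hderivD. Qed.

End Normed.

Section NormedComp.
Context {W : normedModType R}.
Implicit Types (S : set R) (g h : R -> W) (s v : R) (d : W).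

Lemma hderiv_comp S J g (sg : R -> R) s v d : hderiv J sg s v ->
  (\forall t \near s, J t -> S (sg t)) -> hderiv S g (sg s) d ->
  hderiv J (g \o sg) s (v *: d).
Proof.
move=> hs JS hg e e0.
have v1 : 0 < `|v| + 1 by rewrite ltr_wpDl.
have d1 : 0 < `|d| + 1 by rewrite ltr_wpDl.
have e1 : 0 < e / 2 / (`|v| + 1) by rewrite !divr_gt0.
have e2 : 0 < e / 2 / (`|d| + 1) by rewrite !divr_gt0.
have /nbhs_ballP[r /= r0 hr] := hg _ e1.
have r20 : 0 < r / 2 by rewrite divr_gt0.
near=> t => Jt /=.
have h1 : `|sg t - sg s| <= (`|v| + 1) * `|t - s|.
  by move: Jt; near: t; exact: hderiv_bound.
have h2 : `|sg t - sg s - (t - s) *: v| <= e / 2 / (`|d| + 1) * `|t - s|.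
  by move: Jt; near: t; exact: hs.
have h3 : `|sg t - sg s| <= r / 2 by move: Jt; near: t; exact: (hderiv_cont hs).
have St : S (sg t) by move: Jt; near: t.
have hb : ball (sg s) r (sg t) by rewrite /ball /= distrC; lra.
have := hr _ hb St.
set A := g (sg t) - g (sg s) - (sg t - sg s) *: d => hA.
have -> : g (sg t) - g (sg s) - (t - s) *: (v *: d) = A + (sg t - sg s - (t - s) *: v) *: d.
  by rewrite (scalerBl (sg t - sg s) _ d) scalerA /A addrA subrK.
rewrite (le_trans (ler_normD _ _))// normrZ.
apply: (@le_trans _ _ (e / 2 * `|t - s| + e / 2 * `|t - s|)); last by rewrite -mulrDl; lra.
apply: lerD.
  apply: (le_trans hA); rewrite (le_trans (ler_wpM2l (ltW e1) h1))//.
  by rewrite mulrA divfK// gt_eqF.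
apply: (@le_trans _ _ (e / 2 / (`|d| + 1) * `|t - s| * (`|d| + 1))).
  by rewrite ler_pM// lerDl.
by rewrite mulrAC divfK// gt_eqF.
Unshelve. all: by end_near. Qed.

(** The norm is not differentiable, but [|u t - u a| - (g t - g a)] satisfies the one-sided growth
    bound of [dini]; hence the inequality holds with values in any normed space. *)
Lemma mean_value_compare (u d : R -> W) (g dg : R -> R) (a b : R) : a <= b ->
  (forall t, a <= t <= b -> hderiv [set r | a <= r <= b] u t (d t)) ->
  (forall t, a <= t <= b -> hderiv [set r | a <= r <= b] g t (dg t)) ->
  (forall t, a <= t <= b -> `|d t| <= dg t) ->
  `|u b - u a| <= g b - g a.
Proof.
move=> ab hu hg hd; pose h t := `|u t - u a| - (g t - g a).
suff : h b <= h a by rewrite /h (subrr (u a)) subrr subr0 normr0 subr_le0.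
have ineq s t : `| `|u t - u a| - `|u s - u a| | <= `|u t - u s|.
  by apply: (le_trans (ler_dist_dist _ _)); rewrite opprB addrA subrK.
apply: (@dini _ h a b (h a + 1)) => //; first by rewrite ltrDl.
- move=> t tab e e0; have e20 : 0 < e / 2 by rewrite divr_gt0.
  apply: filterS2 (hderiv_cont (hu t tab) e20) (hderiv_cont (hg t tab) e20) => r h1 h2 rab.
  have := h1 rab; have := h2 rab; have := ineq t r; rewrite /h !ler_norml; lra.
- move=> t tab _ e e0; have e20 : 0 < e / 2 by rewrite divr_gt0.
  have tab' : a <= t <= b by case/andP: tab => -> /ltW ->.
  apply: filterS2 (hu t tab' _ e20) (hg t tab' _ e20) => r h1 h2 /andP[tr rb].
  have rab : a <= r <= b by rewrite rb andbT (le_trans _ tr)//; case/andP: tab.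
  have := h1 rab; have := h2 rab; have := ineq t r.
  rewrite (@ger0_norm _ (r - t)) ?subr_ge0// /h => k1 k2 k3.
  have k4 : `|u r - u t| <= e / 2 * (r - t) + dg t * (r - t).
    rewrite -(subrK ((r - t) *: d t) (u r - u t)) (le_trans (ler_normD _ _))// lerD//.
    by rewrite normrZ ger0_norm ?subr_ge0// mulrC ler_wpM2r ?subr_ge0// hd.
  move: k2; rewrite ler_norml /GRing.scale /= => /andP[k5 _].
  move: k1; rewrite ler_norml => /andP[_ k6]; lra.
Qed.

Lemma mean_value_bound (u d : R -> W) (c : W) (k a b : R) : a <= b ->
  (forall t, a <= t <= b -> hderiv [set r | a <= r <= b] u t (d t)) ->
  (forall t, a <= t <= b -> `|d t - c| <= k) ->
  `|u b - u a - (b - a) *: c| <= k * (b - a).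
Proof.
move=> ab hu hd.
have -> : u b - u a - (b - a) *: c = (u b - b *: c) - (u a - a *: c).
  by rewrite scalerBl opprD addrACA -opprD.
rewrite mulrBr.
apply: (@mean_value_compare (fun t => u t - t *: c) (fun t => d t - c)
  (fun t => k * t) (fun=> k)) => // t tab.
  apply: hderivB; first exact: hu.
  by move=> e e0; apply: filterE => r _; rewrite -scalerBl subrr normr0 mulr_ge0// ltW.
move=> e e0; apply: filterE => r _; rewrite /GRing.scale /= [(r - t) * k]mulrC mulrBr subrr normr0.
by rewrite mulr_ge0// ltW.
Qed.

Lemma mean_value_bound2 (u d : R -> W) (S : set R) (c : W) (k a b : R) :
  [set t | Num.min a b <= t <= Num.max a b] `<=` S ->
  (forall t, S t -> hderiv S u t (d t)) ->
  (forall t, Num.min a b <= t <= Num.max a b -> `|d t - c| <= k) ->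
  `|u b - u a - (b - a) *: c| <= k * `|b - a|.
Proof.
move=> abS hu hd; have [ab|ba] := leP a b.
  move: abS hd; rewrite min_l// max_r// => abS hd.
  rewrite (@ger0_norm _ (b - a)) ?subr_ge0//; apply: (@mean_value_bound _ d) => // t tab.
  exact: (hderiv_sub abS (hu t (abS t tab))).
move: abS hd; rewrite min_r ?max_l ?(ltW ba)// => abS hd.
rewrite (@ltr0_norm _ (b - a)) ?subr_lt0// -normrN opprB.
have -> : (b - a) *: c - (u b - u a) = u a - u b - (a - b) *: c.
  by rewrite opprB -scaleNr opprB addrC.
rewrite ?opprB.
apply: (@mean_value_bound _ d _ _ _ _ (ltW ba)) => //.
by move=> t tab; exact: (hderiv_sub abS (hu t (abS t tab))).
Qed.

End NormedComp.
End HasDerivative.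

(** * One-sided derivatives of vector- and matrix-valued maps *)

Section MatrixNorm.
Context {R : realType}.

Lemma mx_entry_le {m n} (A : 'M[R]_(m, n)) i j : `|A i j| <= `|A|.
Proof.
rewrite [leRHS]/Num.norm /= mx_normrE.
by apply/bigmax_geP; right; exists (i, j).
Qed.

Lemma mx_norm_leP {m n} (A : 'M[R]_(m, n)) (c : R) : 0 <= c ->
  (forall i j, `|A i j| <= c) <-> `|A| <= c.
Proof.
move=> c0; split=> [h|h i j]; last exact: le_trans (mx_entry_le A i j) h.
rewrite [leLHS]/Num.norm /= mx_normrE; apply/bigmax_leP; split=> // -[i j] _.
Qed.

Lemma mulmx_norm {m n k} (A : 'M[R]_(m, n)) (B : 'M[R]_(n, k)) :
  `|A *m B| <= n%:R * `|A| * `|B|.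
Proof.
apply/mx_norm_leP => [|i j]; first by rewrite !mulr_ge0.
rewrite mxE (le_trans (ler_norm_sum _ _ _))//.
apply: (@le_trans _ _ (\sum_(l < n) `|A| * `|B|)); last first.
  by rewrite sumr_const card_ord -[X in X <= _]mulr_natl mulrA.
by apply: ler_sum => l _; rewrite normrM ler_pM// mx_entry_le.
Qed.

Lemma trmx_norm {m n} (A : 'M[R]_(m, n)) : `|A^T| = `|A|.
Proof.
have h p q (C : 'M[R]_(p, q)) : `|C^T| <= `|C|.
  by apply/mx_norm_leP => // i j; rewrite mxE mx_entry_le.
by apply/eqP; rewrite eq_le h -{1}(trmxK A) h.
Qed.

Lemma near_mxP {T : Type} {m n} (F : set_system T) (P : 'I_m -> 'I_n -> T -> Prop) : Filter F ->
  (forall i j, \forall x \near F, P i j x) -> \forall x \near F, forall i j, P i j x.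
Proof.
move=> FF h.
suff : \forall x \near F, forall ij : 'I_m * 'I_n, P ij.1 ij.2 x.
  by apply: filterS => x hx i j; exact: (hx (i, j)).
by apply: filter_forall => -[i j]; exact: h.
Qed.

End MatrixNorm.

Section HasDerivativeRules.
Context {R : realType}.
Implicit Types (S J : set R) (s : R).

Lemma hderivP {W : normedModType R} S (g : R -> W) s d :
  diff_quotient S g s --> d <-> hderiv S g s d.
Proof.
rewrite /diff_quotient; split.
- move=> /cvgrPdist_le h e e0; have := h e e0.
  rewrite !near_withinE /= => h1.
  have {h1} : \forall t \near s, t != s -> S t -> `|d - (t - s)^-1 *: (g t - g s)| <= e.
    exact: h1.
  apply: filterS => t ht St; have [->|ts] := eqVneq t s.
    by rewrite !subrr scale0r subr0 !normr0 mulr0.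
  have := ht ts St; have ts0 : 0 < `|t - s| by rewrite normr_gt0 subr_eq0.
  rewrite -(ler_pM2r ts0); apply: le_trans.
  rewrite mulrC -normrZ scalerBr scalerA mulfV ?subr_eq0// scale1r.
  by rewrite distrC.
- move=> h; apply/cvgrPdist_le => e e0; have := h e e0.
  rewrite !near_withinE /=; apply: filterS => t ht ts St.
  have ts0 : 0 < `|t - s| by rewrite normr_gt0 subr_eq0.
  rewrite -(ler_pM2r ts0); apply: le_trans (ht St).
  rewrite mulrC -normrZ scalerBr scalerA mulfV ?subr_eq0// scale1r.
  by rewrite distrC.
Qed.

Lemma hderiv_derive_on {W : normedModType R} S (g : R -> W) s :
  cvg (diff_quotient S g s) -> hderiv S g s (derive_on S g s).
Proof. by move=> h; apply/hderivP. Qed.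

(** Since [a < b], each point of the segment is an accumulation point of it, so the filter defining
    [derive_on] is proper and its limit is unique. *)
Lemma derive_onE {W : normedModType R} (a b : R) (g : R -> W) s d : a < b ->
  a <= s <= b -> hderiv `[a, b]%classic g s d -> derive_on `[a, b]%classic g s = d.
Proof.
move=> ab /andP[sa sb] /hderivP h.
have F : ProperFilter (within `[a, b]%classic s^').
  apply: Build_ProperFilter => P.
  have /nbhs_ballP[e /= e0 he] : \forall t \near s, t != s -> `[a, b]%classic t -> False by exact: P.
  have [slb|bs] := ltP s b.
  -   have h1 : s < Num.min b (s + e / 2) by rewrite lt_min slb /=; lra.
    apply: (he (Num.min b (s + e / 2))); first by rewrite /ball /= ltr0_norm ?subr_lt0//;
      have : Num.min b (s + e/2) <= s + e/2 by [rewrite ge_min lexx orbT]; lra.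
      by rewrite gt_eqF.
    by rewrite /= in_itv /= ge_min lexx (le_trans sa (ltW h1)).
  - have as_ : a < s by rewrite (lt_le_trans ab).
    have h1 : Num.max a (s - e / 2) < s by rewrite gt_max as_ /=; lra.
    apply: (he (Num.max a (s - e / 2))); first by rewrite /ball /= gtr0_norm ?subr_gt0//;
      have : s - e/2 <= Num.max a (s - e/2) by [rewrite le_max lexx orbT]; lra.
      by rewrite lt_eqF.
    by rewrite /= in_itv /= le_max lexx (le_trans (ltW h1) sb).
exact: (@cvg_lim _ (@norm_hausdorff _ _)) h.
Qed.

Lemma hderivM S (g h : R -> R) s (d d' : R) : hderiv S g s d -> hderiv S h s d' ->
  hderiv S (fun t => g t * h t) s (d * h s + g s * d').
Proof.
move=> hg hh e e0.
have g1 : 0 < `|g s| + 1 by rewrite ltr_wpDl.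
have h1 : 0 < `|h s| + 1 by rewrite ltr_wpDl.
have d1 : 0 < `|d| + 1 by rewrite ltr_wpDl.
have e1 : 0 < e / 3 / (`|g s| + 1) by rewrite !divr_gt0.
have e2 : 0 < e / 3 / (`|h s| + 1) by rewrite !divr_gt0.
have e3 : 0 < e / 3 / (`|d| + 1) by rewrite !divr_gt0.
near=> t => St.
have k1 : `|g t - g s - (t - s) * d| <= e / 3 / (`|h s| + 1) * `|t - s|.
  by move: St; near: t; exact: hg.
have k2 : `|h t - h s - (t - s) * d'| <= e / 3 / (`|g s| + 1) * `|t - s|.
  by move: St; near: t; exact: hh.
have k3 : `|h t - h s| <= e / 3 / (`|d| + 1).
  by move: St; near: t; exact: (hderiv_cont hh).
have k4 : `|g t - g s| <= (`|d| + 1) * `|t - s|.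
  by move: St; near: t; exact: (hderiv_bound hg).
have -> : g t * h t - g s * h s - (t - s) *: (d * h s + g s * d') =
  (g t - g s - (t - s) * d) * h s + g s * (h t - h s - (t - s) * d') +
  (g t - g s) * (h t - h s) by rewrite /GRing.scale /=; ring.
have -> : e * `|t - s| = e / 3 / (`|h s| + 1) * `|t - s| * (`|h s| + 1) +
  (`|g s| + 1) * (e / 3 / (`|g s| + 1) * `|t - s|) +
  (`|d| + 1) * `|t - s| * (e / 3 / (`|d| + 1)).
  by field; rewrite ?gt_eqF.
rewrite (le_trans (ler_normD _ _))// lerD//.
  rewrite (le_trans (ler_normD _ _))// lerD// normrM ler_pM// ?lerDl//.
by rewrite normrM ler_pM.
Unshelve. all: by end_near. Qed.

Lemma hderiv_sum {W : normedModType R} {I : Type} (r : seq I) S (g : I -> R -> W) s (d : I -> W) :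
  (forall i, hderiv S (g i) s (d i)) ->
  hderiv S (fun t => \sum_(i <- r) g i t) s (\sum_(i <- r) d i).
Proof.
move=> h; elim: r => [|i r IH].
  rewrite big_nil; apply: (hderiv_near (hderiv_cst S 0 s)); first by rewrite big_nil.
  by apply: filterE => t St; rewrite big_nil.
rewrite big_cons; apply: (hderiv_near (hderivD (h i) IH)); first by rewrite big_cons.
by apply: filterE => t St; rewrite big_cons.
Qed.

Lemma hderiv_mxP {m n} S (g : R -> 'M[R]_(m, n)) s d :
  hderiv S g s d <-> forall i j, hderiv S (fun t => g t i j) s (d i j).
Proof.
split=> [h i j e e0|h e e0].
  apply: filterS (h e e0) => t ht St; apply: le_trans (ht St).
  by apply: le_trans (mx_entry_le _ i j); rewrite !mxE.
have hF : Filter (nbhs s) by exact: nbhs_filter.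
have hij i j : \forall t \near nbhs s, S t -> `|g t i j - g s i j - (t - s) *: d i j| <= e * `|t - s|.
  exact: h.
have := near_mxP hF hij.
apply: filterS => t ht St; apply/mx_norm_leP; first by rewrite mulr_ge0// ltW.
by move=> i j; have := ht i j St; rewrite !mxE.
Qed.

Lemma hderiv_mulmx {m n k} S (g : R -> 'M[R]_(m, n)) (h : R -> 'M[R]_(n, k)) s d d' :
  hderiv S g s d -> hderiv S h s d' ->
  hderiv S (fun t => g t *m h t) s (d *m h s + g s *m d').
Proof.
move=> /hderiv_mxP hg /hderiv_mxP hh; apply/hderiv_mxP => i j.
rewrite !mxE -big_split /=.
apply: (@hderiv_near _ _ S S (fun t => \sum_l g t i l * h t l j)).
- by apply: hderiv_sum => l; exact: hderivM.
- by rewrite mxE.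
- by apply: filterE => t St; rewrite mxE.
Qed.

Lemma hderiv_trmx {m n} S (g : R -> 'M[R]_(m, n)) s d :
  hderiv S g s d -> hderiv S (fun t => (g t)^T) s d^T.
Proof.
move=> /hderiv_mxP hg; apply/hderiv_mxP => i j; rewrite mxE.
apply: (hderiv_near (hg j i)); first by rewrite mxE.
by apply: filterE => t St; rewrite mxE.
Qed.

Lemma hderiv_id S s : hderiv S (fun t => t) s (1 : R).
Proof.
move=> e e0; apply: filterE => t _; rewrite /GRing.scale /= mulr1 subrr normr0.
by rewrite mulr_ge0 // ltW.
Qed.


Lemma diff_near {V W : normedModType R} (g : V -> W) x e : differentiable g x -> 0 < e ->
  \forall y \near x, `|g y - g x - 'd g x (y - x)| <= e * `|y - x|.
Proof.
move=> /diff_locally /eqaddoP h e0.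
have /nbhs_ballP[r /= r0 hr] := h e e0.
apply/nbhs_ballP; exists r => // y; rewrite -ball_normE /= => xy.
have := hr (y - x); rewrite -ball_normE /= sub0r normrN distrC => /(_ xy) /=.
by rewrite !fctE subrK opprD addrA.
Qed.

Lemma hderiv_diff {V W : normedModType R} J (phi : R -> V) (g : V -> W) t v :
  hderiv J phi t v -> differentiable g (phi t) -> hderiv J (g \o phi) t ('d g (phi t) v).
Proof.
move=> hp hd e e0.
have v1 : 0 < `|v| + 1 by rewrite ltr_wpDl.
have [k k0 hk] := linear_lipschitz (diff_continuous hd).
have e1 : 0 < e / 2 / (`|v| + 1) by rewrite !divr_gt0.
have e2 : 0 < e / 2 / k by rewrite !divr_gt0.
have /nbhs_ballP[r /= r0 hr] := diff_near hd e1.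
have r20 : 0 < r / 2 by rewrite divr_gt0.
near=> u => Ju /=.
have h1 : `|phi u - phi t| <= (`|v| + 1) * `|u - t|.
  by move: Ju; near: u; exact: (hderiv_bound hp).
have h2 : `|phi u - phi t - (u - t) *: v| <= e / 2 / k * `|u - t|.
  by move: Ju; near: u; exact: hp.
have h3 : `|phi u - phi t| <= r / 2 by move: Ju; near: u; exact: (hderiv_cont hp).
have hb : ball (phi t) r (phi u) by rewrite -ball_normE /= distrC; lra.
have := hr _ hb => /= hA.
have -> : g (phi u) - g (phi t) - (u - t) *: 'd g (phi t) v =
  (g (phi u) - g (phi t) - 'd g (phi t) (phi u - phi t)) + 'd g (phi t) (phi u - phi t - (u - t) *: v).
  set D := phi u - phi t.
  have -> : 'd g (phi t) (D - (u - t) *: v) = 'd g (phi t) D - (u - t) *: 'd g (phi t) v.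
    by rewrite linearB linearZ.
  by rewrite addrA subrK.
rewrite (le_trans (ler_normD _ _))//.
apply: (@le_trans _ _ (e / 2 * `|u - t| + e / 2 * `|u - t|)); last by rewrite -mulrDl; lra.
apply: lerD.
  apply: (le_trans hA); rewrite (le_trans (ler_wpM2l (ltW e1) h1))//.
  by rewrite mulrA divfK// gt_eqF.
apply: (le_trans (hk _)); rewrite (le_trans (ler_wpM2l (ltW k0) h2))//.
by rewrite mulrA [k * _]mulrC divfK// gt_eqF.
Unshelve. all: by end_near. Qed.

Lemma hderiv_expR S (k : R) s : hderiv S (fun t => expR (k * t)) s (k * expR (k * s)).
Proof.
have h1 := hderivZ k (hderiv_id S s).
have h2 : differentiable (@expR R) (k *: s) by apply/derivable1_diffP; exact: derivable_expR.
have := hderiv_diff h1 h2.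
have -> : 'd (@expR R) (k *: s) (k *: 1) = k * expR (k * s).
  by rewrite linearZ /= -deriveE//; congr (_ * _); exact: derive_val.
by [].
Qed.

End HasDerivativeRules.

(** * Flow of a bounded Lipschitz field *)

Section Existence.
Context {R : realType}.

Lemma antiderivative (u : R -> R) : continuous u ->
  exists U : R -> R, forall t, 0 <= t -> hderiv setT U t (u t).
Proof.
(* Integrating from [-1] makes [0] an interior point, so the derivative is two-sided there as
   well. *)
move=> uc; exists (fun x => (\int[lebesgue_measure]_(t in [set` `[-1, x]]) u t)%R).
move=> t t0.
have xu : t < t + 1 by rewrite ltrDl.
have int : (@lebesgue_measure R).-integrable `[-1, t + 1] (EFin \o u).
  apply: continuous_compact_integrable; first exact: segment_compact.
  by apply: continuous_subspaceT.
have [|dU Ut] := continuous_FTC1_closed xu int _ (uc t); first lra.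
have := hderiv_diff (hderiv_id setT t) ((derivable1_diffP _ _).1 dU).
by rewrite -derive1E'//; [rewrite Ut | exact/derivable1_diffP].
Qed.

Lemma antiderivative_cV {n} (u : R -> 'cV[R]_n) : continuous u ->
  exists U : R -> 'cV[R]_n, forall t, 0 <= t -> hderiv setT U t (u t).
Proof.
move=> uc.
have H i : exists U : R -> R, forall t, 0 <= t -> hderiv setT U t (u t i 0).
  apply: antiderivative => s; apply/cvgrPdist_le => e e0.
  have /cvgrPdist_le/(_ e e0) := uc s; apply: filterS => t; apply: le_trans.
  by apply: le_trans (mx_entry_le _ i 0); rewrite !mxE.
have [U hU] := choice H.
exists (fun t => \col_i U i t) => t t0; apply/hderiv_mxP => i j.
rewrite ord1; apply: (hderiv_near (hU i t t0)); first by rewrite mxE.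
by apply: filterE => r _; rewrite mxE.
Qed.

Lemma geometric_cvg (a : nat -> R) (C : R) :
  (forall k, `|a k.+1 - a k| <= C * 2^-1 ^+ k) ->
  exists l, forall k, `|l - a k| <= 2 * C * 2^-1 ^+ k.
Proof.
move=> ha.
have C0 : 0 <= C by have := le_trans (normr_ge0 _) (ha 0%N); rewrite expr0 mulr1.
have bd k m : `|a (k + m)%N - a k| <= 2 * C * 2^-1 ^+ k * (1 - 2^-1 ^+ m).
  elim: m => [|m IH]; first by rewrite addn0 subrr normr0 expr0 subrr mulr0.
  rewrite addnS -(subrK (a (k + m)%N) (a (k + m).+1)) -addrA.
  rewrite (le_trans (ler_normD _ _))// (le_trans (lerD (ha _) IH))//.
  rewrite exprD exprS; lra.
have bd' k m : (k <= m)%N -> `|a m - a k| <= 2 * C * 2^-1 ^+ k.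
  move=> km; rewrite -(subnKC km); apply: (le_trans (bd _ _)).
  rewrite ler_piMr//; first by rewrite !mulr_ge0// exprn_ge0.
have small e : 0 < e -> exists k, 2 * C * 2^-1 ^+ k < e.
  move=> e0; have C1 : 0 < 2 * C + 1 by rewrite ltr_wpDl// mulr_ge0.
  have e1 : 0 < e / (2 * C + 1) by rewrite divr_gt0.
  have h12 : `|2^-1 : R| < 1 by rewrite ger0_norm//; lra.
  have /cvgrPdist_lt/(_ _ e1) [N _ hN] := cvg_expr h12.
  exists N; have := hN N (leqnn N).
  rewrite /= sub0r normrN ger0_norm ?exprn_ge0// ltr_pdivlMr// mulrC.
  by apply: le_lt_trans; rewrite ler_wpM2r ?exprn_ge0// lerDl.
have cv : cvg (a @ \oo).
  apply: cauchy_cvg; apply/cauchy_exP => e e0.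
  have [N hN] := small e e0; exists (a N); exists N => // m /= Nm.
  by rewrite -ball_normE /= distrC (le_lt_trans (bd' _ _ Nm)).
exists (lim (a @ \oo)) => k; apply/ler_addgt0Pr => e e0.
have /cvgrPdist_le/(_ e e0) [N _ hN] := cv.
have := hN (maxn N k) (leq_maxl _ _); have := bd' k (maxn N k) (leq_maxr _ _).
move=> h1 h2; rewrite -(subrK (a (maxn N k)) (lim _)) -addrA.
by apply: (le_trans (ler_normD _ _)); rewrite [leRHS]addrC; exact: lerD.
Qed.

Lemma geometric_cvg_cV {n} (a : nat -> 'cV[R]_n) (C : R) :
  (forall k, `|a k.+1 - a k| <= C * 2^-1 ^+ k) ->
  exists l, forall k, `|l - a k| <= 2 * C * 2^-1 ^+ k.
Proof.
move=> ha.
have C0 : 0 <= C by have := le_trans (normr_ge0 _) (ha 0%N); rewrite expr0 mulr1.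
have H i : exists l : R, forall k, `|l - a k i 0| <= 2 * C * 2^-1 ^+ k.
  apply: geometric_cvg => k; apply: le_trans (ha k).
  by apply: le_trans (mx_entry_le _ i 0); rewrite !mxE.
have [l hl] := choice H; exists (\col_i l i) => k.
apply/mx_norm_leP => [|i j]; first by rewrite !mulr_ge0// exprn_ge0.
by rewrite !mxE ord1.
Qed.

(** Iterates are compared in the weight [expR (2 * L * t)], for which the Picard map contracts by
    one half on the whole half-line; no short-time solutions have to be glued. *)
Lemma picard_forward {n} (G : 'cV[R]_n -> 'cV[R]_n) (L M : R) (x0 : 'cV[R]_n) : 0 < L ->
  (forall x y, `|G x - G y| <= L * `|x - y|) -> (forall x, `|G x| <= M) ->
  exists2 phi : R -> 'cV[R]_n, phi 0 = x0 &
    forall t, 0 <= t -> hderiv [set r | 0 <= r] phi t (G (phi t)).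
Proof.
move=> L0 GL GM.
pose P := [set r : R | 0 <= r].
have M0 : 0 <= M by apply: le_trans (GM x0).
have step (u : R -> 'cV[R]_n) : {v : R -> 'cV[R]_n | continuous u ->
    [/\ continuous v, v 0 = x0 & forall t, 0 <= t -> hderiv P v t (G (u t))]}.
  apply: cid; have [uc|] := pselect (continuous u); last by exists u.
  have Guc : continuous (fun t => G (u t)).
    move=> s; apply/cvgrPdist_le => e e0.
    have /cvgrPdist_le/(_ (e / L)) := uc s; rewrite divr_gt0// => /(_ isT).
    apply: filterS => t ht; apply: (le_trans (GL _ _)).
    by rewrite mulrC -ler_pdivlMr.
  have [U hU] := antiderivative_cV Guc.
  (* The antiderivative is controlled only for nonnegative times; the absolute value extends the
     iterate to a continuous function on the line, as the next iteration step requires. *)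
  exists (fun t => x0 + (U `|t| - U 0)) => _; split.
  - move=> s; apply: cvgD; first exact: cvg_cst.
    apply: cvgB; last exact: cvg_cst.
    apply/cvgrPdist_le => e e0.
    have /nbhs_ballP[r /= r0 hr] := hderiv_cont (hU _ (normr_ge0 s)) e0.
    apply: filterS (near_dist s r0) => t ts; rewrite distrC; apply: hr => //.
    rewrite /ball /= distrC; apply: le_lt_trans ts; exact: ler_dist_dist.
  - by rewrite normr0 subrr addr0.
  - move=> t t0; have h1 := hderiv_sub (@subsetT _ P) (hU t t0).
    have h2 := hderivD (hderiv_cst P (x0 - U 0) t) h1; rewrite add0r in h2.
    apply: (hderiv_near h2); first by rewrite ger0_norm// addrC [RHS]addrCA.
    by apply: filterE => r r0; split=> //; rewrite ger0_norm// addrC [RHS]addrCA.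
pose ph := fix ph k := if k is k'.+1 then sval (step (ph k')) else fun=> x0.
have phc k : continuous (ph k).
  elim: k => [|k IH] /=; first by move=> s; exact: cvg_cst.
  by case: (svalP (step (ph k)) IH).
have ph0 k : ph k 0 = x0.
  by case: k => [//|k] /=; case: (svalP (step (ph k)) (phc k)).
have phd k t : 0 <= t -> hderiv P (ph k.+1) t (G (ph k t)).
  by case: (svalP (step (ph k)) (phc k)) => _ _; apply.
have subP b : [set r | 0 <= r <= b] `<=` P by move=> r /= /andP[].
(* The first increment is at most [|G x0| * t], and [2 * L * t <= expR (2 * L * t)]; this fixes
   [C]. *)
pose C := `|G x0| / (2 * L).
have expd S t : hderiv S (fun t => expR (2 * L * t)) t (2 * L * expR (2 * L * t)).
  exact: hderiv_expR.
have inc k t : 0 <= t -> `|ph k.+1 t - ph k t| <= C * expR (2 * L * t) * 2^-1 ^+ k.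
  elim: k t => [|k IH] t t0.
    rewrite expr0 mulr1 /=.
    have h : `|ph 1%N t - ph 1%N 0 - (t - 0) *: 0| <= `|G x0| * `|t - 0|.
      apply: (@mean_value_bound2 R _ _ (fun=> G x0) P).
      - by rewrite min_l// max_r// => r /= /andP[].
      - by move=> r r0; exact: phd.
      - by move=> r _; rewrite subr0.
    rewrite scaler0 !subr0 ph0 (ger0_norm t0) in h.
    apply: (le_trans h).
    rewrite /C mulrAC -mulrA ler_wpM2l// ler_pdivlMr ?mulr_gt0// mulrC.
    by have := expR_ge1Dx (2 * L * t); lra.
  pose D := C * 2^-1 ^+ k.+1.
  have := @mean_value_compare R _ (fun t => ph k.+2 t - ph k.+1 t)
    (fun t => G (ph k.+1 t) - G (ph k t)) (fun t => D *: expR (2 * L * t))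
    (fun t => D *: (2 * L * expR (2 * L * t))) 0 t t0.
  rewrite !ph0 subrr subr0 => h; apply: (le_trans (h _ _ _)).
  - move=> r /andP[r0 _]; apply: (hderiv_sub (@subP t)).
    by apply: hderivB; exact: phd.
  - by move=> r _; apply: hderivZ; exact: expd.
  - move=> r /andP[r0 _]; apply: (le_trans (GL _ _)).
    apply: (le_trans (ler_wpM2l (ltW L0) (IH r r0))).
    by rewrite /D /GRing.scale /= exprS; lra.
  - rewrite mulr0 expR0 /D /GRing.scale /= mulr1 exprS.
    have : 0 <= C * 2^-1 ^+ k by rewrite mulr_ge0// ?exprn_ge0// divr_ge0// mulr_ge0// ltW.
    by lra.
have lim_ex t : {l : 'cV[R]_n | 0 <= t ->
    forall k, `|l - ph k t| <= 2 * (C * expR (2 * L * t)) * 2^-1 ^+ k}.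
  apply: cid; have [t0|] := leP 0 t; last by exists 0.
  by have [l hl] := geometric_cvg_cV (fun k => inc k t t0); exists l.
pose phi t := sval (lim_ex t).
have phiP t : 0 <= t -> forall k, `|phi t - ph k t| <= 2 * (C * expR (2 * L * t)) * 2^-1 ^+ k.
  exact: svalP (lim_ex t).
have small (K e : R) : 0 < e -> exists k, K * 2^-1 ^+ k <= e.
  move=> e0; have K1 : 0 < `|K| + 1 by rewrite ltr_wpDl.
  have e1 : 0 < e / (`|K| + 1) by rewrite divr_gt0.
  have h12 : `|2^-1 : R| < 1 by rewrite ger0_norm//; lra.
  have /cvgrPdist_lt/(_ _ e1) [N _ hN] := cvg_expr h12.
  exists N; have := hN N (leqnn N).
  rewrite /= sub0r normrN ger0_norm ?exprn_ge0// ltr_pdivlMr// mulrC => h.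
  apply: le_trans (ltW h); rewrite ler_wpM2r ?exprn_ge0//.
  by rewrite (le_trans (ler_norm _))// lerDl.
exists phi.
  apply/eqP; rewrite -subr_eq0 -normr_le0; apply/ler_addgt0Pr => e e0.
  have [k hk] := small (2 * (C * expR (2 * L * 0))) e e0.
  by rewrite add0r -(ph0 k) (le_trans (phiP 0 _ k)).
have phiL s t : 0 <= s -> 0 <= t -> `|phi s - phi t| <= M * `|s - t|.
  move=> s0 t0; apply/ler_addgt0Pr => e e0; have e20 : 0 < e / 2 by rewrite divr_gt0.
  have [k hk] := small (2 * (C * expR (2 * L * s))) _ e20.
  have [k' hk'] := small (2 * (C * expR (2 * L * t))) _ e20.
  pose l := (maxn k k').+1.
  have dec (K : R) i j : 0 <= K -> (i <= j)%N -> K * 2^-1 ^+ j <= K * 2^-1 ^+ i.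
    move=> K0 ij; rewrite ler_wpM2l//.
    by apply: ler_wiXn2l => //; lra.
  have C0 r : 0 <= 2 * (C * expR (2 * L * r)).
    by rewrite !mulr_ge0 ?expR_ge0// invr_ge0 mulr_ge0// ltW.
  have h1 : `|phi s - ph l s| <= e / 2.
    apply: (le_trans (phiP s s0 l)); apply: le_trans hk; apply: dec => //.
    by rewrite /l leqW// leq_maxl.
  have h2 : `|phi t - ph l t| <= e / 2.
    apply: (le_trans (phiP t t0 l)); apply: le_trans hk'; apply: dec => //.
    by rewrite /l leqW// leq_maxr.
  have h3 : `|ph l s - ph l t - (s - t) *: 0| <= M * `|s - t|.
    apply: (@mean_value_bound2 R _ (ph l) (fun r => G (ph (maxn k k') r)) P).
    - by move=> r /= /andP[+ _]; apply: le_trans; rewrite le_min s0 t0.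
    - by move=> r r0; exact: phd.
    - by move=> r _; rewrite subr0.
  rewrite scaler0 subr0 in h3.
  have -> : phi s - phi t = (phi s - ph l s) + (ph l s - ph l t) - (phi t - ph l t).
    by rewrite addrA subrK opprB addrA subrK.
  rewrite (le_trans (ler_normB _ _))// (le_trans (lerD (ler_normD _ _) (lexx _)))//.
  by have := lerD (lerD h1 h3) h2; lra.
(* The derivative of the limit is read off a quadratic remainder. The mean value inequality gives it
   for each iterate up to errors governed by the index [k], and [k] is sent to infinity through
   [e'], so derivatives never have to be exchanged with limits. *)
have quad s t : 0 <= s -> 0 <= t ->
    `|phi s - phi t - (s - t) *: G (phi t)| <= L * M * `|s - t| * `|s - t|.
  move=> s0 t0; apply/ler_addgt0Pr => e e0.
  pose T := Num.max s t.
  pose K := 2 * (C * expR (2 * L * T)).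
  have K0 : 0 <= K by rewrite !mulr_ge0 ?expR_ge0// invr_ge0 mulr_ge0// ltW.
  pose e' := e / (2 + L * `|s - t|).
  have e'0 : 0 < e' by rewrite divr_gt0// ltr_pwDl// mulr_ge0// ltW.
  have [k hk] := small K _ e'0.
  have KP r : 0 <= r <= T -> forall j, `|phi r - ph j r| <= K * 2^-1 ^+ j.
    move=> /andP[r0 rT] j; apply: (le_trans (phiP r r0 j)).
    rewrite ler_wpM2r ?exprn_ge0// /K ler_wpM2l// ler_wpM2l//.
      by rewrite divr_ge0// mulr_ge0// ltW.
    by rewrite ler_expR ler_wpM2l// mulr_ge0// ltW.
  have sT : 0 <= s <= T by rewrite s0 le_max lexx.
  have tT : 0 <= t <= T by rewrite t0 le_max lexx orbT.
  have hk1 : K * 2^-1 ^+ k.+1 <= e'.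
    by apply: le_trans hk; rewrite ler_wpM2l// ler_wiXn2l//; lra.
  have h1 := le_trans (KP s sT k.+1) hk1.
  have h2 := le_trans (KP t tT k.+1) hk1.
  have h3 : `|ph k.+1 s - ph k.+1 t - (s - t) *: G (phi t)| <= L * (e' + M * `|s - t|) * `|s - t|.
    apply: (@mean_value_bound2 R _ (ph k.+1) (fun r => G (ph k r)) P).
    - by move=> r /= /andP[+ _]; apply: le_trans; rewrite le_min s0 t0.
    - by move=> r r0; exact: phd.
    - move=> r /andP[r1 r2].
      have r0 : 0 <= r by apply: le_trans r1; rewrite le_min s0 t0.
      have rT : 0 <= r <= T by rewrite r0 /T maxC.
      apply: (le_trans (GL _ _)); rewrite ler_wpM2l ?(ltW L0)//.
      rewrite -(subrK (phi r) (ph k r)) -addrA (le_trans (ler_normD _ _))// lerD//.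
        by rewrite distrC (le_trans (KP r rT k)).
      apply: (le_trans (phiL _ _ r0 t0)); rewrite ler_wpM2l//.
      move: r1 r2; have [ts|st] := leP t s.
        rewrite (@ger0_norm _ (s - t)) ?subr_ge0// => r1 r2.
        by rewrite ger0_norm ?subr_ge0// lerB.
      rewrite (@ltr0_norm _ (s - t)) ?subr_lt0// => r1 r2.
      by rewrite ler0_norm ?subr_le0//; lra.
  have -> : phi s - phi t - (s - t) *: G (phi t) = (phi s - ph k.+1 s) +
      (ph k.+1 s - ph k.+1 t - (s - t) *: G (phi t)) - (phi t - ph k.+1 t).
    by apply/colP => i; rewrite !mxE; ring.
  rewrite (le_trans (ler_normB _ _))// (le_trans (lerD (ler_normD _ _) (lexx _)))//.
  apply: (le_trans (lerD (lerD h1 h3) h2)).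
  have -> : e = e' * (2 + L * `|s - t|) by rewrite divfK// gt_eqF// ltr_pwDl// mulr_ge0// ltW.
  by lra.
move=> t t0 e e0.
have LM : 0 < L * M + 1 by rewrite ltr_wpDl// mulr_ge0// ltW.
apply: filterS (near_dist t (divr_gt0 e0 LM)) => s st s0.
apply: (le_trans (quad s t s0 t0)); rewrite ler_wpM2r//.
move: st; rewrite ltr_pdivlMr// => st; apply: le_trans (ltW st).
by rewrite mulrC ler_wpM2l// lerDl.
Qed.

(** Backward time is forward time for [- G]; the two halves fit at [0] because both one-sided
    derivatives equal [G x0]. *)
Lemma picard {n} (G : 'cV[R]_n -> 'cV[R]_n) (L M : R) (x0 : 'cV[R]_n) : 0 < L ->
  (forall x y, `|G x - G y| <= L * `|x - y|) -> (forall x, `|G x| <= M) ->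
  exists2 phi : R -> 'cV[R]_n, phi 0 = x0 & forall t, hderiv setT phi t (G (phi t)).
Proof.
move=> L0 GL GM.
have [p1 p10 p1d] := picard_forward x0 L0 GL GM.
have [p2 p20 p2d] : exists2 phi : R -> 'cV[R]_n, phi 0 = x0 &
    forall t, 0 <= t -> hderiv [set r | 0 <= r] phi t (- G (phi t)).
  apply: (@picard_forward n (fun x => - G x) L M x0 L0) => [x y|x].
    by rewrite -opprD normrN.
  by rewrite normrN.
pose q t := p2 (- t).
have qd t : t <= 0 -> hderiv [set r | r <= 0] q t (G (q t)).
  move=> t0; have h0 : hderiv [set r | r <= 0] (fun t : R => - t) t (- 1).
    exact: hderivN (hderiv_id _ _).
  have Nt0 : 0 <= - t by rewrite oppr_ge0.
  have := hderiv_comp h0 _ (p2d _ Nt0); rewrite scaleN1r opprK; apply.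
  by apply: filterE => r; rewrite /= oppr_ge0.
exists (fun t => if 0 <= t then p1 t else q t); first by rewrite lexx.
move=> t; have [t0|t0|t0] := ltgtP 0 t; last first.
- rewrite -t0; have := p1d 0 (lexx 0) => h1; have := qd 0 (lexx 0) => h2 e e0.
  have q0 : q 0 = p1 0 by rewrite /q oppr0 p10 p20.
  rewrite lexx -q0 in h1 *.
  apply: filterS2 (h1 e e0) (h2 e e0) => r h3 h4 _.
  have [r0|r0] := leP 0 r; first by rewrite -q0 in h3; apply: h3.
  by apply: h4; exact: ltW.
- have h := qd t (ltW t0); apply: (hderiv_near h); first by rewrite leNgt t0.
  have t0' : 0 < - t by rewrite oppr_gt0.
  apply: filterS (near_dist t t0') => r; rewrite ltr_norml => /andP[_ rt] _.
  have r0 : r < 0 by lra.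
  by split; [exact: ltW | rewrite leNgt r0].
- have h := p1d t (ltW t0); apply: (hderiv_near h); first by rewrite (ltW t0).
  apply: filterS (near_dist t t0) => r; rewrite ltr_norml => /andP[rt _] _.
  have r0 : 0 < r by lra.
  by split; [exact: ltW | rewrite (ltW r0)].
Qed.
End Existence.

(** * Quadratic forms and null sets *)

Section QuadraticForms.
Context {R : realType} {n : nat}.
Implicit Types (M : 'M[R]_n) (u v w : 'cV[R]_n).

Definition bform M u v : R := (u^T *m M *m v) 0 0.

Lemma bformDl M u w v : bform M (u + w) v = bform M u v + bform M w v.
Proof. by rewrite /bform linearD /= !mulmxDl mxE. Qed.

Lemma bformDr M u w v : bform M v (u + w) = bform M v u + bform M v w.
Proof. by rewrite /bform mulmxDr mxE. Qed.

Lemma bformZl M k u v : bform M (k *: u) v = k * bform M u v.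
Proof. by rewrite /bform linearZ /= -!scalemxAl mxE. Qed.

Lemma bformZr M k u v : bform M u (k *: v) = k * bform M u v.
Proof. by rewrite /bform -scalemxAr mxE. Qed.

Lemma bformNl M u v : bform M (- u) v = - bform M u v.
Proof. by rewrite -scaleN1r bformZl mulN1r. Qed.

Lemma bformNr M u v : bform M u (- v) = - bform M u v.
Proof. by rewrite -scaleN1r bformZr mulN1r. Qed.

Lemma bformDm M M' u v : bform (M + M') u v = bform M u v + bform M' u v.
Proof. by rewrite /bform mulmxDr mulmxDl mxE. Qed.

Lemma bformNm M u v : bform (- M) u v = - bform M u v.
Proof. by rewrite /bform mulmxN mulNmx mxE. Qed.

Lemma bformZm M (k : R) u v : bform (k *: M) u v = k * bform M u v.
Proof. by rewrite /bform -scalemxAr -scalemxAl mxE. Qed.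

Lemma bform_tr M u v : bform M^T u v = bform M v u.
Proof.
rewrite /bform -[in RHS](trmxK (v^T *m M *m u)) [in RHS]mxE.
by rewrite !trmx_mul trmxK mulmxA.
Qed.

Lemma bform_norm M u v : `|bform M u v| <= n%:R ^+ 2 * `|M| * `|u| * `|v|.
Proof.
apply: le_trans (mx_entry_le _ 0 0) _; apply: le_trans (mulmx_norm _ _) _.
rewrite expr2 -!mulrA ler_wpM2l// !mulrA ler_wpM2r//.
apply: le_trans (mulmx_norm _ _) _; rewrite trmx_norm.
by rewrite -!mulrA ler_wpM2l// mulrC.
Qed.

Lemma mx_norm_sqr_le v (K : R) : 0 <= K -> (forall i, v i 0 ^+ 2 <= K) -> `|v| ^+ 2 <= K.
Proof.
move=> K0 h; rewrite -(sqr_sqrtr K0) lerXn2r ?nnegrE ?sqrtr_ge0//.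
apply/mx_norm_leP; first exact: sqrtr_ge0.
by move=> i j; rewrite ord1 -sqrtr_sqr ler_wsqrtr.
Qed.

(* With w_j = M^-1 e_j, expanding [0 <= q (v - t w_j)] at the optimal [t] gives
   [v_j ^ 2 <= q w_j * q v], without any compactness of the sphere. *)
Lemma posdef_lower M : posdef M -> exists2 c : R, 0 < c & forall v, c * `|v| ^+ 2 <= bform M v v.
Proof.
move=> [Msym Mpos].
have Mge0 v : 0 <= bform M v v.
  by have [->|/Mpos/ltW//] := eqVneq v 0; rewrite /bform mulmx0 mxE.
have Mu : M \in unitmx.
  rewrite -row_free_unit; apply: inj_row_free => v vM.
  apply/eqP; apply: contraT => v0.
  have := Mpos v^T; rewrite trmxK vM mul0mx mxE ltxx => h; apply: h.
  by apply: contraNneq v0 => h; rewrite -(trmxK v) h trmx0.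
pose w j : 'cV[R]_n := invmx M *m delta_mx j 0.
have Mw j : M *m w j = delta_mx j 0 by rewrite mulmxA mulmxV// mul1mx.
have vw v j : bform M v (w j) = v j 0.
  rewrite /bform -mulmxA Mw mxE (bigD1 j)//= big1 ?addr0; first by rewrite !mxE !eqxx mulr1.
  by move=> i ij; rewrite !mxE (negbTE ij) mulr0.
have wv v j : bform M (w j) v = v j 0 by rewrite -bform_tr Msym vw.
pose b j := bform M (w j) (w j).
have b0 j : 0 < b j.
  apply: Mpos; apply/eqP => h; have := Mw j; rewrite h mulmx0 => /matrixP/(_ j 0).
  by rewrite !mxE !eqxx /= => /eqP; rewrite eq_sym oner_eq0.
have key v j : v j 0 ^+ 2 <= b j * bform M v v.
  have := Mge0 (v - (v j 0 / b j) *: w j).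
  rewrite bformDl !bformDr !bformNl !bformNr !bformZl !bformZr vw wv -/(b j) => h.
  rewrite mulrC -ler_pdivrMr//.
  have e : v j 0 / b j * (v j 0 / b j * b j) = v j 0 ^+ 2 / b j.
    by field; rewrite gt_eqF.
  have e2 : v j 0 / b j * v j 0 = v j 0 ^+ 2 / b j by rewrite mulrAC -expr2.
  by move: h; rewrite -/(b j) e e2; lra.
have S0 : 0 < 1 + \sum_j b j by rewrite ltr_pwDl// sumr_ge0// => j _; exact: ltW.
exists (1 + \sum_j b j)^-1; first by rewrite invr_gt0.
move=> v; rewrite mulrC ler_pdivrMr// mulrC.
apply: mx_norm_sqr_le => [|j]; first by rewrite mulr_ge0// ltW.
apply: (le_trans (key v j)); rewrite ler_wpM2r//.
rewrite (bigD1 j)//= addrCA lerDl addr_ge0// sumr_ge0// => i _; exact: ltW.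
Qed.

Lemma norm_le_enorm v : `|v| <= enorm v.
Proof.
apply/mx_norm_leP => [|i j]; first exact: sqrtr_ge0.
rewrite ord1 -sqrtr_sqr ler_wsqrtr// (bigD1 i)//= lerDl sumr_ge0// => k _.
exact: sqr_ge0.
Qed.

Lemma enorm_le_norm v : enorm v <= n%:R * `|v|.
Proof.
rewrite /enorm -[leRHS]ger0_norm ?mulr_ge0// -sqrtr_sqr ler_wsqrtr//.
apply: (@le_trans _ _ (\sum_(i < n) `|v| ^+ 2)).
  by apply: ler_sum => i _; rewrite -real_normK ?num_real// lerXn2r ?nnegrE// mx_entry_le.
rewrite sumr_const card_ord -[X in X <= _]mulr_natl exprMn ler_wpM2r ?exprn_ge0//.
by rewrite -natrX ler_nat; case: (n) => // k; rewrite expnS leq_pmulr.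
Qed.

Lemma enorm_ge0 v : 0 <= enorm v.
Proof. exact: sqrtr_ge0. Qed.

End QuadraticForms.

(** * Null sets: finite covers, unions, Lipschitz graphs *)

Section NullSets.
Context {R : realType}.

Definition box_vol {n} (ab : 'cV[R]_n * 'cV[R]_n) : R := \prod_i (ab.2 i 0 - ab.1 i 0).

Lemma lebesgue_null_seq {n} (N : set 'cV[R]_n.+1) :
  (forall e : R, 0 < e -> exists s : seq ('cV[R]_n.+1 * 'cV[R]_n.+1),
    [/\ forall ab, ab \in s -> forall i, ab.1 i 0 <= ab.2 i 0,
        forall x, N x -> exists2 ab, ab \in s & forall i, ab.1 i 0 <= x i 0 <= ab.2 i 0
      & \sum_(ab <- s) box_vol ab <= e]) -> lebesgue_null N.
Proof.
move=> h e e0; have [s [s1 s2 s3]] := h e e0.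
(* Past the end of [s] the default is the degenerate box at the origin. Its volume is zero because
   the dimension is positive; an empty product would be [1]. *)
exists (fun k => (nth (0, 0) s k).1), (fun k => (nth (0, 0) s k).2); split.
- move=> k i; have [ks|sk] := ltnP k (size s); first by apply: s1; rewrite mem_nth.
  by rewrite nth_default.
- move=> x /s2[ab abs xab]; exists (index ab s) => //=.
  by rewrite nth_index.
- move=> j; apply: le_trans s3.
  elim: s s1 {s2} j => [|ab s IH] s1 j.
    rewrite big_nil big1// => k _; rewrite nth_nil /=.
    by rewrite big_ord_recl mxE subrr mul0r.
  have vol0 : 0 <= box_vol ab.
    by apply: prodr_ge0 => i _; rewrite subr_ge0 s1// mem_head.
  have s1' : forall ab0, ab0 \in s -> forall i, ab0.1 i 0 <= ab0.2 i 0.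
    by move=> ab' h'; apply: s1; rewrite in_cons h' orbT.
  rewrite big_cons; case: j => [|j].
    by rewrite big_ord0 addr_ge0//; have := IH s1' 0%N; rewrite big_ord0.
  by rewrite big_ord_recl /= lerD2l; exact: IH.
Qed.

Lemma lebesgue_nullU {n} (N N' : set 'cV[R]_n) :
  lebesgue_null N -> lebesgue_null N' -> lebesgue_null (N `|` N').
Proof.
move=> h h' e e0; have e20 : 0 < e / 2 by rewrite divr_gt0.
have [a [b [h1 h2 h3]]] := h _ e20; have [a' [b' [h1' h2' h3']]] := h' _ e20.
exists (fun k => if odd k then a k./2 else a' k./2), (fun k => if odd k then b k./2 else b' k./2); split.
- by move=> k i; case: ifP.
- move=> x [/h2[k _ hk]|/h2'[k _ hk]].
    by exists (k.*2.+1) => //=; rewrite odd_double /= uphalf_double.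
  by exists (k.*2) => //=; rewrite odd_double /= doubleK.
- move=> j.
  pose F k := \prod_i ((if odd k then b k./2 else b' k./2) i 0 - (if odd k then a k./2 else a' k./2) i 0).
  have F0 k : 0 <= F k.
    by apply: prodr_ge0 => i _; rewrite subr_ge0; case: ifP.
  apply: (@le_trans _ _ (\sum_(k < j.*2) F k)).
    have jj : (j <= j.*2)%N by rewrite -addnn leq_addr.
    rewrite -!(big_mkord xpredT F) [X in _ <= X](@big_cat_nat _ _ _ j) ?(leq0n j) ?jj //=.
    by rewrite lerDl sumr_ge0.
  have -> : \sum_(k < j.*2) F k = \sum_(k < j) \prod_i (b' k i 0 - a' k i 0) + \sum_(k < j) \prod_i (b k i 0 - a k i 0).
    elim: (j) => [|m IH]; first by rewrite !big_ord0 addr0.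
    rewrite doubleS !big_ord_recr /= IH /F /= odd_double /= doubleK uphalf_double.
    by ring.
  by have := lerD (h3' j) (h3 j); lra.
Qed.

(** Grid the coordinates other than [j] by cells of side [h]. Over one cell the set has height at
    most [2 * L * h] in direction [j], so the boxes over all cells have total volume proportional to
    [h]. *)
Lemma lebesgue_null_graph {n} (N : set 'cV[R]_n) (x0 : 'cV[R]_n) (a L : R) (j : 'I_n) :
  0 < a -> 0 <= L -> (forall x, N x -> forall i, x0 i 0 - a <= x i 0 <= x0 i 0 + a) ->
  (forall x y d, N x -> N y -> 0 <= d -> (forall i, i != j -> `|x i 0 - y i 0| <= d) ->
     `|x j 0 - y j 0| <= L * d) -> lebesgue_null N.
Proof.
case: n N x0 j => [|n] N x0 j; first by case: j.
move=> a0 L0 Nbd Nlip; apply: lebesgue_null_seq => e e0.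
(* With [k.+1] cells per coordinate and [h = 2 * a / k.+1], the total volume is [C / k.+1]. *)
pose C : R := (2 * a) ^+ n * (2 * L) * (2 * a).
have C0 : 0 <= C by rewrite !mulr_ge0 ?exprn_ge0 ?mulr_ge0// ltW.
have [k hk] : exists k : nat, C / k.+1%:R <= e.
  exists (Num.bound (C / e)); rewrite ler_pdivrMr ?ltr0n// mulrC -ler_pdivrMr//.
  apply: (le_trans (ltW (archi_boundP _))); first by rewrite divr_ge0// ltW.
  by rewrite ler_nat.
pose h : R := 2 * a / k.+1%:R.
have h0 : 0 < h by rewrite divr_gt0 ?mulr_gt0 ?ltr0n.
have hk1 : h * k.+1%:R = 2 * a by rewrite divfK// pnatr_eq0.
pose lo (i : 'I_n.+1) (m : nat) : R := x0 i 0 - a + h * m%:R.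
pose cell (g : {ffun 'I_n -> 'I_k.+1}) : set 'cV[R]_n.+1 :=
  [set x | N x /\ forall i : 'I_n, lo (lift j i) (g i) <= x (lift j i) 0 <= lo (lift j i) (g i).+1].
(* In direction [j] the box is centred at an arbitrary point of the cell. For an empty cell [get]
   returns a default value; such a box covers nothing required but has the same volume. *)
pose box (g : {ffun 'I_n -> 'I_k.+1}) : 'cV[R]_n.+1 * 'cV[R]_n.+1 :=
  (\col_i (if unlift j i is Some i' then lo i (g i') else get (cell g) j 0 - L * h),
   \col_i (if unlift j i is Some i' then lo i (g i').+1 else get (cell g) j 0 + L * h)).
exists [seq box g | g <- enum {: {ffun 'I_n -> 'I_k.+1}}]; split.
- move=> ab /mapP[g _ ->] i; rewrite !mxE; case: unliftP => [i' _|_].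
    by rewrite /lo lerD2l ler_wpM2l ?(ltW h0)// ler_nat.
  by have : 0 <= L * h by [rewrite mulr_ge0// ltW]; lra.
- move=> x Nx.
  have ex (i : 'I_n) : exists m : 'I_k.+1, lo (lift j i) m <= x (lift j i) 0 <= lo (lift j i) m.+1.
    have /andP[l1 l2] := Nbd x Nx (lift j i).
    pose u := (x (lift j i) 0 - (x0 (lift j i) 0 - a)) / h.
    have u0 : 0 <= u by rewrite divr_ge0 ?subr_ge0// ltW.
    have uE : x (lift j i) 0 = x0 (lift j i) 0 - a + h * u.
      by rewrite /u mulrC divfK ?gt_eqF//; ring.
    have uk : u <= k.+1%:R by rewrite /u ler_pdivrMr// mulrC hk1; lra.
    have [t1 t2] := (andP (truncn_itv u0)).
    (* The second case is the right edge [u = k.+1] of the grid, which is assigned to the last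
       cell. *)
    have [tk|kt] := ltnP (Num.truncn u) k.+1.
      exists (Ordinal tk); rewrite /lo uE !lerD2l !ler_pM2l//= t1 /=; exact: ltW.
    exists (Ordinal (ltnSn k)); rewrite /lo uE !lerD2l !ler_pM2l//= uk andbT.
    by apply: le_trans t1; rewrite ler_nat ltnW.
  have [g hg] := choice ex.
  have cx : cell [ffun i => g i] x by split=> // i; rewrite ffunE.
  exists (box [ffun i => g i]); first by apply: map_f; rewrite mem_enum.
  move=> i; rewrite !mxE; case: unliftP => [i' ->|->]; first by rewrite !ffunE.
  have [Ny hy] := @getPex _ (cell [ffun i => g i]) (ex_intro _ x cx).
  have := @Nlip x (get (cell [ffun i => g i])) h Nx Ny (ltW h0).
  rewrite ler_distl => -> // i' /negPf ij.
  case: (unliftP j i') ij => [i2 -> _|->]; last by rewrite eqxx.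
  have := hy i2; have := hg i2; rewrite ffunE /lo -natr1 mulrDr mulr1 ler_norml; lra.
- rewrite big_map big_enum /=.
  have volE g : box_vol (box g) = (2 * L * h) * h ^+ n.
    rewrite /box_vol (bigD1_ord j)//=; congr (_ * _).
      by rewrite !mxE unlift_none; ring.
    rewrite -[n in RHS]card_ord -prodr_const; apply: eq_bigr => i _.
    by rewrite !mxE liftK /lo -natr1; ring.
  rewrite (eq_bigr _ (fun g _ => volE g)) sumr_const card_ffun !card_ord -[X in X <= _]mulr_natr natrX.
  apply: le_trans hk; rewrite -mulrA -exprMn hk1 /C /h le_eqVlt; apply/orP; left; apply/eqP.
  by field; rewrite addrC natr1 pnatr_eq0.
Qed.

End NullSets.

(** * Decay of the Lyapunov function in a tube around the orbit *)

Section TubeEstimates.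
Context {R : realType} {n : nat}.
Variables (X : set 'cV[R]_n) (F : 'cV[R]_n -> 'cV[R]_n) (p : 'cV[R]_n -> R)
  (xs : R -> 'cV[R]_n) (sa sw : R) (V : 'cV[R]_n -> R) (rho : R -> R)
  (U : set 'cV[R]_n) (c C d : R).

Local Notation e := (err xs p).
Local Notation orbit := (maneuver_orbit sa sw xs).

Definition in_tube (x : 'cV[R]_n) : Prop := exists2 s, sa <= s <= sw & `|x - xs s| < d.

(* The factor [k] lets the same bounds serve the field [F] and the reversed field [- F]. *)
Definition derivative_along (W : 'cV[R]_n -> R) (x : 'cV[R]_n) (w : R) : Prop :=
  forall J phi t (k : R), phi t = x -> hderiv J phi t (k *: F x) -> hderiv J (W \o phi) t (k * w).

(** The upper bound gives decay in forward time. The lower bound limits the growth of [V] along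
    reversed trajectories, which keeps a trajectory that meets the orbit on it in the past. *)
Definition decay_bounds (x : 'cV[R]_n) (w : R) : Prop :=
  - C * `|e x| ^+ 2 <= w <= - c * `|e x| ^+ 2.

(** The interface between geometry and dynamics: the stability arguments use the system only through
    these fields, with one lower constant [c], one upper constant [C] and one radius [d]. [U] stands
    for the set where [p] and [V] are differentiable along solutions; on the two end levels a
    function [W] replaces [V]. *)
Record tube_estimates : Prop := {
  tube_lt : sa < sw;
  tube_c0 : 0 < c;
  tube_C0 : 0 < C;
  tube_d0 : 0 < d;
  tube_range : forall x, X x -> sa <= p x <= sw;
  tube_p_lip : forall x y, X x -> X y -> `|p x - p y| <= C * `|x - y|;
  tube_xs_lip : forall s t, sa <= s <= sw -> sa <= t <= sw -> `|xs s - xs t| <= C * `|s - t|;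
  tube_p_xs : forall s, sa <= s <= sw -> p (xs s) = s;
  tube_V_lower : forall x, X x -> c * `|e x| ^+ 2 <= V x;
  tube_V_upper : forall x, X x -> V x <= C * `|e x| ^+ 2;
  tube_V_cont : forall x, X x -> forall r, 0 < r -> \forall y \near x, X y -> `|V y - V x| <= r;
  tube_X : forall x, in_tube x -> \forall y \near x, X y;
  tube_cases : forall x, in_tube x -> [\/ U x, p x = sa | p x = sw];
  tube_deriv : forall x, in_tube x -> U x -> exists ds dV,
    [/\ derivative_along p x ds, derivative_along V x dV,
        `|ds - rho (p x)| <= C * `|e x| & decay_bounds x dV];
  tube_deriv_end : forall x, in_tube x -> p x = sa \/ p x = sw -> exists W dV,
    [/\ forall y, X y -> p y = p x -> W y = V y, derivative_along W x dV & decay_bounds x dV];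
  tube_F_lip : forall s x y, sa <= s <= sw -> `|x - xs s| < d -> `|y - xs s| < d ->
    `|F x - F y| <= C * `|x - y|;
  tube_F_bound : forall x, in_tube x -> `|F x| <= C }.

Hypothesis E : tube_estimates.

Let ltab := tube_lt E.
Let c0 := tube_c0 E.
Let C0 := tube_C0 E.
Let d0 := tube_d0 E.

Lemma tube_memX x : in_tube x -> X x.
Proof. by move=> /(tube_X E); exact: nbhs_singleton. Qed.

Lemma in_tube_xs s : sa <= s <= sw -> in_tube (xs s).
Proof. by move=> h; exists s => //; rewrite subrr normr0. Qed.

(** The error vanishes at [xs s], and [1 + C ^+ 2] is a Lipschitz constant for it, the square coming
    from [xs] composed with [p]. *)
Lemma err_le s x : X x -> sa <= s <= sw -> `|e x| <= (1 + C ^+ 2) * `|x - xs s|.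
Proof.
move=> Xx ss; have Xs := tube_memX (in_tube_xs ss).
have -> : e x = (x - xs s) + (xs (p (xs s)) - xs (p x)).
  by rewrite (tube_p_xs E ss) /err addrA subrK.
rewrite (le_trans (ler_normD _ _))// mulrDl mul1r lerD2l.
have ps : sa <= p (xs s) <= sw by apply: (tube_range E).
apply: (le_trans (tube_xs_lip E ps (tube_range E Xx))).
rewrite expr2 -mulrA ler_wpM2l ?(ltW C0)// distrC.
exact: (tube_p_lip E).
Qed.

Lemma err_small x r : X x -> V x < c * r ^+ 2 -> 0 < r -> `|e x| < r.
Proof.
move=> Xx Vx r0; have := le_lt_trans (tube_V_lower E Xx) Vx.
rewrite ltr_pM2l ?c0// => h; rewrite ltNge; apply/negP => re.
by move: h; rewrite ltNge lerXn2r ?nnegrE// ltW.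
Qed.

Lemma in_tube_V x : X x -> V x < c * d ^+ 2 -> in_tube x.
Proof.
move=> Xx Vx; exists (p x); first exact: (tube_range E).
exact: err_small.
Qed.

Lemma V_ge0 x : X x -> 0 <= V x.
Proof.
by move=> Xx; apply: le_trans (tube_V_lower E Xx); rewrite mulr_ge0 ?exprn_ge0// ltW.
Qed.

Lemma hderiv_dini (S : set R) (g : R -> R) t w r : hderiv S g t w -> w <= 0 -> 0 < r ->
  \forall u \near t, S u -> t <= u -> g u <= g t + r * (u - t).
Proof.
move=> h w0 /h; apply: filterS => u hu Su tu; have := hu Su.
rewrite (@ger0_norm _ (u - t)) ?subr_ge0// ler_norml /GRing.scale /= => /andP[_].
by have : (u - t) * w <= 0 by [rewrite mulr_ge0_le0// subr_ge0]; lra.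
Qed.

Section Trajectory.
Variables (k : R) (phi : R -> 'cV[R]_n) (a b : R).
Hypothesis ab : a <= b.
Hypothesis phiX : forall t, a <= t <= b -> X (phi t).
Hypothesis phid : forall t, a <= t <= b -> hderiv [set u | a <= u <= b] phi t (k *: F (phi t)).

Let I := [set u | a <= u <= b].

Lemma traj_near t (P : 'cV[R]_n -> Prop) : I t ->
  (\forall y \near phi t, P y) -> \forall u \near t, I u -> P (phi u).
Proof.
move=> It /nbhs_ballP[r /= r0 hr]; have r20 : 0 < r / 2 by rewrite divr_gt0.
apply: filterS (hderiv_cont (phid It) r20) => u hu Iu; apply: hr.
by rewrite -ball_normE /= distrC (le_lt_trans (hu Iu))//; lra.
Qed.

Lemma traj_p_cont t : I t -> cont_in I (p \o phi) t.
Proof.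
move=> It r r0; have rC : 0 < r / C by rewrite divr_gt0 ?C0.
apply: filterS (hderiv_cont (phid It) rC) => u hu Iu /=.
apply: (le_trans (tube_p_lip E (phiX Iu) (phiX It))).
by rewrite mulrC -ler_pdivlMr ?C0//; exact: hu.
Qed.

Lemma traj_V_cont t : I t -> cont_in I (V \o phi) t.
Proof.
move=> It r r0.
apply: filterS (traj_near It (tube_V_cont E (phiX It) r0)) => u hu Iu.
exact: hu (phiX Iu).
Qed.

Lemma traj_p_neq t s : I t -> p (phi t) <> s -> \forall u \near t, I u -> p (phi u) <> s.
Proof.
move=> It ns; have r0 : 0 < `|p (phi t) - s| / 2.
  by rewrite divr_gt0// normr_gt0 subr_eq0; apply/eqP.
apply: filterS (traj_p_cont It r0) => u hu Iu pu; move: (hu Iu) => /=.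
rewrite pu distrC; move: r0; set z := `| _ |; lra.
Qed.

Variables (m c1 : R).
Hypothesis rate : forall x w, X x -> decay_bounds x w -> k * w <= m * V x.
Hypothesis start : V (phi a) < c1.
Hypothesis stay : forall t, a <= t <= b -> c1 * expR (m * (t - a)) <= c * d ^+ 2.

(* Across a crossing time of the boundary of [U] the function [V] need not be
   differentiable along [phi], but at the ends it agrees with a function that is. *)
Lemma V_decay : V (phi b) <= V (phi a) * expR (m * (b - a)).
Proof.
(* Integrating factor: the claim becomes monotonicity of the product [g] of [V] along [phi] with
   [h]. *)
pose h (t : R) := expR (- m * t + m * a).
have h_gt0 t : 0 < h t by exact: expR_gt0.
have hE t : h t * expR (m * (t - a)) = 1.
  by rewrite /h -expRD; have -> : - m * t + m * a + m * (t - a) = 0 by [ring]; rewrite expR0.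
have hd t : hderiv I h t (- m * h t).
  rewrite /h; have h1 := hderivZ (expR (m * a)) (hderiv_expR I (- m) t).
  apply: (hderiv_near (S := I) (g := fun u => expR (m * a) *: expR (- m * u))).
  - by move: h1; rewrite /GRing.scale /= expRD mulrCA [expR (m * a) * _]mulrC.
  - by rewrite /GRing.scale /= expRD mulrC.
  - by apply: filterE => u Iu; rewrite /GRing.scale /= expRD mulrC.
pose g t := V (phi t) * h t.
suff gb : g b <= g a.
  rewrite -[leLHS]mulr1 -(hE b) mulrA ler_wpM2r ?expR_ge0//.
  have ha : h a = 1 by rewrite /h mulNr addNr expR0.
  by move: gb; rewrite /g ha mulr1.
pose Z := [set t | p (phi t) = sa \/ p (phi t) = sw].
(* Through [stay], the level [c1] for [g] becomes the level [c * d ^+ 2] for [V], below which the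
   trajectory is in the tube; this is the purpose of the level in the comparison lemma. *)
have tube t : a <= t < b -> g t < c1 -> in_tube (phi t).
  move=> /andP[ta /ltW tb] gt; have It : I t by rewrite /I /= ta.
  apply: in_tube_V; first exact: phiX.
  apply: lt_le_trans (stay It); rewrite -[ltLHS]mulr1 -(hE t) mulrA.
  by rewrite ltr_pM2r ?expR_gt0.
have dW (W : 'cV[R]_n -> R) w t : I t -> W (phi t) = V (phi t) -> decay_bounds (phi t) w ->
    derivative_along W (phi t) w ->
    hderiv I (fun t => W (phi t) * h t) t ((k * w - m * V (phi t)) * h t).
  move=> It WV wb dw; have := hderivM (dw I phi t k erefl (phid It)) (hd t).
  by rewrite /= WV; have -> : k * w * h t + V (phi t) * (- m * h t) = (k * w - m * V (phi t)) * h t by ring.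
have dn w t : I t -> decay_bounds (phi t) w -> (k * w - m * V (phi t)) * h t <= 0.
  by move=> It wb; rewrite mulr_le0_ge0// ?(ltW (h_gt0 t))// subr_le0; apply: rate => //; exact: phiX.
apply: (@dini_except R g Z a b c1) => //.
- by rewrite /g /h mulNr addNr expR0 mulr1.
- move=> t It r r0.
  have h1 : 0 < r / (2 * h t) by rewrite divr_gt0// mulr_gt0.
  have h2 : 0 < r / 2 / (`|V (phi t)| + r / (2 * h t)) by rewrite !divr_gt0// ltr_wpDl.
  apply: filterS2 (traj_V_cont It h1) (hderiv_cont (hd t) h2) => u k1 k2 Iu.
  have {}k1 : `|V (phi u) - V (phi t)| <= r / (2 * h t) := k1 Iu.
  have {}k2 := k2 Iu.
  have -> : g u - g t = V (phi u) * (h u - h t) + (V (phi u) - V (phi t)) * h t by rewrite /g; ring.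
  rewrite (le_trans (ler_normD _ _))// !normrM (gtr0_norm (h_gt0 t)).
  have k3 : `|V (phi u)| <= `|V (phi t)| + r / (2 * h t).
    by rewrite -(subrK (V (phi t)) (V (phi u))) addrC (le_trans (ler_normD _ _))// lerD2l.
  have k4 := ler_pM (normr_ge0 _) (normr_ge0 _) k3 k2.
  have k5 : `|V (phi u) - V (phi t)| * h t <= r / 2.
    by rewrite -ler_pdivlMr// (le_trans k1)// invfM mulrA.
  move: k4; rewrite mulrC [X in _ <= X]mulrC divfK; last first.
    by rewrite gt_eqF// ltr_wpDl.
  by rewrite mulrC; lra.
- move=> t It nZ.
  have n1 : p (phi t) <> sa by move=> h'; apply: nZ; left.
  have n2 : p (phi t) <> sw by move=> h'; apply: nZ; right.
  apply: filterS2 (traj_p_neq It n1) (traj_p_neq It n2) => u h1 h2 Iu [].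
    exact: h1.
  exact: h2.
- move=> t tab nZ gt r r0; have tt := tube t tab gt.
  have It : I t by rewrite /I /=; case/andP: tab => -> /ltW.
  have Ut : U (phi t).
    by case: (tube_cases E tt) => // h'; case: nZ; [left|right].
  have [ds [w [_ dw _ wb]]] := tube_deriv E tt Ut.
  have := hderiv_dini (dW _ _ _ It erefl wb dw) (dn _ _ It wb) r0.
  apply: filterS => u hu /andP[tu ub]; apply: hu => //; rewrite /I /= ub andbT.
  by apply: le_trans tu; case/andP: tab.
- move=> t tab Zt gt r r0; have tt := tube t tab gt.
  have It : I t by rewrite /I /=; case/andP: tab => -> /ltW.
  have [W [w [WV dw wb]]] := tube_deriv_end E tt Zt.
  have WVt : W (phi t) = V (phi t) by apply: WV => //; exact: phiX.
  (* The two end levels are distinct and [p] is continuous along [phi], so nearby exceptional times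
     belong to the same end and the same [W] represents [V] at all of them. *)
  have Zt' : \forall u \near t, I u -> Z u -> p (phi u) = p (phi t).
    have ne : sa <> sw by move=> h'; move: ltab; rewrite h' ltxx.
    case: Zt => pt.
      have := traj_p_neq It (s := sw); rewrite pt => /(_ ne); apply: filterS => u hu Iu [//|/(hu Iu)//].
    have := traj_p_neq It (s := sa); rewrite pt => /(_ (not_eq_sym ne)).
    by apply: filterS => u hu Iu [/(hu Iu)//|//].
  have := hderiv_dini (dW _ _ _ It WVt wb dw) (dn _ _ It wb) r0.
  apply: filterS2 Zt' => u hz hu /andP[tu ub] Zu.
  have Iu : I u by rewrite /I /= ub andbT; apply: le_trans tu; case/andP: tab.
  by have := hu Iu tu; rewrite WVt (WV (phi u) (phiX Iu) (hz Iu Zu)).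
Qed.

End Trajectory.

Lemma decay_rate x w : X x -> decay_bounds x w -> 1 * w <= - (c / C) * V x.
Proof.
move=> Xx /andP[_ h]; rewrite mul1r; apply: (le_trans h).
have := tube_V_upper E Xx; rewrite -ler_pdivrMl ?C0// => h2.
rewrite !mulNr lerN2 -mulrA ler_wpM2l ?(ltW c0)//.
Qed.

Lemma growth_rate x w : X x -> decay_bounds x w -> -1 * w <= (C / c) * V x.
Proof.
move=> Xx /andP[h _]; rewrite mulN1r lerNl; apply: le_trans h.
rewrite mulNr lerN2 -mulrA ler_wpM2l ?(ltW C0)//.
by rewrite ler_pdivlMl ?c0//; exact: (tube_V_lower E).
Qed.

Lemma solution_hderiv J phi a b : solution X F J phi -> a \in J -> b \in J ->
  (forall t, a <= t <= b -> X (phi t)) /\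
  (forall t, a <= t <= b -> hderiv [set u | a <= u <= b] phi t (1 *: F (phi t))).
Proof.
move=> sol aJ bJ.
have sub t : a <= t <= b -> t \in J.
  move=> /andP[ta tb]; move: aJ bJ; case: J {sol} => l r; rewrite !itv_boundlr.
  move=> /andP[la _] /andP[_ br]; apply/andP; split.
    by apply: le_trans la _; rewrite bnd_simp.
  by apply: le_trans br; rewrite bnd_simp.
split=> t tab; have [Xt /hderivP ht] := sol t (sub t tab) => //.
by rewrite scale1r; apply: hderiv_sub ht => u /sub.
Qed.

Lemma V_decay_solution J phi a b : solution X F J phi -> a \in J -> b \in J -> a <= b ->
  V (phi a) < c * d ^+ 2 -> V (phi b) <= V (phi a) * expR (- (c / C) * (b - a)).
Proof.
move=> sol aJ bJ ab Va; have [hX hd] := solution_hderiv sol aJ bJ.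
apply: (V_decay (k := 1) ab hX hd) Va _; first exact: decay_rate.
move=> t /andP[ta _]; rewrite ger_pMr; last by rewrite mulr_gt0 ?exprn_gt0 ?c0 ?d0.
by rewrite -expR0 ler_expR mulNr oppr_le0 mulr_ge0 ?subr_ge0// divr_ge0 ?ltW.
Qed.

Lemma err0_orbit x : X x -> e x = 0 -> orbit x.
Proof.
move=> Xx ex; exists (p x); first by rewrite /= in_itv /=; exact: (tube_range E).
by apply/eqP; rewrite eq_sym -subr_eq0; apply/eqP.
Qed.

Lemma orbit_V0 x : orbit x -> V x = 0.
Proof.
move=> [s /=]; rewrite in_itv /= => ss <-; have Xs := tube_memX (in_tube_xs ss).
have es : e (xs s) = 0 by rewrite /err (tube_p_xs E ss) subrr.
apply/eqP; rewrite eq_le V_ge0// andbT.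
by have := tube_V_upper E Xs; rewrite es normr0 expr0n /= mulr0.
Qed.

Lemma V0_orbit x : X x -> V x <= 0 -> orbit x.
Proof.
move=> Xx V0; apply: err0_orbit => //; apply/eqP; rewrite -normr_eq0 -sqrf_eq0.
rewrite eq_le sqr_ge0 andbT -(ler_pM2l c0) mulr0.
exact: le_trans (tube_V_lower E Xx) V0.
Qed.

(** The orbit is the zero set of [V] in [X]. Forward, decay from the value [0] keeps [V] at [0];
    backward, the reversed trajectory solves the equation with [- F], along which [V] grows at most
    exponentially, hence not at all from [0]. *)
Lemma orbit_invariant : invariant_set X F orbit.
Proof.
move=> J phi t0 t sol t0J tJ Ot0; have V0 := orbit_V0 Ot0.
have nu0 : 0 < c * d ^+ 2 by rewrite mulr_gt0 ?exprn_gt0 ?c0 ?d0.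
have [t0t|tt0] := leP t0 t.
  apply: V0_orbit; first by have [] := sol t tJ.
  by have := V_decay_solution sol t0J tJ t0t; rewrite V0 mul0r; apply.
have [hX hd] := solution_hderiv sol tJ t0J.
pose psi r := phi (t0 - r).
have b0 : 0 <= t0 - t by rewrite subr_ge0 ltW.
have itv r : 0 <= r <= t0 - t -> t <= t0 - r <= t0 by lra.
have psiX r : 0 <= r <= t0 - t -> X (psi r) by move=> /itv; exact: hX.
have psid r : 0 <= r <= t0 - t -> hderiv [set u | 0 <= u <= t0 - t] psi r (-1 *: F (psi r)).
  move=> hr; have h1 : hderiv [set u | 0 <= u <= t0 - t] (fun u => t0 - u) r (0 - 1).
    by apply: hderivB; [exact: hderiv_cst | exact: hderiv_id].
  have := hderiv_comp h1 _ (hd _ (itv r hr)); rewrite sub0r scale1r; apply.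
  by apply: filterE => u /itv.
(* The initial level is lowered by the largest growth factor over the interval, so that it never
   exceeds [c * d ^+ 2]. *)
have := V_decay b0 psiX psid (@growth_rate) (c1 := c * d ^+ 2 * expR (- (C / c * (t0 - t)))).
rewrite /psi subr0 V0 mul0r mulr_gt0 ?expR_gt0// => /(_ isT) h.
have : V (phi (t0 - (t0 - t))) <= 0.
  apply: h => r /andP[r0 rb]; rewrite -mulrA -expRD subr0 ger_pMr//.
  rewrite -expR0 ler_expR addrC subr_le0 ler_wpM2l// divr_ge0// ltW//.
have -> : t0 - (t0 - t) = t by ring.
by apply: V0_orbit; have [] := sol t tJ.
Qed.

End TubeEstimates.

(** * Exponential stability of the orbit *)

Section TubeStability.
Context {R : realType} {n : nat}.
Variables (X : set 'cV[R]_n) (F : 'cV[R]_n -> 'cV[R]_n) (p : 'cV[R]_n -> R)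
  (xs : R -> 'cV[R]_n) (sa sw : R) (V : 'cV[R]_n -> R) (rho : R -> R)
  (U : set 'cV[R]_n) (c C d : R).

Local Notation e := (err xs p).
Local Notation orbit := (maneuver_orbit sa sw xs).
Local Notation in_tube := (in_tube xs sa sw d).

Hypothesis E : tube_estimates X F p xs sa sw V rho U c C d.

Let ltab := tube_lt E.
Let c0 := tube_c0 E.
Let C0 := tube_C0 E.
Let d0 := tube_d0 E.

Let orbit_dists x := [set `|x - y| | y in orbit].

(** Distance to the orbit in the maximum norm, the norm in which the Lipschitz bounds are stated;
    the Euclidean [dist] is compared with it separately. *)
Definition orbit_dist x : R := inf (orbit_dists x).

Let dists_nonempty x : orbit_dists x !=set0.
Proof.
exists `|x - xs sa|, (xs sa) => //; exists sa => //.
by rewrite /= in_itv /= lexx ltW.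
Qed.

Let dists_lb x : lbound (orbit_dists x) 0.
Proof. by move=> _ [y _ <-]. Qed.

Lemma orbit_dist_le x s : sa <= s <= sw -> orbit_dist x <= `|x - xs s|.
Proof.
move=> ss; apply: ge_inf; first by exists 0; exact: dists_lb.
by exists (xs s) => //; exists s => //; rewrite /= in_itv.
Qed.

Lemma orbit_dist_lt x r : orbit_dist x < r -> exists2 s, sa <= s <= sw & `|x - xs s| < r.
Proof.
move=> xr; have [_ [_ [s /= ss <-] <-] h] := inf_lt (dists_nonempty x) xr.
by exists s => //; move: ss; rewrite in_itv.
Qed.

Lemma orbit_dist_lip x y : `|orbit_dist x - orbit_dist y| <= `|x - y|.
Proof.
have h u v : orbit_dist u <= orbit_dist v + `|u - v|.
  rewrite -lerBlDr; apply: lb_le_inf; first exact: dists_nonempty.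
  move=> _ [_ [s /= ss <-] <-]; rewrite lerBlDr.
  have /orbit_dist_le h : sa <= s <= sw by move: ss; rewrite in_itv.
  apply: (le_trans (h u)).
  have -> : u - xs s = (v - xs s) + (u - v) by apply/colP => i; rewrite !mxE; ring.
  exact: ler_normD.
by rewrite ler_norml; have := h x y; have := h y x; rewrite (distrC y x); lra.
Qed.

Lemma orbit_dist_err x : X x -> orbit_dist x <= `|e x|.
Proof. by move=> Xx; apply: orbit_dist_le; exact: (tube_range E). Qed.

Let d1 := d / 2.

Let d10 : 0 < d1. Proof. by rewrite divr_gt0. Qed.

Lemma near_orbit_in_tube x : orbit_dist x < d -> in_tube x.
Proof. exact: orbit_dist_lt. Qed.

Lemma half_in_tube x : orbit_dist x < d1 -> in_tube x.
Proof. by move=> h; apply: near_orbit_in_tube; move: h; have := d0; rewrite /d1; lra. Qed.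

(** Equal to [1] up to distance [d1 / 2] and to [0] from [d1] on. Multiplication by it turns a field
    controlled only in the tube into a bounded, globally Lipschitz one. *)
Definition cutoff x : R := Num.max 0 (Num.min 1 (2 - 2 * orbit_dist x / d1)).

Lemma cutoff_bound x : 0 <= cutoff x <= 1.
Proof.
by rewrite /cutoff le_max lexx /= ge_max ler01 ge_min lexx.
Qed.

Lemma cutoff_eq1 x : orbit_dist x <= d1 / 2 -> cutoff x = 1.
Proof.
move=> h; have : 2 * orbit_dist x / d1 <= 1 by rewrite ler_pdivrMr//; lra.
by move=> h2; rewrite /cutoff min_l ?max_r//; lra.
Qed.

Lemma cutoff_eq0 x : d1 <= orbit_dist x -> cutoff x = 0.
Proof.
move=> h; have : 2 <= 2 * orbit_dist x / d1 by rewrite ler_pdivlMr//; lra.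
move=> h2; rewrite /cutoff max_l// ge_min; apply/orP; right; lra.
Qed.

Lemma cutoff_lip x y : `|cutoff x - cutoff y| <= 2 / d1 * `|x - y|.
Proof.
have h (u v : R) : `|Num.max 0 (Num.min 1 u) - Num.max 0 (Num.min 1 v)| <= `|u - v|.
  have hu u' v' : u' <= v' -> `|Num.max 0 (Num.min 1 u') - Num.max 0 (Num.min 1 v')| <= v' - u' :> R.
    move=> uv; have [u1|u1] := leP 1 u'.
      by rewrite min_l ?(le_trans u1)// subrr normr0 subr_ge0.
    have [v1|v1] := leP 1 v'.
      have [u0|u0] := leP 0 u'; rewrite ?(max_r u0) ?(max_l (ltW u0)) max_r// ler_norml; lra.
    have [v0|v0] := leP 0 v'; have [u0|u0] := leP 0 u';
      rewrite ?(max_r u0) ?(max_l (ltW u0)) ?(max_r v0) ?(max_l (ltW v0)) ler_norml; lra.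
  have [uv|vu] := leP u v.
    by rewrite (distrC u) (@ger0_norm _ (v - u)) ?subr_ge0//; exact: hu.
  by rewrite distrC (@gtr0_norm _ (u - v)) ?subr_gt0//; apply: hu; exact: ltW.
apply: (le_trans (h _ _)).
have -> : 2 - 2 * orbit_dist x / d1 - (2 - 2 * orbit_dist y / d1) = 2 / d1 * - (orbit_dist x - orbit_dist y) by ring.
rewrite normrM normrN ger0_norm; last by rewrite divr_ge0// ltW.
by rewrite ler_wpM2l ?orbit_dist_lip// divr_ge0// ltW.
Qed.

Let G x := cutoff x *: F x.

(** [tube_F_lip] needs both points near one orbit point, which holds if they are closer than
    [d1 = d / 2]. For points farther apart the bound [2 * C] on the difference is absorbed by
    [|x - y| >= d1]. The last summand of the constant comes from the slope of the cutoff. *)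
Let G_lip : exists2 L : R, 0 < L & forall x y, `|G x - G y| <= L * `|x - y|.
Proof.
have dd : 0 < C / d1 by rewrite divr_gt0.
exists (C + 2 * (C / d1) + 2 * (C / d1)); first by rewrite !addr_gt0// mulr_gt0.
have Flip x y : orbit_dist x < d1 -> orbit_dist y < d1 -> `|F x - F y| <= (C + 2 * (C / d1)) * `|x - y|.
  move=> xd yd; have [xy|xy] := ltP `|x - y| d1.
    have [s ss xs1] := orbit_dist_lt xd.
    apply: (le_trans (tube_F_lip E ss _ _)).
    - by rewrite (lt_trans xs1)// /d1; have := d0; lra.
    - rewrite -(subrK x y) -addrA (le_lt_trans (ler_normD _ _))// distrC /d1; move: xs1 xy; rewrite /d1; lra.
    - by rewrite mulrDl lerDl mulr_ge0// mulr_ge0// ltW.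
  have tx : in_tube x by exact: half_in_tube.
  have ty : in_tube y by exact: half_in_tube.
  apply: (le_trans (ler_normB _ _)).
  apply: (le_trans (lerD (tube_F_bound E tx) (tube_F_bound E ty))).
  have h : C <= C / d1 * `|x - y| by rewrite mulrAC ler_pdivlMr// ler_pM2l.
  by have : 0 <= C * `|x - y| by [rewrite mulr_ge0// ltW]; lra.
have half x y : orbit_dist x < d1 -> `|(cutoff x - cutoff y) *: F x| <= 2 * (C / d1) * `|x - y|.
  move=> xd; have tx : in_tube x by exact: half_in_tube.
  rewrite normrZ; have := ler_pM (normr_ge0 _) (normr_ge0 _) (cutoff_lip x y) (tube_F_bound E tx).
  by move=> h; apply: (le_trans h); rewrite -subr_ge0; have -> : 2 * (C / d1) * `|x - y| - 2 / d1 * `|x - y| * C = 0 by ring.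
have K0 (x y : 'cV[R]_n) : 0 <= (C + 2 * (C / d1)) * `|x - y|.
  by rewrite mulr_ge0// addr_ge0 ?(ltW C0)// mulr_ge0// ltW.
have half0 (x y : 'cV[R]_n) : 0 <= 2 * (C / d1) * `|x - y| by rewrite mulr_ge0// mulr_ge0// ltW.
move=> x y; rewrite mulrDl; have [xd|xd] := ltP (orbit_dist x) d1; last first.
  rewrite /G (cutoff_eq0 xd) scale0r sub0r normrN.
  have [yd|yd] := ltP (orbit_dist y) d1; last first.
    by rewrite (cutoff_eq0 yd) scale0r normr0 addr_ge0.
  have := half y x yd; rewrite (cutoff_eq0 xd) subr0 distrC => h.
  by rewrite (le_trans h)// lerDr.
have [yd|yd] := ltP (orbit_dist y) d1; last first.
  have := half x y xd; rewrite /G (cutoff_eq0 yd) scale0r !subr0 => h.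
  by rewrite (le_trans h)// lerDr.
have -> : G x - G y = cutoff y *: (F x - F y) + (cutoff x - cutoff y) *: F x.
  by apply/colP => i; rewrite !mxE; ring.
rewrite (le_trans (ler_normD _ _))// lerD ?half// normrZ.
have /andP[y0 y1] := cutoff_bound y; rewrite ger0_norm//.
by apply: le_trans (Flip x y xd yd); rewrite ler_piMl.
Qed.

Let G_bound x : `|G x| <= C.
Proof.
have /andP[y0 y1] := cutoff_bound x; rewrite normrZ ger0_norm//.
have [xd|xd] := ltP (orbit_dist x) d1; last by rewrite cutoff_eq0// mul0r ltW.
have tx : in_tube x by exact: half_in_tube.
by apply: (le_trans _ (tube_F_bound E tx)); rewrite ler_piMl.
Qed.

Lemma truncated_flow x0 : exists2 phi : R -> 'cV[R]_n, phi 0 = x0 &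
  forall t, hderiv setT phi t (cutoff (phi t) *: F (phi t)).
Proof. have [L L0 GL] := G_lip; exact: (picard x0 L0 GL G_bound). Qed.

Lemma flow_dist_cont (phi : R -> 'cV[R]_n) t v r : hderiv setT phi t v -> 0 < r ->
  \forall u \near t, `|orbit_dist (phi u) - orbit_dist (phi t)| <= r.
Proof.
move=> h r0; apply: filterS (hderiv_cont h r0) => u /(_ Logic.I).
exact: (le_trans (orbit_dist_lip _ _)).
Qed.

Lemma in_tube_half x : orbit_dist x <= d1 / 2 -> in_tube x.
Proof. by move=> h; apply: near_orbit_in_tube; move: h; have := d0; rewrite /d1; lra. Qed.

Lemma local_solution x : orbit_dist x < d1 / 2 ->
  exists tau phi, [/\ 0 < tau, solution X F `](- tau), tau[ phi & phi 0 = x].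
Proof.
move=> xd; have [phi phi0 hphi] := truncated_flow x.
have r0 : 0 < (d1 / 2 - orbit_dist x) / 2 by lra.
have := flow_dist_cont (hphi 0) r0; rewrite phi0 => /nbhs_ballP[tau /= tau0 htau].
exists tau, phi; split=> // t; rewrite in_itv /= => /andP[t1 t2].
have : orbit_dist (phi t) <= d1 / 2.
  have : `|orbit_dist (phi t) - orbit_dist x| <= (d1 / 2 - orbit_dist x) / 2.
    by apply: htau; rewrite /ball /= sub0r normrN ltr_norml t1.
  by rewrite ler_norml; lra.
move=> h; split; first exact: (tube_memX E (in_tube_half h)).
apply/hderivP; apply: (hderiv_sub (@subsetT _ _)).
by have := hphi t; rewrite (cutoff_eq1 h) scale1r.
Qed.

(** Below this level the orbit is closer than [d1 / 4], half the radius on which the cutoff equals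
    [1]; the margin lets the flow move for a short time before the bound is re-established. *)
Definition safe_level : R := c * (d1 / 4) ^+ 2.

Lemma safe_level_gt0 : 0 < safe_level.
Proof. by rewrite mulr_gt0// exprn_gt0// divr_gt0. Qed.

Lemma safe_level_lt : safe_level < c * d ^+ 2.
Proof.
rewrite ltr_pM2l// ltrXn2r// ?nnegrE; try (have := d0; rewrite /d1; lra).
Qed.

Lemma safe_dist x : X x -> V x < safe_level -> orbit_dist x < d1 / 4.
Proof.
move=> Xx Vx; apply: (le_lt_trans (orbit_dist_err Xx)).
by apply: (err_small E) => //; rewrite divr_gt0.
Qed.

(** A continuation argument: while the truncated flow stays within [d1 / 2] it solves the true
    equation, so [V] does not increase, so the distance is in fact below [d1 / 4], and the flow may
    be followed a little further. *)
Lemma global_solution x0 : X x0 -> V x0 < safe_level -> global_solution_from X F x0.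
Proof.
move=> Xx0 Vx0; have [phi phi0 hphi] := truncated_flow x0.
have dd : 0 < d1 / 4 by rewrite divr_gt0.
have good b : 0 <= b -> orbit_dist (phi b) <= d1 / 4.
  move=> b0; have h0 : orbit_dist (phi 0) <= d1 / 4 by rewrite phi0 ltW// safe_dist.
  apply: (@real_induction R (fun t => orbit_dist (phi t) <= d1 / 4) 0 b) => //; last by rewrite b0 lexx.
  - move=> t /andP[t0 tb] IH.
    have /nbhs_ballP[q /= q0 hq] := flow_dist_cont (hphi t) dd.
    exists q => //= u tu_q /andP[tu ub].
    have h1 r : 0 <= r <= u -> orbit_dist (phi r) <= d1 / 2.
      move=> /andP[r0 ru]; have [rt|tr] := leP r t.
        by have := IH r; rewrite r0 rt => /(_ isT); have := d10; lra.
      have := IH t; rewrite t0 lexx => /(_ isT) h.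
      have : `|orbit_dist (phi r) - orbit_dist (phi t)| <= d1 / 4.
        apply: hq; rewrite /ball /= distrC gtr0_norm ?subr_gt0//.
        by move: tu_q; rewrite /ball_ /= distrC ger0_norm ?subr_ge0//; lra.
      by rewrite ler_norml; lra.
    have u0 : 0 <= u := le_trans t0 tu.
    have hX r : 0 <= r <= u -> X (phi r).
      by move=> /h1 h; exact: (tube_memX E (in_tube_half h)).
    have hd r : 0 <= r <= u -> hderiv [set v | 0 <= v <= u] phi r (1 *: F (phi r)).
      move=> /h1 h; apply: (hderiv_sub (@subsetT _ _)).
      by have := hphi r; rewrite (cutoff_eq1 h) scale1r.
    have := V_decay E u0 hX hd (@decay_rate _ _ _ _ _ _ _ _ _ _ _ _ _ _ E) (c1 := safe_level).
    rewrite phi0 subr0 => /(_ Vx0) h2.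
    apply: ltW; apply: safe_dist; first by apply: hX; rewrite u0 lexx.
    apply: le_lt_trans Vx0; apply: (le_trans (h2 _)).
      move=> r /andP[r0 _]; apply: le_trans (ltW safe_level_lt).
      rewrite subr0 ger_pMr ?safe_level_gt0// -expR0 ler_expR mulNr oppr_le0.
      by rewrite mulr_ge0// divr_ge0// ltW.
    rewrite ler_piMr ?(V_ge0 E)// -expR0 ler_expR mulNr oppr_le0.
    by rewrite mulr_ge0// divr_ge0// ltW.
  - move=> t /andP[t0 tb] IH; apply/ler_addgt0Pr => r r0.
    have /nbhs_ballP[q /= q0 hq] := flow_dist_cont (hphi t) r0.
    pose u := Num.max 0 (t - q / 2).
    have ut : u < t by rewrite /u gt_max t0 /=; lra.
    have u0 : 0 <= u by rewrite /u le_max lexx.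
    have qu : t - q / 2 <= u by rewrite /u le_max lexx orbT.
    have : `|orbit_dist (phi u) - orbit_dist (phi t)| <= r.
      by apply: hq; rewrite /ball /= gtr0_norm ?subr_gt0//; lra.
    have := IH u; rewrite u0 ut => /(_ isT); rewrite ler_norml; lra.
exists phi => // t; rewrite in_itv /= andbT => t0.
have h : orbit_dist (phi t) <= d1 / 2 by apply: (le_trans (good t t0)); lra.
split; first exact: (tube_memX E (in_tube_half h)).
apply/hderivP; apply: (hderiv_sub (@subsetT _ _)).
by have := hphi t; rewrite (cutoff_eq1 h) scale1r.
Qed.

Let dist_le_err x : X x -> dist orbit x <= n%:R * `|e x|.
Proof.
move=> Xx; apply: (le_trans _ (enorm_le_norm _)); apply: ge_inf.
  by exists 0 => _ [y _ <-]; exact: enorm_ge0.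
exists (xs (p x)) => //; exists (p x) => //; rewrite /= in_itv /=.
exact: (tube_range E).
Qed.

Let dist_nonempty x : [set enorm (x - y) | y in orbit] !=set0.
Proof.
exists (enorm (x - xs sa)), (xs sa) => //; exists sa => //.
by rewrite /= in_itv /= lexx ltW.
Qed.

Let dist_ge0 x : 0 <= dist orbit x.
Proof.
apply: lb_le_inf; first exact: dist_nonempty.
by move=> _ [y _ <-]; exact: enorm_ge0.
Qed.

Let dist_lt x r : dist orbit x < r -> orbit_dist x < r.
Proof.
move=> /(inf_lt (dist_nonempty x))[_ [_ [s /= ss <-] <-] h].
apply: (le_lt_trans _ h); apply: (le_trans _ (norm_le_enorm _)).
by apply: orbit_dist_le; move: ss; rewrite in_itv.
Qed.

Let err_le_dist x : X x -> `|e x| <= (1 + C ^+ 2) * dist orbit x.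
Proof.
move=> Xx; have q0 : 0 < 1 + C ^+ 2 by rewrite ltr_pwDl// sqr_ge0.
rewrite mulrC -ler_pdivrMr//; apply: lb_le_inf; first exact: dist_nonempty.
move=> _ [_ [s /= ss <-] <-]; rewrite ler_pdivrMr// mulrC.
have {}ss : sa <= s <= sw by move: ss; rewrite in_itv.
apply: (le_trans (err_le E Xx ss)); rewrite ler_wpM2l ?(ltW q0)//.
exact: norm_le_enorm.
Qed.

Let k1 : R := 1 + C ^+ 2.
Let k1_gt0 : 0 < k1. Proof. by rewrite ltr_pwDl// sqr_ge0. Qed.

Let V_le_dist x : X x -> V x <= C * k1 ^+ 2 * dist orbit x ^+ 2.
Proof.
move=> Xx; apply: (le_trans (tube_V_upper E Xx)).
rewrite -mulrA ler_wpM2l ?(ltW C0)// -exprMn lerXn2r ?nnegrE ?mulr_ge0 ?(ltW k1_gt0)//.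
exact: err_le_dist.
Qed.

Lemma safe_start : exists2 delta : R, 0 < delta &
  forall x, dist orbit x < delta -> X x /\ V x < safe_level.
Proof.
have q0 : 0 < C * k1 ^+ 2 by rewrite mulr_gt0// exprn_gt0.
(* The entry [1] makes the squared distance at most the distance, so the quadratic bound on [V] can
   be met by a linear condition. *)
pose dl := Num.min d (Num.min 1 (safe_level / (C * k1 ^+ 2))).
exists dl; first by rewrite !lt_min d0 ltr01 divr_gt0// safe_level_gt0.
move=> x; rewrite !lt_min => /and3P[xd x1 x2].
have Xx : X x by apply: (tube_memX E); apply: near_orbit_in_tube; exact: dist_lt.
split=> //; apply: (le_lt_trans (V_le_dist Xx)).
rewrite mulrC -ltr_pdivlMr//; apply: le_lt_trans x2.
by rewrite expr2 ler_piMr// ltW.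
Qed.

Lemma err_decay J phi t : solution X F J phi -> 0 \in J -> t \in J -> 0 <= t ->
  V (phi 0) < c * d ^+ 2 ->
  `|e (phi t)| <= Num.sqrt (C / c) * `|e (phi 0)| * expR (- (c / C / 2) * t).
Proof.
move=> sol oJ tJ t0 V0.
have [X0 _] := sol 0 oJ; have [Xt _] := sol t tJ.
have := V_decay_solution E sol oJ tJ t0 V0; rewrite subr0 => h.
have h2 := le_trans (tube_V_lower E Xt) h.
have h3 : c * `|e (phi t)| ^+ 2 <= C * `|e (phi 0)| ^+ 2 * expR (- (c / C) * t).
  by apply: (le_trans h2); rewrite ler_wpM2r ?expR_ge0// (tube_V_upper E).
have Cc : 0 <= C / c by rewrite divr_ge0// ltW.
rewrite -(@ler_pXn2r _ 2)// ?nnegrE ?mulr_ge0 ?sqrtr_ge0 ?expR_ge0//.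
rewrite !exprMn sqr_sqrtr// -(ler_pM2l c0); apply: (le_trans h3).
have -> : expR (- (c / C / 2) * t) ^+ 2 = expR (- (c / C) * t).
  by rewrite expr2 -expRD; congr expR; field; rewrite gt_eqF.
by rewrite le_eqVlt; apply/orP; left; apply/eqP; field; rewrite gt_eqF.
Qed.

Lemma orbit_exponentially_stable : exponentially_stable_set X F orbit.
Proof.
have [delta delta0 hdelta] := safe_start.
exists delta, (n%:R * Num.sqrt (C / c) * k1 + 1), (c / C / 2); split=> //.
- by rewrite ltr_wpDl// !mulr_ge0 ?sqrtr_ge0// ltW.
- by rewrite !divr_gt0.
- by move=> x0 /hdelta[]; exact: global_solution.
- move=> J phi sol oJ dphi t tJ t0; have [X0 V0] := hdelta _ dphi.
  have [Xt _] := sol t tJ.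
  have h := err_decay sol oJ tJ t0 (lt_trans V0 safe_level_lt).
  apply: (le_trans (dist_le_err Xt)).
  apply: (@le_trans _ _ (n%:R * Num.sqrt (C / c) * k1 * dist orbit (phi 0) * expR (- (c / C / 2) * t))).
    rewrite -!mulrA ler_wpM2l//; apply: (le_trans h); rewrite -!mulrA ler_wpM2l ?sqrtr_ge0//.
    rewrite !mulrA ler_wpM2r ?expR_ge0//; exact: err_le_dist.
  by rewrite ler_wpM2r ?expR_ge0// ler_wpM2r// lerDl.
Qed.

End TubeStability.

(** * Asymptotic stability of the final equilibrium *)

Section TubeAsymptotics.
Context {R : realType} {n : nat}.
Variables (X : set 'cV[R]_n) (F : 'cV[R]_n -> 'cV[R]_n) (p : 'cV[R]_n -> R)
  (xs : R -> 'cV[R]_n) (sa sw : R) (V : 'cV[R]_n -> R) (rho : R -> R)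
  (U : set 'cV[R]_n) (c C d : R).

Local Notation e := (err xs p).
Local Notation orbit := (maneuver_orbit sa sw xs).

Hypothesis E : tube_estimates X F p xs sa sw V rho U c C d.
Hypothesis rho_cont : {within `[sa, sw], continuous rho}.
Hypothesis rho_sa : rho sa = 0.
Hypothesis rho_sw : rho sw = 0.
Hypothesis rho_gt0 : forall s, sa < s < sw -> 0 < rho s.
Hypothesis F_sw : F (xs sw) = 0.

Let ltab := tube_lt E.
Let c0 := tube_c0 E.
Let C0 := tube_C0 E.
Let d0 := tube_d0 E.

Lemma rho_ge0 s : sa <= s <= sw -> 0 <= rho s.
Proof.
move=> /andP[]; rewrite le_eqVlt => /orP[/eqP <- _|s1]; first by rewrite rho_sa.
rewrite le_eqVlt => /orP[/eqP ->|s2]; first by rewrite rho_sw.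
by apply/ltW/rho_gt0; rewrite s1.
Qed.

Lemma expR_small (g K r : R) : 0 < g -> 0 <= K -> 0 < r ->
  exists2 T, 0 <= T & forall t, T <= t -> K * expR (- g * t) <= r.
Proof.
(* This threshold comes from [expR (g * t) >= 1 + g * t]. *)
move=> g0 K0 r0; exists (K / (r * g)); first by rewrite divr_ge0// mulr_ge0// ltW.
move=> t; rewrite ler_pdivrMr ?mulr_gt0// => h.
rewrite mulNr expRN ler_pdivrMr ?expR_gt0//.
have := expR_ge1Dx (g * t); rewrite -(ler_pM2l r0) => h2; apply: le_trans h2; nra.
Qed.

Let g := c / C / 2.
Let g0 : 0 < g. Proof. by rewrite !divr_gt0. Qed.

(** * Motion of the parameter [p] along a trajectory *)

Section Progress.
Variables (phi : R -> 'cV[R]_n) (a b k0 eta : R).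
Hypothesis ab : a <= b.
Hypothesis phiX : forall t, a <= t <= b -> X (phi t).
Hypothesis phid : forall t, a <= t <= b -> hderiv [set u | a <= u <= b] phi t (1 *: F (phi t)).
Hypothesis tube : forall t, a <= t <= b -> in_tube xs sa sw d (phi t).
Hypothesis k00 : 0 <= k0.
Hypothesis small : forall t, a <= t <= b -> `|e (phi t)| <= k0 * expR (- g * t).
Hypothesis eta_rho : forall t, a <= t <= b -> eta <= rho (p (phi t)).
Hypothesis eta_end : forall t, a <= t <= b -> p (phi t) = sa \/ p (phi t) = sw -> eta = 0.

(** [D * expR (- g * t)] is the integral of the drift error [C * k0 * expR (- g * r)] over all
    [r >= t]. *)
Let D := C * k0 / g.
Let I := [set u | a <= u <= b].

(* The drift error in [p' = rho (p) + O (|e|)] is integrable along [phi], and is absorbed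
   by the correction [- D * expR (- g * t)]. *)
Lemma p_progress : p (phi a) - D * expR (- g * a) + eta * (b - a) <= p (phi b) - D * expR (- g * b).
Proof.
have D0 : 0 <= D by rewrite divr_ge0 ?(ltW g0)// mulr_ge0// ltW.
pose h t := eta * t - (p (phi t) - D * expR (- g * t)).
suff : h b <= h a by rewrite /h; lra.
have ed t : hderiv I (fun t => D *: expR (- g * t)) t (D *: (- g * expR (- g * t))).
  exact: hderivZ (hderiv_expR _ _ _).
have exp_dec t u : t <= u -> D * expR (- g * u) <= D * expR (- g * t).
  by move=> tu; rewrite ler_wpM2l// ler_expR !mulNr lerN2 ler_pM2l.
(* Only the final end is exceptional, and there [p] takes equal values at the times compared. At the
   initial end the range condition [sa <= p] already gives an increment of the right sign. *)
pose Z := [set t | p (phi t) = sw].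
apply: (@dini_except R h Z a b (h a + 1)) => //; first by rewrite ltrDl.
- move=> t It r r0; have r3 : 0 < r / 3 by rewrite divr_gt0.
  have h1 := traj_p_cont E phiX phid It r3.
  have h2 := hderiv_cont (ed t) r3.
  have h3 := hderiv_cont (hderivZ eta (hderiv_id I t)) r3.
  apply: filterS3 h1 h2 h3 => u k1 k2 k3 Iu.
  have := k1 Iu; have := k2 Iu; have := k3 Iu; rewrite /h /GRing.scale /= => {}k3 {}k2 {}k1.
  have -> : eta * u - (p (phi u) - D * expR (- g * u)) - (eta * t - (p (phi t) - D * expR (- g * t))) =
    (eta * u - eta * t) - (p (phi u) - p (phi t)) + (D * expR (- g * u) - D * expR (- g * t)) by ring.
  rewrite (le_trans (ler_normD _ _))// (le_trans (lerD (ler_normB _ _) (lexx _)))//; lra.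
- by move=> t It nZ; exact: (traj_p_neq E phiX phid It nZ).
- move=> t tab nZ _ r r0.
  have It : I t by rewrite /I /=; case/andP: tab => -> /ltW.
  have sub u : t <= u <= b -> I u.
    by move=> /andP[tu ub]; rewrite /I /= ub andbT; apply: le_trans tu; case/andP: tab.
  have [pa|npa] := eqVneq (p (phi t)) sa.
    have e0 : eta = 0 by apply: (eta_end It); left.
    apply: filterE => u tub; rewrite /h e0 !mul0r !sub0r !opprB pa.
    have /andP[pu _] := tube_range E (phiX (sub u tub)).
    have /andP[tu _] := tub; have := exp_dec t u tu.
    have : 0 <= r * (u - t) by [rewrite mulr_ge0 ?subr_ge0// ltW]; lra.
  have Ut : U (phi t).
    by case: (tube_cases E (tube It)) => // h'; rewrite h' eqxx in npa.
  have [ds [dV [dp _ bd _]]] := tube_deriv E (tube It) Ut.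
  have hd : hderiv I h t (eta - (1 * ds - D * (- g * expR (- g * t)))).
    have h1 := hderivZ eta (hderiv_id I t); rewrite {2}/GRing.scale /= mulr1 in h1.
    exact: hderivB h1 (hderivB (dp _ _ _ 1 erefl (phid It)) (ed t)).
  have w0 : eta - (1 * ds - D * (- g * expR (- g * t))) <= 0.
    have -> : D * (- g * expR (- g * t)) = - (C * (k0 * expR (- g * t))).
      by rewrite /D; field; rewrite gt_eqF.
    have := small It; rewrite -(ler_pM2l C0) => h1.
    have := eta_rho It; move: bd; rewrite ler_norml => /andP[bd1 bd2]; lra.
  apply: filterS (hderiv_dini hd w0 r0) => u hu tub; apply: hu; first exact: sub.
  by case/andP: tub.
- move=> t tab Zt _ r r0.
  have It : I t by rewrite /I /=; case/andP: tab => -> /ltW.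
  have e0 : eta = 0 by apply: (eta_end It); right.
  apply: filterE => u /andP[tu ub] Zu.
  have {}Zt : p (phi t) = sw := Zt; have {}Zu : p (phi u) = sw := Zu.
  rewrite /h e0 !mul0r !sub0r !opprB Zt Zu.
  have := exp_dec t u tu; have : 0 <= r * (u - t) by [rewrite mulr_ge0 ?subr_ge0// ltW]; lra.
Qed.

End Progress.

Let k1 : R := 1 + C ^+ 2.
Let k1_gt0 : 0 < k1. Proof. by rewrite ltr_pwDl// sqr_ge0. Qed.
(** [K2] bounds how far [p] can be from [sw], per unit of initial distance: [C] for the initial
    offset of [p], the rest for the total drift. [K3] adds the error to the resulting displacement
    along the curve. *)
Let K2 : R := C + C * (Num.sqrt (C / c) * k1) / g.
Let K3 : R := Num.sqrt (C / c) * k1 + C * K2.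

Let Kr_ge0 : 0 <= Num.sqrt (C / c) * k1. Proof. by rewrite mulr_ge0 ?sqrtr_ge0// ltW. Qed.
Let K2_ge0 : 0 <= K2. Proof. by rewrite /K2 addr_ge0 ?(ltW C0)// divr_ge0 ?(ltW g0)// mulr_ge0 ?(ltW C0). Qed.
Let K3_ge0 : 0 <= K3. Proof. by rewrite /K3 addr_ge0// mulr_ge0 ?(ltW C0). Qed.

Let ss : sa <= sw <= sw. Proof. by rewrite lexx andbT ltW. Qed.

Section Solution.
Variables (J : interval R) (phi : R -> 'cV[R]_n).
Hypothesis sol : solution X F J phi.
Hypothesis oJ : 0 \in J.
Hypothesis V0 : V (phi 0) < c * d ^+ 2.

Let k0 := Num.sqrt (C / c) * `|e (phi 0)|.

Let k00 : 0 <= k0. Proof. by rewrite mulr_ge0 ?sqrtr_ge0. Qed.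

Lemma solution_small t : t \in J -> 0 <= t -> `|e (phi t)| <= k0 * expR (- g * t).
Proof. by move=> tJ t0; exact: (err_decay E sol oJ tJ t0 V0). Qed.

Lemma solution_in_tube t : t \in J -> 0 <= t -> in_tube xs sa sw d (phi t).
Proof.
move=> tJ t0; have [Xt _] := sol tJ; apply: (in_tube_V E Xt).
have := V_decay_solution E sol oJ tJ t0 V0 => h; apply: le_lt_trans V0.
have [X0 _] := sol oJ; apply: (le_trans h); rewrite ler_piMr ?(V_ge0 E)//.
by rewrite -expR0 ler_expR mulNr oppr_le0 subr0 mulr_ge0// divr_ge0// ltW.
Qed.

Lemma solution_itv a b t : a \in J -> b \in J -> a <= t <= b -> t \in J.
Proof.
case: J => l r aJ bJ /andP[ta tb]; move: aJ bJ; rewrite !itv_boundlr.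
move=> /andP[la _] /andP[_ br]; apply/andP; split.
  by apply: le_trans la _; rewrite bnd_simp.
by apply: le_trans br; rewrite bnd_simp.
Qed.

Lemma solution_progress a b eta : a \in J -> b \in J -> 0 <= a -> a <= b ->
  (forall t, a <= t <= b -> eta <= rho (p (phi t))) ->
  (forall t, a <= t <= b -> p (phi t) = sa \/ p (phi t) = sw -> eta = 0) ->
  p (phi a) - C * k0 / g * expR (- g * a) + eta * (b - a) <= p (phi b) - C * k0 / g * expR (- g * b).
Proof.
move=> aJ bJ a0 ab h1 h2; have [hX hd] := solution_hderiv sol aJ bJ.
apply: (p_progress ab hX hd _ k00) => // t tab; have tJ := solution_itv aJ bJ tab.
  by apply: solution_in_tube => //; apply: le_trans a0 _; case/andP: tab.
by apply: solution_small => //; apply: le_trans a0 _; case/andP: tab.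
Qed.

Lemma solution_monotone a b : a \in J -> b \in J -> 0 <= a -> a <= b ->
  p (phi a) - C * k0 / g * expR (- g * a) <= p (phi b) - C * k0 / g * expR (- g * b).
Proof.
move=> aJ bJ a0 ab; have := @solution_progress a b 0 aJ bJ a0 ab.
rewrite mul0r addr0; apply=> // t tab; apply: rho_ge0; apply: (tube_range E).
by have [] := sol (solution_itv aJ bJ tab).
Qed.

Let k0_le : k0 <= Num.sqrt (C / c) * k1 * `|phi 0 - xs sw|.
Proof.
have [X0 _] := sol oJ; rewrite -mulrA ler_wpM2l ?sqrtr_ge0//.
exact: (err_le E).
Qed.

Lemma solution_p_lower t : t \in J -> 0 <= t -> sw - p (phi t) <= K2 * `|phi 0 - xs sw|.
Proof.
move=> tJ t0; have := solution_monotone oJ tJ (lexx 0) t0.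
rewrite mulr0 expR0 mulr1 => h1.
have D0 : 0 <= C * k0 / g by rewrite divr_ge0 ?(ltW g0)// mulr_ge0// ltW.
have h2 : 0 <= C * k0 / g * expR (- g * t) by rewrite mulr_ge0// expR_ge0.
have [X0 _] := sol oJ; have Xw := tube_memX E (in_tube_xs E ss).
have := tube_p_lip E X0 Xw; rewrite (tube_p_xs E ss) ler_norml => /andP[h3 _].
have h4 : C * k0 / g <= C * (Num.sqrt (C / c) * k1) / g * `|phi 0 - xs sw|.
  by rewrite [leRHS]mulrAC ler_wpM2r ?invr_ge0 ?(ltW g0)// -mulrA ler_wpM2l ?(ltW C0)//.
rewrite /K2 mulrDl; lra.
Qed.

(** The error stays small by decay of [V]; the parameter cannot exceed [sw], and its total retreat
    is bounded by the integrated drift. Both contributions are linear in the initial distance. *)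
Lemma solution_near_end t : t \in J -> 0 <= t -> `|phi t - xs sw| <= K3 * `|phi 0 - xs sw|.
Proof.
move=> tJ t0; have [Xt _] := sol tJ.
have h1 : `|e (phi t)| <= Num.sqrt (C / c) * k1 * `|phi 0 - xs sw|.
  apply: le_trans k0_le; apply: (le_trans (solution_small tJ t0)).
  by rewrite ler_piMr// -expR0 ler_expR mulNr oppr_le0 mulr_ge0// ltW.
have h2 : `|xs (p (phi t)) - xs sw| <= C * (K2 * `|phi 0 - xs sw|).
  have pr := tube_range E Xt; have /andP[_ pw] := pr.
  apply: (le_trans (tube_xs_lip E pr ss)); rewrite ler_wpM2l ?(ltW C0)//.
  by rewrite ler0_norm ?subr_le0// opprB; exact: solution_p_lower.
rewrite /K3 mulrDl -mulrA; have -> : phi t - xs sw = e (phi t) + (xs (p (phi t)) - xs sw).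
  by rewrite /err addrA subrK.
by rewrite mulrA (le_trans (ler_normD _ _))// lerD// -mulrA.
Qed.

End Solution.

Lemma dist_le_end x : dist orbit x <= enorm (x - xs sw).
Proof.
apply: ge_inf; first by exists 0 => _ [y _ <-]; exact: enorm_ge0.
by exists (xs sw) => //; exists sw => //; rewrite /= in_itv.
Qed.

(** The corrected parameter [q] never decreases, so it is enough that it once exceeds [sw - r].
    Otherwise [p] eventually stays in a compact subinterval free of both zeros of [rho], where its
    speed has a positive lower bound, and [q] would overshoot. The closeness assumption keeps [p]
    away from [sa]. *)
Lemma p_cvg phi : solution X F `[0, +oo[ phi -> V (phi 0) < c * d ^+ 2 ->
  K2 * `|phi 0 - xs sw| <= (sw - sa) / 2 ->
  forall r, 0 < r -> exists2 T, 0 <= T & forall t, T <= t -> sw - r <= p (phi t).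
Proof.
move=> sol V0 close r r0.
have J (t : R) : 0 <= t -> t \in `[0, +oo[ by rewrite in_itv /= andbT.
pose D := C * (Num.sqrt (C / c) * `|e (phi 0)|) / g.
have D0 : 0 <= D by rewrite divr_ge0 ?(ltW g0)// !mulr_ge0 ?sqrtr_ge0// ltW.
pose q t := p (phi t) - D * expR (- g * t).
have qp t : q t <= p (phi t) by rewrite /q gerBl mulr_ge0// expR_ge0.
have [[t1 t10 ht1]|none] := pselect (exists2 t, 0 <= t & sw - r < q t).
  exists t1 => // t tt; apply: le_trans (qp t); apply: (le_trans (ltW ht1)).
  have t0 := le_trans t10 tt.
  exact: (solution_monotone sol (J 0 (lexx 0)) V0 (J _ t10) (J _ t0)).
have {}none t : 0 <= t -> q t <= sw - r.
  by move=> t0; rewrite leNgt; apply/negP => h; apply: none; exists t.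
have r20 : 0 < r / 2 by rewrite divr_gt0.
have [T0 T00 hT0] := expR_small g0 D0 r20.
have p_up t : T0 <= t -> p (phi t) <= sw - r / 2.
  by move=> tt; have := none t (le_trans T00 tt); have := hT0 t tt; rewrite /q; lra.
have p_lo t : T0 <= t -> (sa + sw) / 2 <= p (phi t).
  move=> tt; have t0 := le_trans T00 tt.
  by have := solution_p_lower sol (J 0 (lexx 0)) V0 (J _ t0) t0; lra.
have itv : (sa + sw) / 2 <= sw - r / 2 := le_trans (p_lo T0 (lexx _)) (p_up T0 (lexx _)).
have sub : `[(sa + sw) / 2, sw - r / 2] `<=` `[sa, sw].
  by move=> s /=; rewrite !in_itv /= => /andP[s1 s2]; have := ltab; lra.
have [s hs smin] := EVT_min itv (continuous_subspaceW sub rho_cont).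
have eta0 : 0 < rho s.
  by move: hs; rewrite in_itv /= => /andP[s1 s2]; apply: rho_gt0; have := ltab; lra.
(* By this time a speed of at least [rho s], the minimum on the subinterval, would bring [q] to
   [sw + 1]. *)
pose t2 := T0 + (sw - q T0 + 1) / rho s.
have qT0 := le_trans (none T0 T00).
have t2T : T0 <= t2.
  rewrite lerDl divr_ge0 ?(ltW eta0)//; have := none T0 T00; lra.
have t20 := le_trans T00 t2T.
have := @solution_progress _ _ sol (J 0 (lexx 0)) V0 T0 t2 (rho s) (J _ T00) (J _ t20) T00 t2T.
rewrite -/D -/(q T0) -/(q t2) => h.
have : q T0 + rho s * (t2 - T0) <= q t2.
  apply: h => t /andP[t1 _]; first by apply: smin; rewrite in_itv /= p_lo ?p_up.
  by have := p_lo t t1; have := p_up t t1; have := ltab; move=> ? ? ? [] ?; lra.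
have -> : rho s * (t2 - T0) = sw - q T0 + 1.
  by rewrite /t2 addrAC subrr add0r mulrC divfK// gt_eqF.
have := none t2 t20; lra.
Qed.

Lemma end_asymptotically_stable : asymptotically_stable X F (xs sw).
Proof.
have [delta delta0 hdelta] := safe_start E.
have lvl := safe_level_lt E.
have J (t : R) : 0 <= t -> t \in `[0, +oo[ by rewrite in_itv /= andbT.
split.
- by split=> //; exact: (tube_memX E (in_tube_xs E ss)).
- move=> eps eps0.
  have K0 : 0 < n%:R * K3 + 1 by rewrite ltr_wpDl// mulr_ge0.
  exists (Num.min delta (eps / (n%:R * K3 + 1))).
    by rewrite lt_min delta0 divr_gt0.
  move=> I phi sol oJ; rewrite lt_min => /andP[h1 h2] t tJ t0.
  have [X0 V0] := hdelta _ (le_lt_trans (dist_le_end _) h1).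
  apply: (le_lt_trans (enorm_le_norm _)).
  apply: (@le_lt_trans _ _ (n%:R * K3 * enorm (phi 0 - xs sw))).
    rewrite -mulrA ler_wpM2l//.
    apply: (le_trans (solution_near_end sol oJ (lt_trans V0 lvl) tJ t0)).
    by rewrite ler_wpM2l// norm_le_enorm.
  move: h2; rewrite ltr_pdivlMr// => h2; apply: le_lt_trans h2.
  by rewrite mulrC ler_wpM2l ?enorm_ge0// lerDl.
- have K0 : 0 < 2 * K2 + 1 by rewrite ltr_wpDl// mulr_ge0.
  have sws : 0 < sw - sa by rewrite subr_gt0.
  (* The second radius makes the possible retreat of [p] at most half the length of the parameter
     interval. *)
  exists (Num.min delta ((sw - sa) / (2 * K2 + 1))).
    by rewrite lt_min delta0 divr_gt0.
  split=> [x0|phi sol]; rewrite lt_min => /andP[h1 h2].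
    have [X0 V0] := hdelta _ (le_lt_trans (dist_le_end _) h1).
    exact: (global_solution E).
  have [X0 V0] := hdelta _ (le_lt_trans (dist_le_end _) h1).
  have {}V0 := lt_trans V0 lvl.
  have close : K2 * `|phi 0 - xs sw| <= (sw - sa) / 2.
    move: h2; rewrite ltr_pdivlMr// => h2.
    have h3 := norm_le_enorm (phi 0 - xs sw).
    have h4 : K2 * `|phi 0 - xs sw| <= K2 * enorm (phi 0 - xs sw) by rewrite ler_wpM2l.
    have := enorm_ge0 (phi 0 - xs sw); lra.
  apply/cvgrPdist_le => r r0.
  have r1 : 0 < r / 2 / C by rewrite !divr_gt0.
  have [T1 T10 hT1] := p_cvg sol V0 close r1.
  have k00 : 0 <= Num.sqrt (C / c) * `|e (phi 0)| by rewrite mulr_ge0 ?sqrtr_ge0.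
  have r2 : 0 < r / 2 by rewrite divr_gt0.
  have [T2 T20 hT2] := expR_small g0 k00 r2.
  exists (Num.max T1 T2); split; first exact: num_real.
  move=> t; rewrite /= gt_max => /andP[/ltW t1 /ltW t2].
  have t0 := le_trans T10 t1; have [Xt _] := sol _ (J t t0).
  rewrite distrC; have -> : phi t - xs sw = e (phi t) + (xs (p (phi t)) - xs sw).
    by rewrite /err addrA subrK.
  have e1 := le_trans (solution_small sol (J 0 (lexx 0)) V0 (J t t0) t0) (hT2 t t2).
  have e2 : `|xs (p (phi t)) - xs sw| <= r / 2.
    have pr := tube_range E Xt; have /andP[_ pw] := pr.
    apply: (le_trans (tube_xs_lip E pr ss)); rewrite mulrC -ler_pdivlMr//.
    by rewrite ler0_norm ?subr_le0// opprB; have := hT1 t t1; lra.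
  by rewrite (le_trans (ler_normD _ _))//; lra.
Qed.

End TubeAsymptotics.

(** * Strict differentiability *)

Section IntervalCalculus.
Context {R : realType}.

Lemma within_contP {W : normedModType R} (S : set R) (g : R -> W) :
  {within S, continuous g} <-> forall s, S s -> cont_in S g s.
Proof.
rewrite subspace_continuousP; split=> h s Ss.
- move=> e e0; have /cvgrPdist_le/(_ e e0) := h s Ss.
  rewrite near_withinE; apply: filterS => t ht St; rewrite distrC; exact: ht.
- apply/cvgrPdist_le => e e0; rewrite near_withinE.
  by apply: filterS (h s Ss e e0) => t ht St; rewrite distrC; exact: ht.
Qed.

(** Compactness with a single small parameter [d], used at once as a radius or lower constant and,
    through [d^-1], as an upper constant; several local constants are thereby made uniform in one
    application. *)
Lemma uniform_on_itv (a b : R) (P : R -> R -> Prop) :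
  (forall s0, a <= s0 <= b -> exists2 r, 0 < r &
     forall s d, a <= s <= b -> `|s - s0| < r -> 0 < d -> d < r -> P d s) ->
  exists2 d, 0 < d & forall s, a <= s <= b -> P d s.
Proof.
move=> h.
have /compact_near_coveringP K : compact `[a, b]%classic by exact: segment_compact.
have := K R 0^'+ (fun d s => a <= s <= b -> P d s) _.
case=> [s0|d /= d0 hd].
  rewrite /= in_itv /= => /h[r r0 hr].
  exists (ball s0 r, [set d | 0 < d < r]) => /=.
    split; first exact: nbhsx_ballx.
    by near=> d; apply/andP; split; near: d; [exact: nbhs_right_gt | exact: nbhs_right_lt].
  move=> [s d] /= [hs /andP[d0 dr] sab]; apply: hr => //.
  by move: hs; rewrite /ball /= distrC.
exists (d / 2); first by rewrite divr_gt0.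
move=> s sab; apply: (hd (d / 2)) => //=.
- rewrite /ball /= sub0r normrN gtr0_norm ?divr_gt0//; have : 0 < d by []. lra.
- by rewrite divr_gt0.
Unshelve. all: by end_near. Qed.

Section C1.
Context {W : normedModType R} (a b : R) (g : R -> W).
Hypothesis ab : a < b.
Hypothesis gC1 : Ck_on `[a, b]%classic 1 g.

Lemma C1_hderiv s : a <= s <= b -> hderiv `[a, b]%classic g s (derive_on `[a, b]%classic g s).
Proof.
by move=> sab; apply: hderiv_derive_on; case: gC1 => h _; apply: h; rewrite /= in_itv.
Qed.

Lemma C1_cont_derive s : a <= s <= b -> cont_in `[a, b]%classic (derive_on `[a, b]%classic g) s.
Proof.
move=> sab; case: gC1 => _ /within_contP; apply; by rewrite /= in_itv.
Qed.

Lemma C1_lipschitz : exists2 L, 0 < L & forall s t, a <= s <= b -> a <= t <= b ->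
  `|g s - g t| <= L * `|s - t|.
Proof.
have [d d0 hd] : exists2 d, 0 < d & forall s, a <= s <= b -> `|derive_on `[a, b]%classic g s| <= d^-1.
  apply: uniform_on_itv => s0 s0ab.
  have /nbhs_ballP[r1 /= r10 hr1] := C1_cont_derive s0ab ltr01.
  pose M := `|derive_on `[a, b]%classic g s0| + 1.
  have M0 : 0 < M by rewrite ltr_wpDl.
  exists (Num.min r1 M^-1); first by rewrite lt_min r10 invr_gt0.
  move=> s d sab; rewrite !lt_min => /andP[sr _] d0 /andP[_ dM].
  apply: (@le_trans _ _ M); last by rewrite -[M]invrK lef_pV2 ?posrE ?invr_gt0// ltW.
  have -> : derive_on `[a, b]%classic g s = derive_on `[a, b]%classic g s0 +
    (derive_on `[a, b]%classic g s - derive_on `[a, b]%classic g s0) by rewrite addrC subrK.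
  rewrite /M (le_trans (ler_normD _ _))// lerD2l; apply: hr1.
    by rewrite /ball /= distrC.
  by rewrite /= in_itv.
exists d^-1; first by rewrite invr_gt0.
move=> s t sab tab.
have := @mean_value_bound2 R W g (derive_on `[a, b]%classic g) `[a, b]%classic 0 d^-1 t s.
rewrite scaler0 subr0; apply.
- move=> r /= /andP[r1 r2]; rewrite in_itv /=; move: sab tab => /andP[s1 s2] /andP[t1 t2].
  by rewrite (le_trans _ r1) ?le_min ?t1// (le_trans r2)// ge_max t2.
- by move=> r /=; rewrite in_itv /=; exact: C1_hderiv.
- move=> r /andP[r1 r2]; rewrite subr0; apply: hd; move: sab tab => /andP[s1 s2] /andP[t1 t2].
  by rewrite (le_trans _ r1) ?le_min ?t1// (le_trans r2)// ge_max t2.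
Qed.

End C1.
End IntervalCalculus.

(** * Directional derivatives and strict differentiability up to a boundary point *)

Section DirectionalDerivatives.
Context {R : realType} {n : nat}.
Implicit Types (x y z v : 'cV[R]_n).

Lemma cV_basis v : v = \sum_j v j 0 *: delta_mx j 0.
Proof.
apply/colP => i; rewrite summxE (bigD1 i)//= big1 ?addr0; first by rewrite !mxE !eqxx mulr1.
by move=> j ji; rewrite !mxE eq_sym (negbTE ji) mulr0.
Qed.

Lemma derive_basis {W : normedModType R} (g : 'cV[R]_n -> W) x v : differentiable g x ->
  'D_v g x = \sum_j v j 0 *: 'D_(delta_mx j 0) g x.
Proof.
move=> dg; rewrite deriveE// {1}(cV_basis v) linear_sum; apply: eq_bigr => j _.
by rewrite linearZ /= deriveE.
Qed.

Lemma jac_mul {k} (g : 'cV[R]_n -> 'cV[R]_k) x v : differentiable g x ->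
  jac g x *m v = 'D_v g x.
Proof.
move=> dg; rewrite (derive_basis _ dg); apply/colP => i.
by rewrite mxE summxE; apply: eq_bigr => j _; rewrite !mxE mulrC.
Qed.

Lemma grad_mul (g : 'cV[R]_n -> R) x v : differentiable g x ->
  (grad_row g x *m v) 0 0 = 'D_v g x.
Proof.
move=> dg; rewrite (derive_basis _ dg) mxE; apply: eq_bigr => j _.
by rewrite mxE mulrC.
Qed.

Lemma hderiv_line J y v (t : R) : hderiv J (fun r => y + r *: v) t v.
Proof.
move=> e e0; apply: filterE => r _.
have -> : y + r *: v - (y + t *: v) - (r - t) *: v = 0 by apply/colP => i; rewrite !mxE; ring.
by rewrite normr0 mulr_ge0// ltW.
Qed.

Lemma hderiv_along_line {W : normedModType R} (g : 'cV[R]_n -> W) J y v (t : R) :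
  differentiable g (y + t *: v) -> hderiv J (fun r => g (y + r *: v)) t ('D_v g (y + t *: v)).
Proof.
by move=> dg; have := hderiv_diff (hderiv_line J y v t) dg; rewrite deriveE.
Qed.

Lemma segment_mean_value {W : normedModType R} (g : 'cV[R]_n -> W) x y (l : W) (k : R) :
  (forall t : R, 0 <= t <= 1 -> differentiable g (y + t *: (x - y)) /\
     `|'D_(x - y) g (y + t *: (x - y)) - l| <= k) ->
  `|g x - g y - l| <= k.
Proof.
move=> h.
have := @mean_value_bound R W (fun t => g (y + t *: (x - y)))
  (fun t => 'D_(x - y) g (y + t *: (x - y))) l k 0 1 ler01.
rewrite scale1r scale0r addr0 subr0 scale1r mulr1 [y + (x - y)]addrC subrK; apply=> t /h[dg ?] //.
exact: hderiv_along_line.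
Qed.

Definition segment_in (A : set 'cV[R]_n) y z := forall t : R, 0 <= t <= 1 -> A (y + t *: (z - y)).

(* Near an end of the orbit the tube need not be convex; its points can only be
   joined by broken lines of comparable length. *)
Definition quasiconvex_at (A : set 'cV[R]_n) x0 (k : R) := forall r : R, 0 < r ->
  exists2 q, 0 < q & forall x y, A x -> A y -> `|x - x0| < q -> `|y - x0| < q ->
  exists z1 z2, [/\ segment_in (A `&` [set z | `|z - x0| < r]) y z1,
    segment_in (A `&` [set z | `|z - x0| < r]) z1 z2,
    segment_in (A `&` [set z | `|z - x0| < r]) z2 x
  & `|z1 - y| + `|z2 - z1| + `|x - z2| <= k * `|x - y|].

Lemma quasiconvex_interior A x0 : nbhs x0 A -> quasiconvex_at A x0 1.
Proof.
move=> /nbhs_ballP[r1 /= r10 hA] r r0; exists (Num.min r r1); first by rewrite lt_min r0.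
move=> x y Ax Ay; rewrite !lt_min => /andP[xr xr1] /andP[yr yr1].
have seg0 (A' : set 'cV[R]_n) : A' y -> segment_in A' y y.
  by move=> Ay' t _; rewrite subrr scaler0 addr0.
exists y, y; split.
- exact: seg0.
- exact: seg0.
- move=> t /andP[t0 t1].
  have h q : `|x - x0| < q -> `|y - x0| < q -> `|y + t *: (x - y) - x0| < q.
    move=> xq yq.
    have -> : y + t *: (x - y) - x0 = t *: (x - x0) + (1 - t) *: (y - x0).
      by apply/colP => i; rewrite !mxE; ring.
    apply: (le_lt_trans (ler_normD _ _)); rewrite !normrZ !ger0_norm ?subr_ge0//.
    have [t0'|t0'] := eqVneq t 0; first by rewrite t0' mul0r add0r subr0 mul1r.
    have tp : 0 < t by rewrite lt_def t0'.
    have h1 : t * `|x - x0| < t * q by rewrite ltr_pM2l.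
    have h2 : (1 - t) * `|y - x0| <= (1 - t) * q by rewrite ler_wpM2l ?subr_ge0// ltW.
    lra.
  split; last exact: h.
  by apply: hA; rewrite -ball_normE /= distrC; exact: h.
- by rewrite !subrr normr0 !add0r mul1r.
Qed.

Lemma norm_coord_sum {W : normedModType R} v (l : 'I_n -> W) (k : R) :
  (forall j, `|l j| <= k) -> `|\sum_j v j 0 *: l j| <= n%:R * k * `|v|.
Proof.
move=> h; apply: (le_trans (ler_norm_sum _ _ _)).
apply: (@le_trans _ _ (\sum_(j < n) k * `|v|)).
  by apply: ler_sum => j _; rewrite normrZ mulrC ler_pM// mx_entry_le.
by rewrite sumr_const card_ord -[leLHS]mulr_natl mulrA.
Qed.

(** The mean value inequality on each of the three segments compares the increment with the limit
    derivative, and the total length is at most [k * |x - y|]. The base point may lie outside [A],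
    and the [l j] are only limits of partial derivatives; this is what an end of the orbit
    offers. *)
Lemma strictly_differentiable_on {W : normedModType R} (A : set 'cV[R]_n) x0 (k : R)
  (g : 'cV[R]_n -> W) (l : 'I_n -> W) :
  quasiconvex_at A x0 k -> (forall z, A z -> differentiable g z) ->
  (forall j (e : R), 0 < e -> \forall z \near x0, A z -> `|'D_(delta_mx j 0) g z - l j| <= e) ->
  forall e : R, 0 < e -> exists2 q, 0 < q & forall x y, A x -> A y ->
    `|x - x0| < q -> `|y - x0| < q -> `|g x - g y - \sum_j (x - y) j 0 *: l j| <= e * `|x - y|.
Proof.
move=> Aqc gd gl e e0.
(* The factor [n] pays for the sum over coordinates and [k] for the length of the broken line. *)
pose e1 := e / (n%:R * (`|k| + 1) + 1).
have N0 : 0 < n%:R * (`|k| + 1) + 1 by rewrite ltr_wpDl// mulr_ge0// addr_ge0.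
have e10 : 0 < e1 by rewrite divr_gt0.
have [r r0 hr] : exists2 r, 0 < r & forall z, A z -> `|z - x0| < r ->
    forall j, `|'D_(delta_mx j 0) g z - l j| <= e1.
  have : \forall z \near x0, forall j : 'I_n, A z -> `|'D_(delta_mx j 0) g z - l j| <= e1.
    have hF : Filter (nbhs x0) := nbhs_filter x0.
    have H := @filter_forall _ _ (fun (j : 'I_n) z => A z -> `|'D_(delta_mx j 0) g z - l j| <= e1) (nbhs x0) hF (fun j => gl j e1 e10).
    exact H.
  move=> /nbhs_ballP[r /= r0 hr]; exists r => // z Az zr j.
  by apply: hr => //; rewrite -ball_normE /= distrC.
have [q q0 hq] := Aqc r r0; exists q => // x y Ax Ay xq yq.
have [z1 [z2 [s1 s2 s3 len]]] := hq x y Ax Ay xq yq.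
have seg u v : segment_in (A `&` [set z | `|z - x0| < r]) u v ->
    `|g v - g u - \sum_j (v - u) j 0 *: l j| <= n%:R * e1 * `|v - u|.
  move=> suv; apply: segment_mean_value => t /suv[Az zr]; split; first exact: gd.
  rewrite derive_basis; last exact: gd.
  rewrite -sumrB; under eq_bigr do rewrite -scalerBr.
  by apply: norm_coord_sum => j; exact: hr.
have -> : g x - g y - \sum_j (x - y) j 0 *: l j =
   (g z1 - g y - \sum_j (z1 - y) j 0 *: l j) + (g z2 - g z1 - \sum_j (z2 - z1) j 0 *: l j)
   + (g x - g z2 - \sum_j (x - z2) j 0 *: l j).
  have -> : \sum_j (x - y) j 0 *: l j = \sum_j (z1 - y) j 0 *: l j
      + \sum_j (z2 - z1) j 0 *: l j + \sum_j (x - z2) j 0 *: l j.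
    rewrite -!big_split /=; apply: eq_bigr => j _; rewrite -!scalerDl; congr (_ *: _).
    by rewrite !mxE; ring.
  rewrite opprD opprD [LHS]addrA [X in X - _ = _]addrA.
  have aux (a b c d p1 p2 p3 : W) : a - b - p1 - p2 - p3 = c - b - p1 + (d - c - p2) + (a - d - p3).
    rewrite (addrACA (c - b)) (addrACA (c - b + (d - c))) [c - b + _]addrC subrKA.
    by rewrite [d - b + _]addrC subrKA !addrA.
  exact: aux.
apply: (le_trans (ler_normD _ _)); apply: (le_trans (lerD (ler_normD _ _) (lexx _))).
apply: (le_trans (lerD (lerD (seg _ _ s1) (seg _ _ s2)) (seg _ _ s3))).
rewrite -!mulrDr; apply: (@le_trans _ _ (n%:R * e1 * ((`|k| + 1) * `|x - y|))).
  rewrite ler_wpM2l ?(mulr_ge0 _ (ltW e10))//; apply: (le_trans len).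
  by rewrite ler_wpM2r// (le_trans (ler_norm _))// lerDl.
rewrite mulrA ler_wpM2r//.
have -> : n%:R * e1 * (`|k| + 1) = e1 * (n%:R * (`|k| + 1)) by ring.
apply: (@le_trans _ _ (e1 * (n%:R * (`|k| + 1) + 1))); first by rewrite ler_wpM2l ?(ltW e10)// lerDl.
by rewrite divfK// gt_eqF.
Qed.

Lemma C1_continuous_derive {W : normedModType R} (A : set 'cV[R]_n) (g : 'cV[R]_n -> W) x0 v (e : R) :
  Ck A 1 g -> A x0 -> 0 < e -> \forall z \near x0, `|'D_v g z - 'D_v g x0| <= e.
Proof.
move=> [_ gc] Ax0 e0; have /cvgrPdist_le/(_ e e0) := gc v x0 Ax0.
by apply: filterS => z; rewrite distrC.
Qed.

Lemma strictly_differentiable {W : normedModType R} (A : set 'cV[R]_n) (g : 'cV[R]_n -> W) x0 (e : R) :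
  open A -> Ck A 1 g -> A x0 -> 0 < e -> exists2 q, 0 < q & forall x y,
    `|x - x0| < q -> `|y - x0| < q -> `|g x - g y - 'D_(x - y) g x0| <= e * `|x - y|.
Proof.
move=> oA gC1 Ax0 e0; have nA : nbhs x0 A by apply: open_nbhs_nbhs.
have dg : forall z, A z -> differentiable g z by case: gC1.
have [|q q0 hq] := strictly_differentiable_on (quasiconvex_interior nA) dg (l := fun j => 'D_(delta_mx j 0) g x0) _ e0.
  by move=> j e' e'0; apply: filterS (C1_continuous_derive (delta_mx j 0) gC1 Ax0 e'0) => z.
move: nA => /nbhs_ballP[r /= r0 hr].
exists (Num.min q r); first by rewrite lt_min q0.
move=> x y; rewrite !lt_min => /andP[xq xr] /andP[yq yr].
have [Ax Ay] : A x /\ A y by split; apply: hr; rewrite -ball_normE /= distrC.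
by rewrite (derive_basis _ (dg _ Ax0)); exact: hq.
Qed.

End DirectionalDerivatives.

(** * Second derivatives and asymptotic expansions *)

Section Smoothness.
Context {R : realType}.

Lemma Ck_pred {V W : normedModType R} (A : set V) k (g : V -> W) : Ck A k.+1 g -> Ck A k g.
Proof.
elim: k g => [|k IH] g [dg h]; first by move=> x /dg /differentiable_continuous.
by split=> // v; apply: IH; exact: h.
Qed.

Lemma Ck_le {V W : normedModType R} (A : set V) k j (g : V -> W) : (j <= k)%N -> Ck A k g -> Ck A j g.
Proof.
elim: k => [|k IH]; first by rewrite leqn0 => /eqP ->.
by rewrite leq_eqVlt ltnS => /orP[/eqP ->//|/IH h] /Ck_pred.
Qed.

Lemma Ck_on_pred {W : normedModType R} (a b : R) k (g : R -> W) :
  Ck_on `[a, b]%classic k.+1 g -> Ck_on `[a, b]%classic k g.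
Proof.
elim: k g => [|k IH] g [dg h]; last by split=> //; exact: IH.
by apply/within_contP => s Ss; apply: hderiv_cont; apply: hderiv_derive_on; exact: dg.
Qed.

Lemma derive_scale {n} {W : normedModType R} (g : 'cV[R]_n -> W) x (k : R) v :
  differentiable g x -> 'D_(k *: v) g x = k *: 'D_v g x.
Proof. by move=> dg; rewrite !deriveE// linearZ. Qed.

(** The mean value inequality is applied to [h], the increment of [g] across [t *: v] seen while
    moving along [t *: u]; its derivative is an increment of ['D_u g], governed by strict
    differentiability of ['D_u g]. *)
Lemma second_difference {n} (A : set 'cV[R]_n) (g : 'cV[R]_n -> R) x0 u v (e : R) :
  open A -> Ck A 2 g -> A x0 -> 0 < e -> exists2 q, 0 < q & forall t : R, 0 < t -> t < q ->
  `|g (x0 + t *: u + t *: v) - g (x0 + t *: u) - (g (x0 + t *: v) - g x0)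
     - t ^+ 2 * 'D_v ('D_u g) x0| <= e * t ^+ 2.
Proof.
move=> oA gC2 Ax0 e0; have [dg hg] := gC2; have [ddg _] := hg u.
pose e1 := e / (`|v| + 1).
have v0 : 0 < `|v| + 1 by rewrite ltr_wpDl.
have e10 : 0 < e1 by rewrite divr_gt0.
have [q1 q10 hq1] := strictly_differentiable oA (hg u) Ax0 e10.
have /nbhs_ballP[r /= r0 hr] : nbhs x0 A by exact: open_nbhs_nbhs.
pose q := Num.min q1 r / (`|u| + `|v| + 1).
have uv0 : 0 < `|u| + `|v| + 1 by rewrite ltr_wpDl// addr_ge0.
have qr0 : 0 < Num.min q1 r by rewrite lt_min q10.
exists q; first by rewrite divr_gt0.
move=> t t0; rewrite ltr_pdivlMr// lt_min => /andP[tq tr].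
have bd (a b : R) : 0 <= a <= 1 -> 0 <= b <= 1 -> `|x0 + b *: (t *: v) + a *: (t *: u) - x0| <= t * (`|u| + `|v| + 1).
  move=> /andP[a0 a1] /andP[b0 b1].
  have -> : x0 + b *: (t *: v) + a *: (t *: u) - x0 = b *: (t *: v) + a *: (t *: u).
    by apply/colP => i; rewrite !mxE; ring.
  rewrite (le_trans (ler_normD _ _))// !normrZ !ger0_norm// ?(ltW t0)//.
  have h1 : b * (t * `|v|) <= t * `|v| by rewrite ler_piMl// mulr_ge0// ltW.
  have h2 : a * (t * `|u|) <= t * `|u| by rewrite ler_piMl// mulr_ge0// ltW.
  by rewrite !mulrDr mulr1; lra.
have pt (a b : R) : 0 <= a <= 1 -> 0 <= b <= 1 ->
    A (x0 + b *: (t *: v) + a *: (t *: u)) /\ `|x0 + b *: (t *: v) + a *: (t *: u) - x0| < q1.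
  move=> ha hb; have h := bd a b ha hb; split; last exact: le_lt_trans h tq.
  by apply: hr; rewrite -ball_normE /= distrC (le_lt_trans h tr).
have I0 : 0 <= (0 : R) <= 1 by rewrite lexx ler01.
have I1 : 0 <= (1 : R) <= 1 by rewrite lexx ler01.
pose y0 := x0 + t *: v.
have y0E : y0 = x0 + 1 *: (t *: v) by rewrite scale1r.
have x0E : x0 = x0 + 0 *: (t *: v) by rewrite scale0r addr0.
pose h (a : R) := g (y0 + a *: (t *: u)) - g (x0 + a *: (t *: u)).
pose dh (a : R) := 'D_(t *: u) g (y0 + a *: (t *: u)) - 'D_(t *: u) g (x0 + a *: (t *: u)).
have := @mean_value_bound R _ h dh (t ^+ 2 * 'D_v ('D_u g) x0) (e * t ^+ 2) 0 1 ler01.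
rewrite /h !scale0r !scale1r !addr0 subr0 scale1r mulr1.
have -> : y0 + t *: u = x0 + t *: u + t *: v by rewrite /y0 addrAC.
have re (a b c d : R) : a - b - (c - d) = a - c - (b - d) by ring.
move=> H; rewrite re in H.
have {}re : g (x0 + t *: u + t *: v) - g (x0 + t *: u) - (g (x0 + t *: v) - g x0) =
   g (x0 + t *: u + t *: v) - g y0 - (g (x0 + t *: u) - g x0) by rewrite /y0; ring.
rewrite -/y0 in H; rewrite re.
have -> : g (x0 + t *: u + t *: v) - g y0 - (g (x0 + t *: u) - g x0) =
  g (x0 + t *: u + t *: v) - g (x0 + t *: u) - (g y0 - g x0) by ring.
have -> : g (x0 + t *: u + t *: v) - g (x0 + t *: u) - (g y0 - g x0) =
  g (x0 + t *: u + t *: v) - g y0 - (g (x0 + t *: u) - g x0) by ring.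
apply: H => a ha.
- apply: hderivB; apply: hderiv_along_line; apply: dg.
  + by rewrite y0E; exact: (pt a 1 ha I1).1.
  + by rewrite {1}x0E; exact: (pt a 0 ha I0).1.
- have [A1 n1] := pt a 1 ha I1; have [A0 n0] := pt a 0 ha I0.
  rewrite /dh; rewrite scale1r in A1 n1; rewrite scale0r addr0 in A0 n0.
  rewrite !derive_scale; try exact: dg.
  rewrite -scalerBr; have := hq1 _ _ n1 n0.
  have -> : x0 + t *: v + a *: (t *: u) - (x0 + a *: (t *: u)) = t *: v.
    by apply/colP => i; rewrite !mxE; ring.
  rewrite derive_scale; last exact: ddg.
  move=> hh; rewrite /GRing.scale /= in hh *.
  have -> : t * ('D_u g (y0 + a *: (t *: u)) - 'D_u g (x0 + a *: (t *: u))) - t ^+ 2 * 'D_v ('D_u g) x0 =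
    t * ('D_u g (x0 + t *: v + a *: (t *: u)) - 'D_u g (x0 + a *: (t *: u)) - t * 'D_v ('D_u g) x0).
    by rewrite /y0; ring.
  rewrite normrM (gtr0_norm t0) expr2 mulrCA ler_pM2l//; apply: (le_trans hh).
  rewrite normrZ (gtr0_norm t0) /e1 mulrCA mulrC ler_pM2r// mulrAC ler_pdivrMr//.
  by rewrite ler_pM2l// lerDl.
Qed.

(** The second difference is symmetric in [u] and [v], and after division by [t ^+ 2] it
    approximates both mixed derivatives. *)
Lemma derive_comm {n} (A : set 'cV[R]_n) (g : 'cV[R]_n -> R) x0 u v :
  open A -> Ck A 2 g -> A x0 -> 'D_u ('D_v g) x0 = 'D_v ('D_u g) x0.
Proof.
move=> oA gC2 Ax0; apply/eqP; rewrite -subr_eq0 -normr_le0; apply/ler_addgt0Pr => e e0.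
have e20 : 0 < e / 2 by rewrite divr_gt0.
have [q1 q10 h1] := second_difference u v oA gC2 Ax0 e20.
have [q2 q20 h2] := second_difference v u oA gC2 Ax0 e20.
pose t := Num.min q1 q2 / 2.
have t0 : 0 < t by rewrite divr_gt0// lt_min q10.
have tm : t < Num.min q1 q2 by rewrite /t; move: t0; rewrite /t; lra.
move: tm; rewrite lt_min => /andP[t1 t2].
have := h1 t t0 t1; have := h2 t t0 t2.
rewrite [x0 + t *: v + t *: u]addrAC; set a := g _; set b := g _; set c := g _; set d := g _.
set D1 : R := 'D_u _ _; set D2 : R := 'D_v _ _ => k1 k2.
have t20 : 0 < t ^+ 2 by rewrite exprn_gt0.
rewrite add0r -(ler_pM2l t20) -{1}(gtr0_norm t20) -normrM.
have -> : t ^+ 2 * (D1 - D2) = (a - c - (b - d) - t ^+ 2 * D2) - (a - b - (c - d) - t ^+ 2 * D1) by ring.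
apply: (le_trans (ler_normB _ _)); apply: (le_trans (lerD k2 k1)).
by rewrite -mulrDl -splitr mulrC.
Qed.

End Smoothness.

(** * Landau symbols relative to the error, along a filter *)

Section Asymptotics.
Context {R : realType} {T : Type} (F : set_system T) {FF : Filter F}.
Context {N : nat} (e : T -> 'cV[R]_N).

Definition tends {m n} (g : T -> 'M[R]_(m, n)) l := forall r : R, 0 < r -> \forall x \near F, `|g x - l| <= r.
Definition small_o {m n} (g : T -> 'M[R]_(m, n)) := forall r : R, 0 < r -> \forall x \near F, `|g x| <= r * `|e x|.
Definition big_O {m n} (g : T -> 'M[R]_(m, n)) := exists2 C : R, 0 <= C & \forall x \near F, `|g x| <= C * `|e x|.

Lemma tends_cst {m n} (l : 'M[R]_(m, n)) : tends (fun=> l) l.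
Proof. by move=> r r0; apply: filterE => x; rewrite subrr normr0 ltW. Qed.

Lemma tendsD {m n} (g h : T -> 'M[R]_(m, n)) a b : tends g a -> tends h b -> tends (fun x => g x + h x) (a + b).
Proof.
move=> hg hh r r0; have r20 : 0 < r / 2 by rewrite divr_gt0.
apply: filterS2 (hg _ r20) (hh _ r20) => x h1 h2.
by rewrite opprD addrACA (le_trans (ler_normD _ _))//; lra.
Qed.

Lemma tends_bound {m n} (g : T -> 'M[R]_(m, n)) a : tends g a -> \forall x \near F, `|g x| <= `|a| + 1.
Proof.
move=> /(_ 1 ltr01); apply: filterS => x h.
by rewrite -(subrK a (g x)) addrC (le_trans (ler_normD _ _))// lerD2l.
Qed.

Lemma tends_mulmx {m n k} (g : T -> 'M[R]_(m, n)) (h : T -> 'M[R]_(n, k)) a b :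
  tends g a -> tends h b -> tends (fun x => g x *m h x) (a *m b).
Proof.
move=> hg hh r r0.
pose K := n%:R * (`|a| + `|b| + 2).
have K0 : 0 < K + 1 by rewrite ltr_wpDl// mulr_ge0// !addr_ge0.
have r1 : 0 < r / (K + 1) by rewrite divr_gt0.
apply: filterS3 (hg _ r1) (hh _ r1) (tends_bound hg) => x h1 h2 h3.
have -> : g x *m h x - a *m b = g x *m (h x - b) + (g x - a) *m b.
  by rewrite mulmxBr mulmxBl addrA subrK.
rewrite (le_trans (ler_normD _ _))//.
apply: (le_trans (lerD (mulmx_norm _ _) (mulmx_norm _ _))).
have -> : r = r / (K + 1) * (K + 1) by rewrite divfK// gt_eqF.
have n0 : 0 <= (n%:R : R) by [].
have k1 : n%:R * `|g x| * `|h x - b| <= n%:R * (`|a| + 1) * (r / (K + 1)).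
  by rewrite ler_pM ?mulr_ge0// ler_wpM2l.
have k2 : n%:R * `|g x - a| * `|b| <= n%:R * (r / (K + 1)) * `|b|.
  by rewrite ler_wpM2r// ler_wpM2l.
apply: (le_trans (lerD k1 k2)).
have -> : n%:R * (`|a| + 1) * (r / (K + 1)) + n%:R * (r / (K + 1)) * `|b| =
  r / (K + 1) * (n%:R * (`|a| + `|b| + 1)) by ring.
rewrite ler_wpM2l ?(ltW r1)// /K; nra.
Qed.

Lemma tends_trmx {m n} (g : T -> 'M[R]_(m, n)) a : tends g a -> tends (fun x => (g x)^T) a^T.
Proof. by move=> h r /h; apply: filterS => x; rewrite -linearB trmx_norm. Qed.

Lemma small_o_eq {m n} (g h : T -> 'M[R]_(m, n)) : (\forall x \near F, g x = h x) -> small_o g -> small_o h.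
Proof. by move=> gh hg r r0; apply: filterS2 gh (hg r r0) => x ->. Qed.

Lemma small_oD {m n} (g h : T -> 'M[R]_(m, n)) : small_o g -> small_o h -> small_o (fun x => g x + h x).
Proof.
move=> hg hh r r0; have r20 : 0 < r / 2 by rewrite divr_gt0.
apply: filterS2 (hg _ r20) (hh _ r20) => x h1 h2.
by rewrite (le_trans (ler_normD _ _))//; lra.
Qed.

Lemma small_oN {m n} (g : T -> 'M[R]_(m, n)) : small_o g -> small_o (fun x => - g x).
Proof. by move=> h r /h; apply: filterS => x; rewrite normrN. Qed.

Lemma small_o_bigO {m n} (g : T -> 'M[R]_(m, n)) : small_o g -> big_O g.
Proof. by move=> /(_ 1 ltr01) h; exists 1. Qed.

Lemma big_O_self : big_O e.
Proof. by exists 1 => //; apply: filterE => x; rewrite mul1r. Qed.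

Lemma big_OD {m n} (g h : T -> 'M[R]_(m, n)) : big_O g -> big_O h -> big_O (fun x => g x + h x).
Proof.
move=> [C C0 h1] [D D0 h2]; exists (C + D); first exact: addr_ge0.
by apply: filterS2 h1 h2 => x k1 k2; rewrite (le_trans (ler_normD _ _))// mulrDl lerD.
Qed.

Lemma big_O_mulmx {m n k} (A : T -> 'M[R]_(m, n)) (g : T -> 'M[R]_(n, k)) a :
  tends A a -> big_O g -> big_O (fun x => A x *m g x).
Proof.
move=> hA [C C0 hg]; exists (n%:R * (`|a| + 1) * C); first by rewrite !mulr_ge0// addr_ge0.
apply: filterS2 (tends_bound hA) hg => x h1 h2.
apply: (le_trans (mulmx_norm _ _)); apply: (@le_trans _ _ (n%:R * (`|a| + 1) * (C * `|e x|))).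
  by rewrite ler_pM ?mulr_ge0// ler_wpM2l.
by rewrite mulrA.
Qed.

Lemma small_o_mulmx {m n k} (A : T -> 'M[R]_(m, n)) (g : T -> 'M[R]_(n, k)) a :
  tends A a -> small_o g -> small_o (fun x => A x *m g x).
Proof.
move=> hA hg r r0.
have K0 : 0 < n%:R * (`|a| + 1) + 1 by rewrite ltr_wpDl// mulr_ge0// addr_ge0.
have r1 := divr_gt0 r0 K0.
apply: filterS2 (tends_bound hA) (hg _ r1) => x h1 h2.
apply: (le_trans (mulmx_norm _ _)).
apply: (@le_trans _ _ (n%:R * (`|a| + 1) * (r / (n%:R * (`|a| + 1) + 1) * `|e x|))).
  by rewrite ler_pM ?mulr_ge0// ler_wpM2l.
rewrite mulrA ler_wpM2r// mulrCA ler_piMr ?(ltW r0)// ler_pdivrMr// mul1r lerDl//.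
Qed.

Lemma small_o_sub {m n k} (A : T -> 'M[R]_(m, n)) (g : T -> 'M[R]_(n, k)) a :
  tends A a -> big_O g -> small_o (fun x => (A x - a) *m g x).
Proof.
move=> hA [C C0 hg] r r0.
have K0 : 0 < n%:R * C + 1 by rewrite ltr_wpDl// mulr_ge0.
have r1 := divr_gt0 r0 K0.
apply: filterS2 (hA _ r1) hg => x h1 h2.
apply: (le_trans (mulmx_norm _ _)).
apply: (@le_trans _ _ (n%:R * (r / (n%:R * C + 1)) * (C * `|e x|))).
  by rewrite ler_pM ?mulr_ge0// ler_wpM2l.
rewrite mulrA ler_wpM2r//.
have -> : n%:R * (r / (n%:R * C + 1)) * C = r * (n%:R * C / (n%:R * C + 1)) by ring.
by rewrite ler_piMr ?(ltW r0)// ler_pdivrMr// mul1r lerDl.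
Qed.

Lemma small_o_swap {m n k} (A : T -> 'M[R]_(m, n)) (g : T -> 'M[R]_(n, k)) a :
  tends A a -> big_O g -> small_o (fun x => A x *m g x - a *m g x).
Proof.
move=> hA hg; apply: small_o_eq (small_o_sub hA hg).
by apply: filterE => x; rewrite mulmxBl.
Qed.

Lemma small_o_sum {m n} {I : Type} (s : seq I) (g : I -> T -> 'M[R]_(m, n)) :
  (forall i, small_o (g i)) -> small_o (fun x => \sum_(i <- s) g i x).
Proof.
move=> h; elim: s => [|i s IH].
  by move=> r r0; apply: filterE => x; rewrite big_nil normr0 mulr_ge0// ltW.
by apply: small_o_eq (small_oD (h i) IH); apply: filterE => x; rewrite big_cons.
Qed.

Lemma small_o_mxP {m n} (g : T -> 'M[R]_(m, n)) :
  (forall i j (r : R), 0 < r -> \forall x \near F, `|g x i j| <= r * `|e x|) -> small_o g.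
Proof.
move=> h r r0.
have := near_mxP FF (fun i j => h i j r r0); apply: filterS => x hx.
by apply/mx_norm_leP => //; rewrite mulr_ge0// ltW.
Qed.

Lemma tends_mxP {m n} (g : T -> 'M[R]_(m, n)) (l : 'M[R]_(m, n)) :
  (forall i j (r : R), 0 < r -> \forall x \near F, `|g x i j - l i j| <= r) -> tends g l.
Proof.
move=> h r r0.
have := near_mxP FF (fun i j => h i j r r0); apply: filterS => x hx.
by apply/mx_norm_leP => [|i j]; [exact: ltW | rewrite !mxE].
Qed.

(** Replacing the matrix by its limit and the vectors by approximations costs [o (|e|^2)]: the
    difference telescopes into three terms, each with one small factor and vectors of order
    [|e|]. *)
Lemma bform_small (M : T -> 'M[R]_N) M0 (u v u' v' : T -> 'cV[R]_N) :
  tends M M0 -> big_O u -> big_O v -> small_o (fun x => u x - u' x) -> small_o (fun x => v x - v' x) ->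
  forall r : R, 0 < r -> \forall x \near F, `|bform (M x) (u x) (v x) - bform M0 (u' x) (v' x)| <= r * `|e x| ^+ 2.
Proof.
move=> hM Ou Ov su sv r r0; have [Cu Cu0 hu] := Ou; have [Cv Cv0 hv] := Ov.
have [Cw Cw0 hw] : big_O u'.
  have := big_OD Ou (small_o_bigO (small_oN su)) => -[C C0 hC].
  by exists C => //; apply: filterS hC => x; rewrite opprB addrCA subrr addr0.
pose Z := N%:R ^+ 2 * (Cu * Cv + `|M0| * Cv + `|M0| * Cw).
have Z0 : 0 <= Z by rewrite mulr_ge0 ?exprn_ge0// !addr_ge0 ?mulr_ge0.
have r1 : 0 < r / (Z + 1) by rewrite divr_gt0// ltr_wpDl.
have h3 := hM _ r1; have h4 := su _ r1; have h5 := sv _ r1.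
have hh : \forall x \near F, [/\ `|u x| <= Cu * `|e x|, `|v x| <= Cv * `|e x|, `|u' x| <= Cw * `|e x|,
    `|M x - M0| <= r / (Z + 1) & `|u x - u' x| <= r / (Z + 1) * `|e x| /\ `|v x - v' x| <= r / (Z + 1) * `|e x|].
  by apply: filterS3 (filterI hu hv) (filterI hw h3) (filterI h4 h5) => x [? ?] [? ?] [? ?].
apply: filterS hh => x [k1 k2 k3 k4 [k5 k6]].
have -> : bform (M x) (u x) (v x) - bform M0 (u' x) (v' x) =
   bform (M x - M0) (u x) (v x) + bform M0 (u x - u' x) (v x) + bform M0 (u' x) (v x - v' x).
  by rewrite bformDm bformNm bformDl bformNl bformDr bformNr; ring.
rewrite (le_trans (ler_normD _ _))// (le_trans (lerD (ler_normD _ _) (lexx _)))//.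
apply: (le_trans (lerD (lerD (bform_norm _ _ _) (bform_norm _ _ _)) (bform_norm _ _ _))).
have N0 : 0 <= N%:R ^+ 2 :> R by rewrite exprn_ge0.
set E := `|e x| in k1 k2 k3 k5 k6 *; set q := r / (Z + 1) in r1 k4 k5 k6 *.
have E0 : 0 <= E by exact: normr_ge0. have q0 := ltW r1.
have j1 : N%:R ^+ 2 * `|M x - M0| * `|u x| * `|v x| <= N%:R ^+ 2 * q * (Cu * E) * (Cv * E).
  by rewrite !ler_pM ?mulr_ge0 ?ler_wpM2l.
have j2 : N%:R ^+ 2 * `|M0| * `|u x - u' x| * `|v x| <= N%:R ^+ 2 * `|M0| * (q * E) * (Cv * E).
  by rewrite !ler_pM ?mulr_ge0.
have j3 : N%:R ^+ 2 * `|M0| * `|u' x| * `|v x - v' x| <= N%:R ^+ 2 * `|M0| * (Cw * E) * (q * E).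
  by rewrite !ler_pM ?mulr_ge0.
apply: (le_trans (lerD (lerD j1 j2) j3)).
have -> : N%:R ^+ 2 * q * (Cu * E) * (Cv * E) + N%:R ^+ 2 * `|M0| * (q * E) * (Cv * E) +
  N%:R ^+ 2 * `|M0| * (Cw * E) * (q * E) = q * Z * E ^+ 2 by rewrite /Z; ring.
rewrite ler_wpM2r ?exprn_ge0// /q mulrAC ler_pdivrMr ?ltr_wpDl//.
by rewrite ler_wpM2l ?(ltW r0)// lerDl.
Qed.

End Asymptotics.

(** * Geometry of the projection operator *)

Section ProjectionGeometry.
Context {R : realType} {n : nat}.
Variables (sa sw : R) (xs : R -> 'cV[R]_n) (r : nat) (X Ha T Hw : set 'cV[R]_n) (p : 'cV[R]_n -> R).
Hypothesis ltab : sa < sw.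
Hypothesis xsC2 : Ck_on `[sa, sw]%classic 2 xs.
Hypothesis hproj : projection_operator sa sw xs r X Ha T Hw p.

Local Notation S := (`[sa, sw]%classic).
Local Notation U := (T°).
Local Notation Fc := (derive_on `[sa, sw]%classic xs).
Local Notation e := (err xs p).

Lemma memS s : sa <= s <= sw -> S s. Proof. by rewrite /= in_itv. Qed.

Let xsC1 : Ck_on S 1 xs. Proof. exact: Ck_on_pred. Qed.

Lemma xs_lipschitz : exists2 L, 0 < L & forall s t, sa <= s <= sw -> sa <= t <= sw ->
  `|xs s - xs t| <= L * `|s - t|.
Proof. exact: (C1_lipschitz xsC1). Qed.

Lemma orbit_nbhs s : sa <= s <= sw -> nbhs (xs s) X.
Proof.
by move=> ss; apply: (proj_neighborhood hproj); exists s => //; exact: memS.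
Qed.

Lemma orbit_memX s : sa <= s <= sw -> X (xs s).
Proof. by move=> /orbit_nbhs; exact: nbhs_singleton. Qed.

Lemma tube_open : open U. Proof. exact: open_interior. Qed.

Lemma tube_subX x : U x -> X x.
Proof.
move=> /interior_subset Tx; have [_ TX _] := proj_sub hproj.
exact: interior_subset (TX x Tx).
Qed.

Lemma tube_orbit s : sa < s < sw -> U (xs s).
Proof.
move=> ss; have [q q0 hq] : exists2 q, 0 < q & eball (xs s) q `<=` T.
  by apply: (tube_radius (proj_tube hproj)); rewrite in_itv.
have N0 : 0 < n%:R + 1 :> R by rewrite ltr_wpDl.
apply/nbhs_ballP; exists (q / (n%:R + 1)); first by rewrite /= divr_gt0.
move=> y; rewrite -ball_normE /= distrC ltr_pdivlMr// => h; apply: hq.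
apply: (le_lt_trans (enorm_le_norm _)); apply: le_lt_trans h.
by rewrite mulrC ler_wpM2l// lerDl.
Qed.

Lemma proj_range_le x : X x -> sa <= p x <= sw.
Proof. by move=> /(proj_range hproj); rewrite in_itv. Qed.

Lemma proj_orbit_le s : sa <= s <= sw -> p (xs s) = s.
Proof. by move=> ss; apply: (proj_orbit hproj); rewrite in_itv. Qed.

Lemma proj_tube_lt x : U x -> sa < p x < sw.
Proof. by move=> /(proj_T hproj); rewrite in_itv. Qed.

Lemma proj_lip : exists2 L, 0 < L & forall x y, X x -> X y -> `|p x - p y| <= L * `|x - y|.
Proof.
have [M [_ hM]] := proj_lipschitz hproj.
exists (Num.max M 0 + 1); first by rewrite ltr_wpDl// le_max lexx orbT.
move=> x y Xx Xy; apply: (hM (Num.max M 0 + 1) _ (x, y)) => //.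
by rewrite (@le_lt_trans _ _ (Num.max M 0)) ?le_max ?lexx// ltrDl.
Qed.

Lemma proj_C1 : Ck U 1 p.
Proof. by have [_ h _] := proj_Cr hproj; apply: Ck_le h; have := proj_order hproj; case: (r). Qed.

Lemma proj_C2 : Ck U 2 p.
Proof. by have [_ h _] := proj_Cr hproj; apply: Ck_le h; exact: (proj_order hproj). Qed.

Lemma proj_DC1 v : Ck U 1 ('D_v p).
Proof. by have [_ h] := proj_C2; exact: h. Qed.

Lemma proj_diff x : U x -> differentiable p x.
Proof. by case: proj_C1 => h _; exact: h. Qed.

Lemma near_enorm x0 (q : R) : 0 < q -> exists2 q', 0 < q' & forall x, `|x - x0| < q' -> @eball R n x0 q x.
Proof.
move=> q0; have N0 : 0 < n%:R + 1 :> R by rewrite ltr_wpDl.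
exists (q / (n%:R + 1)); first by rewrite divr_gt0.
move=> x; rewrite ltr_pdivlMr// => h; apply: (le_lt_trans (enorm_le_norm _)).
by apply: le_lt_trans h; rewrite mulrC ler_wpM2l// lerDl.
Qed.

Lemma closure_level (H : set 'cV[R]_n) s x : H `<=` X° -> (forall y, H y -> p y = s) ->
  X x -> closure H x -> p x = s.
Proof.
move=> HX Hp Xx clx; have [L L0 hL] := proj_lip.
apply/eqP; rewrite -subr_eq0 -normr_le0; apply/ler_addgt0Pr => e0 e00.
have := clx _ (near_dist x (divr_gt0 e00 L0)) => -[y [Hy /= yx]].
rewrite add0r -(Hp y Hy); apply: (le_trans (hL x y Xx (interior_subset (HX y Hy)))).
by rewrite distrC -ler_pdivlMl// mulrC ltW.
Qed.

(** Near an end, a point outside [T] lies in the closure of the cap, where [p = s0] by continuity.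
    Since [p <> s0] is an open condition, a point satisfying it is even interior to [T]. *)
Lemma tube_near_end s0 : s0 = sa \/ s0 = sw -> exists2 q, 0 < q &
  forall x, `|x - xs s0| < q -> X x /\ (p x <> s0 -> U x).
Proof.
move=> s0E; have [eps eps0 [ca cw]] := proj_caps hproj.
have [HaX TX HwX] := proj_sub hproj.
have s0ab : sa <= s0 <= sw by case: s0E => ->; rewrite lexx ltW.
have [q1 q10 hq1] := near_enorm (xs s0) eps0.
have /nbhs_ballP[q2 /= q20 hq2] := orbit_nbhs s0ab.
have inT x : `|x - xs s0| < Num.min q1 q2 -> X x /\ (p x <> s0 -> T x).
  rewrite lt_min => /andP[x1 x2].
  have Xx : X x by apply: hq2; rewrite -ball_normE /= distrC.
  split=> // px; apply: contrapT => nT; apply: px.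
  have eb := hq1 x x1; case: s0E eb => -> eb.
  - by apply: (closure_level HaX (proj_Ha hproj) Xx); apply: ca.
  - by apply: (closure_level HwX (proj_Hw hproj) Xx); apply: cw.
have q0 : 0 < Num.min q1 q2 by rewrite lt_min q10.
exists (Num.min q1 q2) => // x xq; have [Xx Tx] := inT x xq; split=> // px.
have [L L0 hL] := proj_lip.
have d0 : 0 < `|p x - s0| / L by rewrite divr_gt0// normr_gt0 subr_eq0; apply/eqP.
have q3 : 0 < Num.min q1 q2 - `|x - xs s0| by rewrite subr_gt0.
apply/nbhs_ballP; exists (Num.min (`|p x - s0| / L) (Num.min q1 q2 - `|x - xs s0|)).
  by rewrite /= lt_min d0.
move=> y; rewrite -ball_normE /= distrC lt_min => /andP[y1 y2].
have yq : `|y - xs s0| < Num.min q1 q2.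
  rewrite -(subrK x y) -addrA (le_lt_trans (ler_normD _ _))//; lra.
have [Xy Ty] := inT y yq; apply: Ty => py.
have := hL y x Xy Xx; rewrite py distrC leNgt => /negP; apply.
by rewrite -ltr_pdivlMl// mulrC.
Qed.

Lemma orbit_pt_tends s0 : sa <= s0 <= sw ->
  forall q : R, 0 < q -> \forall x \near xs s0, X x /\ `|xs (p x) - xs s0| < q.
Proof.
move=> s0ab q q0; have [L L0 hL] := proj_lip; have [M M0 hM] := xs_lipschitz.
have q1 : 0 < q / (M * L) by rewrite divr_gt0// mulr_gt0.
apply: filterS2 (orbit_nbhs s0ab) (near_dist (xs s0) q1) => x Xx xq; split=> //.
apply: (le_lt_trans (hM _ _ (proj_range_le Xx) s0ab)).
have := hL x (xs s0) Xx (orbit_memX s0ab); rewrite (proj_orbit_le s0ab) => h.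
apply: (@le_lt_trans _ _ (M * (L * `|x - xs s0|))); first by rewrite ler_wpM2l// ltW.
by rewrite mulrA mulrC -ltr_pdivlMr// mulr_gt0.
Qed.

(** Moving the parameter slightly towards the midpoint of the interval reaches interior parameters.
    Thus even the ends of the orbit are limits of points of [T°], and limits from within the tube
    are unique. *)
Lemma tube_dense s0 : sa <= s0 <= sw -> forall q : R, 0 < q ->
  exists s, [/\ sa < s < sw, `|s - s0| < q & `|xs s - xs s0| < q].
Proof.
move=> s0ab q q0; have [M M0 hM] := xs_lipschitz; have /andP[sa0 s0w] := s0ab.
pose m := (sa + sw) / 2.
pose t := Num.min (2^-1) (Num.min (q / (1 + `|m - s0|)) (q / M / (1 + `|m - s0|)) / 2).
have m0 : 0 < 1 + `|m - s0| by rewrite ltr_pwDl.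
have t0 : 0 < t.
  have a1 : 0 < q / (1 + `|m - s0|) by rewrite divr_gt0.
  have a2 : 0 < q / M / (1 + `|m - s0|) by rewrite !divr_gt0.
  by rewrite /t lt_min invr_gt0 ltr0n /= divr_gt0// lt_min a1 a2.
have t1 : t <= 2^-1 by rewrite ge_min lexx.
pose s := s0 + t * (m - s0).
have t1' : 0 < 1 - t by have := t1; have h2 : (2^-1 : R) < 1 by [rewrite invf_lt1 ?ltr1n]; lra.
have sab : sa < s < sw.
  have e1 : s - sa = (1 - t) * (s0 - sa) + t * ((sw - sa) / 2) by rewrite /s /m; field.
  have e2 : sw - s = (1 - t) * (sw - s0) + t * ((sw - sa) / 2) by rewrite /s /m; field.
  have p1 : 0 < t * ((sw - sa) / 2) by rewrite mulr_gt0// divr_gt0// subr_gt0.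
  rewrite -subr_gt0 e1 -[s < sw]subr_gt0 e2; apply/andP; split; apply: ltr_wpDl => //;
    by rewrite mulr_ge0 ?subr_ge0// ltW// -subr_gt0.
have h : t < Num.min (q / (1 + `|m - s0|)) (q / M / (1 + `|m - s0|)).
  apply: (@le_lt_trans _ _ (Num.min (q / (1 + `|m - s0|)) (q / M / (1 + `|m - s0|)) / 2)).
    by rewrite ge_min lexx orbT.
  by rewrite ltr_pdivrMr// ltr_pMr ?ltr1n// lt_min !divr_gt0.
move: h; rewrite lt_min !ltr_pdivlMr// => /andP[h1 h2].
have d : `|s - s0| <= t * (1 + `|m - s0|).
  rewrite /s addrC addKr normrM gtr0_norm// ler_wpM2l ?(ltW t0)// lerDr//.
exists s; split=> //; first exact: le_lt_trans d h1.
have sab' : sa <= s <= sw by case/andP: sab => /ltW -> /ltW ->.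
apply: (le_lt_trans (hM _ _ sab' s0ab)); rewrite mulrC -ltr_pdivlMr//.
by rewrite ltr_pdivlMr//; apply: le_lt_trans h2; rewrite ler_wpM2r// ltW.
Qed.

Definition tube_filter s0 := within U (nbhs (xs s0)).

Lemma tube_filter_proper s0 : sa <= s0 <= sw -> ProperFilter (tube_filter s0).
Proof.
move=> s0ab; apply: Build_ProperFilter => P.
have /nbhs_ballP[q /= q0 hq] : nbhs (xs s0) (fun x => U x -> False) by exact: P.
have [s [sab _ sq]] := tube_dense s0ab q0.
by apply: (hq (xs s)) (tube_orbit sab); rewrite -ball_normE /= distrC.
Qed.

Lemma tube_filterP s0 (P : 'cV[R]_n -> Prop) :
  (\forall x \near tube_filter s0, P x) <-> (\forall x \near xs s0, U x -> P x).
Proof. by []. Qed.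

Lemma end_or_interior s0 : sa <= s0 <= sw -> (s0 = sa \/ s0 = sw) \/ sa < s0 < sw.
Proof.
move=> /andP[]; rewrite le_eqVlt => /orP[/eqP <- _|h1]; first by left; left.
rewrite le_eqVlt => /orP[/eqP ->|h2]; first by left; right.
by right; rewrite h1.
Qed.

(** Justifies the [lim] defining [Porb]: the limit exists at the ends by assumption on the
    projection operator, and inside by continuity of the derivatives of [p]. *)
Lemma Porb_tends s0 : sa <= s0 <= sw -> tends (tube_filter s0) (grad_row p) (Porb xs T p s0).
Proof.
move=> s0ab; have PF := tube_filter_proper s0ab.
have lims j : exists l : R, forall q : R, 0 < q -> \forall x \near tube_filter s0, `|'D_(delta_mx j 0) p x - l| <= q.
  have [ends|inner] := end_or_interior s0ab.
    exists (lim ('D_(delta_mx j 0) p x @[x --> tube_filter s0])) => q q0.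
    have := (@proj_D1_ends _ _ _ _ _ _ _ _ _ _ _ hproj s0 (delta_mx j 0) ends) => /cvgrPdist_le/(_ q q0).
    by apply: filterS => x; rewrite distrC.
  exists ('D_(delta_mx j 0) p (xs s0)) => q q0.
  have := C1_continuous_derive (delta_mx j 0) proj_C1 (tube_orbit inner) q0.
  by apply: filterS => x.
have [l hl] := choice lims.
have tl : tends (tube_filter s0) (grad_row p) (\row_j l j).
  apply: tends_mxP => i j q q0; apply: filterS (hl j q q0) => x.
  by rewrite !mxE.
suff -> : Porb xs T p s0 = \row_j l j by [].
apply: (@cvg_lim _ (@norm_hausdorff _ _)); apply/cvgrPdist_le => q q0.
by apply: filterS (tl q q0) => x; rewrite distrC.
Qed.

Lemma hessian_tends s0 : sa <= s0 <= sw -> exists2 H : 'M[R]_n,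
  forall i j (q : R), 0 < q -> \forall x \near tube_filter s0, `|'D_(delta_mx i 0) ('D_(delta_mx j 0) p) x - H i j| <= q
  & sa < s0 < sw -> forall i j, H i j = 'D_(delta_mx i 0) ('D_(delta_mx j 0) p) (xs s0).
Proof.
move=> s0ab; have PF := tube_filter_proper s0ab.
have [ends|inner] := end_or_interior s0ab.
  exists (\matrix_(i, j) lim ('D_(delta_mx i 0) ('D_(delta_mx j 0) p) x @[x --> tube_filter s0])).
    move=> i j q q0.
    have := (@proj_D2_ends _ _ _ _ _ _ _ _ _ _ _ hproj s0 (delta_mx j 0) (delta_mx i 0) ends) => /cvgrPdist_le/(_ q q0).
    by apply: filterS => x; rewrite distrC mxE.
  by move=> /andP[h1 h2]; case: ends => h; move: h1 h2; rewrite h ltxx.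
exists (\matrix_(i, j) 'D_(delta_mx i 0) ('D_(delta_mx j 0) p) (xs s0)) => [i j q q0|_ i j]; last by rewrite mxE.
have := C1_continuous_derive (delta_mx i 0) (proj_DC1 (delta_mx j 0)) (tube_orbit inner) q0.
by apply: filterS => x h Ux; rewrite mxE.
Qed.

Lemma xs_hderiv s : sa <= s <= sw -> hderiv S xs s (Fc s).
Proof. exact: C1_hderiv xsC1 s. Qed.

Lemma grad_tangent s : sa < s < sw -> grad_row p (xs s) *m Fc s = 1%:M.
Proof.
move=> sab; have sab' : sa <= s <= sw by case/andP: sab => /ltW -> /ltW ->.
have Us := tube_orbit sab; have dp := proj_diff Us.
apply/matrixP => i j; rewrite !ord1 grad_mul// mxE eqxx /=.
have h1 := hderiv_diff (xs_hderiv sab') dp; rewrite -deriveE// in h1.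
have h2 : hderiv S (p \o xs) s 1.
  apply: (hderiv_near (hderiv_id S s)); first by rewrite /= proj_orbit_le.
  by apply: filterE => t St; split=> //=; rewrite proj_orbit_le//; move: St; rewrite /= in_itv.
by rewrite -(derive_onE ltab sab' h1) (derive_onE ltab sab' h2).
Qed.

Lemma p_tends s0 (q : R) : sa <= s0 <= sw -> 0 < q -> \forall x \near xs s0, X x -> `|p x - s0| < q.
Proof.
move=> s0ab q0; have [L L0 hL] := proj_lip.
apply: filterS (near_dist (xs s0) (divr_gt0 q0 L0)) => x xq Xx.
have := hL x (xs s0) Xx (orbit_memX s0ab); rewrite (proj_orbit_le s0ab) => h.
by apply: (le_lt_trans h); rewrite mulrC -ltr_pdivlMr.
Qed.

Lemma param_tends {k l} (g : R -> 'M[R]_(k, l)) s0 (A : set 'cV[R]_n) : A `<=` X -> sa <= s0 <= sw ->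
  cont_in S g s0 -> tends (within A (nbhs (xs s0))) (fun x => g (p x)) (g s0).
Proof.
move=> AX s0ab gc q q0; have /nbhs_ballP[d /= d0 hd] := gc q q0.
have := p_tends s0ab d0; rewrite near_withinE; apply: filterS => x hx Ax.
apply: hd; first by rewrite /ball /= distrC; apply: hx; exact: AX.
by apply: memS; apply: proj_range_le; exact: AX.
Qed.

Lemma Fc_tends s0 (A : set 'cV[R]_n) : A `<=` X -> sa <= s0 <= sw ->
  tends (within A (nbhs (xs s0))) (fun x => Fc (p x)) (Fc s0).
Proof.
move=> AX s0ab; apply: (param_tends AX s0ab).
have [_ /within_contP h] := xsC1; exact: h (memS s0ab).
Qed.

Lemma grad_orbit_tends s0 : sa <= s0 <= sw ->
  tends (tube_filter s0) (fun x => grad_row p (xs (p x))) (Porb xs T p s0).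
Proof.
move=> s0ab q q0.
have /nbhs_ballP[d /= d0 hd] : nbhs (xs s0) (fun x => U x -> `|grad_row p x - Porb xs T p s0| <= q).
  exact: Porb_tends s0ab q q0.
have := orbit_pt_tends s0ab d0; rewrite tube_filterP; apply: filterS => x [_ hx] Ux.
apply: hd; first by rewrite -ball_normE /= distrC.
exact: tube_orbit (proj_tube_lt Ux).
Qed.

(** The identity of [grad_tangent] holds at interior parameters and passes to the ends along the
    base points [xs (p x)]. *)
Lemma Porb_tangent s0 : sa <= s0 <= sw -> Porb xs T p s0 *m Fc s0 = 1%:M.
Proof.
move=> s0ab; have PF := tube_filter_proper s0ab.
have h : tends (tube_filter s0) (fun x => grad_row p (xs (p x)) *m Fc (p x)) (Porb xs T p s0 *m Fc s0).
  by apply: tends_mulmx; [exact: grad_orbit_tends | exact: (Fc_tends (@tube_subX) s0ab)].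
apply/eqP; rewrite -subr_eq0 -normr_le0; apply/ler_addgt0Pr => q q0.
have : \forall x \near tube_filter s0, `|1%:M - Porb xs T p s0 *m Fc s0| <= q.
  have := h q q0; rewrite !tube_filterP; apply: filterS => x hx Ux.
  by have := hx Ux; rewrite (grad_tangent (proj_tube_lt Ux)).
by move=> /filter_ex[x]; rewrite distrC add0r.
Qed.

Lemma tangent_speed s0 : sa <= s0 <= sw ->
  \forall z \near xs s0, U z -> 2^-1 <= 'D_(Fc s0) p z.
Proof.
move=> s0ab; have PF := tube_filter_proper s0ab.
have : tends (tube_filter s0) (fun z => grad_row p z *m Fc s0) (Porb xs T p s0 *m Fc s0).
  by apply: tends_mulmx; [exact: Porb_tends | exact: tends_cst].
rewrite (Porb_tangent s0ab) => /(_ 2^-1); rewrite invr_gt0 ltr0n => /(_ isT).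
rewrite tube_filterP; apply: filterS => z hz Uz.
rewrite -grad_mul; last exact: proj_diff.
have := le_trans (mx_entry_le _ 0 0) (hz Uz); rewrite !mxE eqxx /= ler_norml; lra.
Qed.

(** The inward sign: it makes [end_height] nonnegative on [X] at either end, so both ends are
    treated by one argument. *)
Definition end_side s0 : R := if s0 == sa then 1 else -1.

Definition end_height s0 x : R := end_side s0 * (p x - s0).

Section AtEnd.
Variable s0 : R.
Hypothesis ends : s0 = sa \/ s0 = sw.

Lemma end_side_norm : `|end_side s0| = 1.
Proof. by rewrite /end_side; case: ifP; rewrite ?normrN normr1. Qed.

Lemma end_side_sqr : end_side s0 * end_side s0 = 1.
Proof. by rewrite /end_side; case: ifP => _; [rewrite mulr1 | rewrite mulrNN mulr1]. Qed.

Lemma end_height_ge0 x : X x -> 0 <= end_height s0 x.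
Proof.
move=> /proj_range_le /andP[p1 p2]; rewrite /end_height /end_side; case: eqP => [->|ne].
  by rewrite mul1r subr_ge0.
by case: ends => // ->; rewrite mulN1r opprB subr_ge0.
Qed.

Lemma end_height_gt0 x : U x -> 0 < end_height s0 x.
Proof.
move=> Ux; rewrite lt_def end_height_ge0 ?andbT; last exact: tube_subX.
have /andP[p1 p2] := proj_tube_lt Ux.
rewrite /end_height mulf_neq0//; first by rewrite -normr_gt0 end_side_norm.
by rewrite subr_eq0; case: ends => ->; [rewrite gt_eqF | rewrite lt_eqF].
Qed.

Lemma end_height_neq x : 0 < end_height s0 x -> p x <> s0.
Proof. by rewrite /end_height => hx px; move: hx; rewrite px subrr mulr0 ltxx. Qed.

Lemma end_height_lip : exists2 L, 0 < L & forall x y, X x -> X y ->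
  `|end_height s0 x - end_height s0 y| <= L * `|x - y|.
Proof.
have [L L0 hL] := proj_lip; exists L => // x y Xx Xy.
have -> : end_height s0 x - end_height s0 y = end_side s0 * (p x - p y) by rewrite /end_height; ring.
by rewrite normrM end_side_norm mul1r; exact: hL.
Qed.

(* The slope is only known inside the tube, but a ray along which the height does not
   decrease cannot reach the level [s0], hence never leaves the tube. *)
Lemma tube_ray y d l k : 0 <= l -> 0 <= k -> U y ->
  (forall t, 0 <= t <= l -> X (y + t *: d) /\ (p (y + t *: d) <> s0 -> U (y + t *: d))) ->
  (forall t, 0 <= t <= l -> U (y + t *: d) -> k <= end_side s0 * 'D_d p (y + t *: d)) ->
  end_height s0 y + k * l <= end_height s0 (y + l *: d).
Proof.
move=> l0 k0 Uy inX slope; have [L L0 h_lip] := end_height_lip.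
have M0 : 0 <= `|d| by exact: normr_ge0.
pose h := end_height s0; pose g t := k * t - h (y + t *: d).
suff : g l <= g 0 by rewrite /g scale0r addr0 mulr0 /h; lra.
apply: (@dini _ g 0 l 0) => //.
- by rewrite /g scale0r addr0 mulr0 sub0r oppr_lt0 end_height_gt0.
- move=> t tdl z z0.
  have K0 : 0 < k + L * `|d| + 1 by rewrite ltr_wpDl// addr_ge0// mulr_ge0// ltW.
  apply: filterS (near_dist t (divr_gt0 z0 K0)) => u ut udl.
  have -> : g u - g t = k * (u - t) - (h (y + u *: d) - h (y + t *: d)) by rewrite /g; ring.
  rewrite (le_trans (ler_normB _ _))//.
  have := h_lip _ _ (inX u udl).1 (inX t tdl).1; rewrite -/(h _) -/(h (y + t *: d)).
  have -> : y + u *: d - (y + t *: d) = (u - t) *: d by apply/colP => i; rewrite !mxE; ring.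
  rewrite normrZ normrM (ger0_norm k0) => h1.
  move: ut; rewrite ltr_pdivlMr// => ut.
  by have := normr_ge0 (u - t); lra.
- move=> t /andP[t0 tdl] gt z z0.
  have tdl' : 0 <= t <= l by rewrite t0 ltW.
  have kt : 0 <= k * t by rewrite mulr_ge0.
  have Ut : U (y + t *: d).
    by apply: (inX t tdl').2; apply: end_height_neq; move: gt; rewrite /g -/h; lra.
  have hd : hderiv [set u | 0 <= u <= l] g t (k - end_side s0 * 'D_d p (y + t *: d)).
    have k1 : hderiv [set u | 0 <= u <= l] (fun t : R => k * t) t k.
      have := hderivZ k (hderiv_id [set u | 0 <= u <= l] t).
      by rewrite {2}/GRing.scale /= mulr1.
    apply: hderivB k1 _.
    have k2 := hderivZ (end_side s0) (hderiv_along_line [set u | 0 <= u <= l] (proj_diff Ut)).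
    have k3 := hderivD k2 (hderiv_cst [set u | 0 <= u <= l] (- (end_side s0 * s0)) t).
    rewrite addr0 in k3; apply: (hderiv_near k3); first by rewrite /h /end_height /GRing.scale /=; ring.
    by apply: filterE => u Iu; split=> //; rewrite /h /end_height /GRing.scale /=; ring.
  have w0 : k - end_side s0 * 'D_d p (y + t *: d) <= 0 by rewrite subr_le0; exact: slope.
  apply: filterS (hderiv_dini hd w0 z0) => u hu /andP[tu udl]; apply: hu => //.
  by rewrite /= udl (le_trans t0).
Qed.

End AtEnd.

(** At an end, both points are lifted along the inward tangent, on which the height grows at speed
    at least one half; the lifted points are high enough for the straight segment between them to
    remain in the tube. The constant is the length [1 + 8 * L * M] of this detour. *)
Lemma quasiconvex_tube s0 : sa <= s0 <= sw -> exists k, quasiconvex_at U (xs s0) k.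
Proof.
move=> s0ab; have [ends|inner] := end_or_interior s0ab; last first.
  exists 1; apply: quasiconvex_interior; apply: open_nbhs_nbhs; split; first exact: tube_open.
  exact: tube_orbit.
have [L L0 h_lip] := end_height_lip s0.
have [q1 q10 hq1] := tube_near_end ends.
pose tau := end_side s0; pose h := end_height s0.
have tau1 : `|tau| = 1 by exact: end_side_norm.
have h_U x : `|x - xs s0| < q1 -> 0 < h x -> U x.
  by move=> xq hx; apply: (hq1 x xq).2; exact: end_height_neq hx.
have U_h x : U x -> 0 < h x by exact: end_height_gt0.
pose d := tau *: Fc s0; pose M := `|Fc s0|.
have M0 : 0 <= M by exact: normr_ge0.
have dM : `|d| = M by rewrite normrZ tau1 mul1r.
exists (1 + 8 * L * M) => q q0.
have /nbhs_ballP[q2 /= q20 hq2] := tangent_speed s0ab.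
pose q3 := Num.min q (Num.min q1 q2).
have q30 : 0 < q3 by rewrite !lt_min q0 q10.
have ray y dl : U y -> 0 <= dl -> (forall t, 0 <= t <= dl -> `|y + t *: d - xs s0| < q3) ->
    h y + dl / 2 <= h (y + dl *: d).
  move=> Uy dl0 inb.
  have inb1 t : 0 <= t <= dl -> [/\ `|y + t *: d - xs s0| < q1 & `|y + t *: d - xs s0| < q2].
    by move=> /inb; rewrite !lt_min => /and3P[].
  rewrite [dl / 2]mulrC; apply: tube_ray => // [t /inb1[b1 _]|t /inb1[_ b2] Ut]; first exact: hq1.
  rewrite derive_scale; last exact: proj_diff.
  rewrite /GRing.scale /= mulrA end_side_sqr mul1r.
  by apply: hq2 => //; rewrite -ball_normE /= distrC.
(* A shrinking factor that keeps the lifts and the connecting segment inside the ball of radius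
   [q3]. *)
pose N := 8 + 16 * L * M.
have N0 : 0 < N by rewrite /N ltr_pwDl// !mulr_ge0// ltW.
exists (q3 / N); first by rewrite divr_gt0.
move=> x y Ux Uy; rewrite !ltr_pdivlMr// => xq yq.
(* The lift gains height at least [dl / 2 = 2 * L * D], more than the [L * D] that can be lost
   between the lifted points. *)
pose D := `|x - y|; pose dl := 4 * L * D.
have D0 : 0 <= D by exact: normr_ge0.
have dl0 : 0 <= dl by rewrite !mulr_ge0// ltW.
have DE : D <= `|x - xs s0| + `|y - xs s0|.
  rewrite /D; have -> : x - y = (x - xs s0) - (y - xs s0) by apply/colP => i; rewrite !mxE; ring.
  exact: ler_normB.
have inball z w t : `|z - xs s0| * N < q3 -> `|w| <= D -> 0 <= t <= dl -> `|z + w + t *: d - xs s0| < q3.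
  move=> zq wD /andP[t0 tdl].
  have -> : z + w + t *: d - xs s0 = (z - xs s0) + w + t *: d by apply/colP => i; rewrite !mxE; ring.
  rewrite (le_lt_trans (ler_normD _ _))// (le_lt_trans (lerD (ler_normD _ _) (lexx _)))//.
  rewrite normrZ dM (ger0_norm t0).
  have a1 : t * M <= 4 * L * D * M by rewrite ler_wpM2r.
  have Q : 4 * L * D * M <= 4 * L * M * (`|x - xs s0| + `|y - xs s0|).
    by rewrite mulrAC ler_wpM2l// !mulr_ge0// ltW.
  set ax := `|x - xs s0| in xq DE Q *; set ay := `|y - xs s0| in yq DE Q *.
  set az := `|z - xs s0| in zq *; set LM := 4 * L * M in Q.
  have LM0 : 0 <= LM by rewrite !mulr_ge0// ltW.
  have NE : N = 8 + 4 * LM by rewrite /N /LM; ring.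
  rewrite NE in xq yq zq.
  have : az + ax + ay + LM * (ax + ay) < q3.
    have ax0 : 0 <= ax by exact: normr_ge0. have ay0 : 0 <= ay by exact: normr_ge0. have az0 : 0 <= az by exact: normr_ge0.
    have : 0 <= LM * ax by rewrite mulr_ge0. have : 0 <= LM * ay by rewrite mulr_ge0.
    have : 0 <= LM * az by rewrite mulr_ge0. lra.
  lra.
have small0 z t : `|z - xs s0| * N < q3 -> 0 <= t <= dl -> `|z + t *: d - xs s0| < q3.
  by move=> zq tdl; have := @inball z 0 t zq; rewrite normr0 addr0; apply.
have q3q z : `|z - xs s0| < q3 -> `|z - xs s0| < q /\ `|z - xs s0| < q1.
  by rewrite !lt_min => /and3P[].
have on_ray z t : U z -> `|z - xs s0| * N < q3 -> 0 <= t <= dl ->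
    (U `&` [set z | `|z - xs s0| < q]) (z + t *: d).
  move=> Uz zq tdl; have [b1 b2] := q3q _ (small0 z t zq tdl); split=> //.
  apply: h_U => //; apply: (@lt_le_trans _ _ (h z + t / 2)).
    by rewrite ltr_pwDl ?U_h// divr_ge0//; case/andP: tdl.
  have /andP[t0 tl] := tdl; apply: ray => // u /andP[u0 ut].
  by apply: small0 => //; rewrite u0 (le_trans ut).
exists (y + dl *: d), (x + dl *: d); split.
- move=> t /andP[t0 t1].
  have -> : y + t *: (y + dl *: d - y) = y + (t * dl) *: d by apply/colP => i; rewrite !mxE; ring.
  by apply: on_ray => //; rewrite mulr_ge0//= ler_piMl.
- move=> t /andP[t0 t1].
  have -> : y + dl *: d + t *: (x + dl *: d - (y + dl *: d)) = y + t *: (x - y) + dl *: d.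
    by apply/colP => i; rewrite !mxE; ring.
  have dlI : 0 <= dl <= dl by rewrite dl0 lexx.
  have tD : `|t *: (x - y)| <= D by rewrite normrZ ger0_norm// ler_piMl.
  have [b1 b2] := q3q _ (inball y (t *: (x - y)) dl yq tD dlI).
  split=> //; apply: h_U => //.
  have Xz := (hq1 _ b2).1.
  have [_ b3] := q3q _ (small0 y dl yq dlI); have Xz1 := (hq1 _ b3).1.
  have := h_lip _ _ Xz Xz1.
  have -> : y + t *: (x - y) + dl *: d - (y + dl *: d) = t *: (x - y) by apply/colP => i; rewrite !mxE; ring.
  rewrite ler_norml => /andP[k1 _].
  have k2 : h y + dl / 2 <= h (y + dl *: d).
    by apply: ray => // u udl; exact: small0.
  have k3 := U_h y Uy.
  have k4 : L * `|t *: (x - y)| <= L * D by rewrite ler_wpM2l// ltW.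
  have k5 : 0 <= L * D by rewrite mulr_ge0// ltW.
  by move: k2 k3; rewrite /dl /h; lra.
- move=> t /andP[t0 t1].
  have -> : x + dl *: d + t *: (x - (x + dl *: d)) = x + ((1 - t) * dl) *: d by apply/colP => i; rewrite !mxE; ring.
  by apply: on_ray => //; rewrite mulr_ge0 ?subr_ge0//= ler_piMl// gerBl.
- have -> : y + dl *: d - y = dl *: d by apply/colP => i; rewrite !mxE; ring.
  have -> : x + dl *: d - (y + dl *: d) = x - y by apply/colP => i; rewrite !mxE; ring.
  have -> : x - (x + dl *: d) = - (dl *: d) by apply/colP => i; rewrite !mxE; ring.
  by rewrite normrN normrZ dM (ger0_norm dl0) /dl -/D; lra.
Qed.

Section NearOrbit.
Variable s0 : R.
Hypothesis s0ab : sa <= s0 <= sw.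

Let x0 := xs s0.

(** Both [x] and its base point [xs (p x)] vary in the tube near [xs s0], so strict
    differentiability is used, with the derivative frozen at [s0]. *)
Lemma strict_on_base {W : normedModType R} (g : 'cV[R]_n -> W) (l : 'I_n -> W) :
  (forall z, U z -> differentiable g z) ->
  (forall j (q : R), 0 < q -> \forall z \near x0, U z -> `|'D_(delta_mx j 0) g z - l j| <= q) ->
  forall q : R, 0 < q -> \forall x \near tube_filter s0,
    `|g x - g (xs (p x)) - \sum_j (e x) j 0 *: l j| <= q * `|e x|.
Proof.
move=> dg gl q q0; have [k hk] := quasiconvex_tube s0ab.
have [d d0 hd] := strictly_differentiable_on hk dg gl q0.
rewrite tube_filterP; apply: filterS2 (near_dist x0 d0) (orbit_pt_tends s0ab d0) => x xd [_ xd'] Ux.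
apply: hd => //; exact: tube_orbit (proj_tube_lt Ux).
Qed.

Lemma Porb_err : small_o (tube_filter s0) e (fun x => Porb xs T p s0 *m e x).
Proof.
have PF := tube_filter_proper s0ab.
apply: small_o_mxP => i j q q0.
have gl (j' : 'I_n) (q' : R) : 0 < q' -> \forall z \near x0, U z -> `|'D_(delta_mx j' 0) p z - Porb xs T p s0 0 j'| <= q'.
  move=> q'0; have := Porb_tends s0ab q'0; rewrite tube_filterP; apply: filterS => z hz Uz.
  by have := le_trans (mx_entry_le _ 0 j') (hz Uz); rewrite !mxE.
have := strict_on_base (@proj_diff) gl q0; rewrite !tube_filterP; apply: filterS => x hx Ux.
have := hx Ux; rewrite proj_orbit_le ?subrr ?sub0r ?normrN; last first.
  by have /andP[/ltW -> /ltW ->] := proj_tube_lt Ux.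
by rewrite !ord1 mxE; under eq_bigr do rewrite /GRing.scale /= mulrC.
Qed.

(** Inside the interval [H] is the Hessian of [p]. At the ends it is only the limit from the tube,
    and it enters later through the factor [rho s0], which vanishes there. *)
Lemma grad_err : exists2 H : 'M[R]_n,
  small_o (tube_filter s0) e (fun x => (grad_row p x)^T - (grad_row p (xs (p x)))^T - H^T *m e x) &
  sa < s0 < sw -> forall i j, H i j = 'D_(delta_mx i 0) ('D_(delta_mx j 0) p) x0.
Proof.
have PF := tube_filter_proper s0ab.
have [H hH Hin] := hessian_tends s0ab; exists H => //.
apply: small_o_mxP => i j q q0.
have dg z : U z -> differentiable ('D_(delta_mx i 0) p) z by case: (proj_DC1 (delta_mx i 0)) => h _; exact: h.
have gl (j' : 'I_n) (q' : R) : 0 < q' -> \forall z \near x0, U z ->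
    `|'D_(delta_mx j' 0) ('D_(delta_mx i 0) p) z - H j' i| <= q'.
  by move=> q'0; exact: hH.
have := strict_on_base dg gl q0; rewrite !tube_filterP; apply: filterS => x hx Ux.
have := hx Ux; rewrite !mxE; congr (`| _ - _| <= _).
by apply: eq_bigr => k _; rewrite !mxE ord1 /GRing.scale /= mulrC.
Qed.

End NearOrbit.

End ProjectionGeometry.

(** * Expansion of the closed loop along the orbit *)

Section LocalLipschitz.
Context {R : realType} {n : nat}.
Variables (X : set 'cV[R]_n) (x0 : 'cV[R]_n).

Definition lip_near {W : normedModType R} (g : 'cV[R]_n -> W) :=
  exists L q : R, [/\ 0 <= L, 0 < q & forall x y, X x -> X y -> `|x - x0| < q -> `|y - x0| < q ->
    `|g x - g y| <= L * `|x - y|].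

Lemma lip_near_bound {W : normedModType R} (g : 'cV[R]_n -> W) : X x0 -> lip_near g ->
  exists M q : R, [/\ 0 <= M, 0 < q & forall x, X x -> `|x - x0| < q -> `|g x| <= M].
Proof.
move=> Xx0 [L [q [L0 q0 h]]]; exists (`|g x0| + L * q), q; split=> //.
  by rewrite addr_ge0// mulr_ge0// ltW.
move=> x Xx xq; rewrite -(subrK (g x0) (g x)) addrC (le_trans (ler_normD _ _))// lerD2l.
apply: (le_trans (h x x0 Xx Xx0 xq _)); first by rewrite subrr normr0.
by rewrite ler_wpM2l// ltW.
Qed.

Lemma lip_near_id : lip_near id.
Proof. by exists 1, 1; split=> // x y _ _ _ _; rewrite mul1r. Qed.

Lemma lip_nearD {W : normedModType R} (g h : 'cV[R]_n -> W) : lip_near g -> lip_near h ->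
  lip_near (fun x => g x + h x).
Proof.
move=> [L [q [L0 q0 hg]]] [M [r [M0 r0 hh]]]; exists (L + M), (Num.min q r); split.
- exact: addr_ge0.
- by rewrite lt_min q0.
- move=> x y Xx Xy; rewrite !lt_min => /andP[x1 x2] /andP[y1 y2].
  rewrite opprD addrACA (le_trans (ler_normD _ _))// mulrDl lerD//.
    exact: hg.
  exact: hh.
Qed.

Lemma lip_nearN {W : normedModType R} (g : 'cV[R]_n -> W) : lip_near g -> lip_near (fun x => - g x).
Proof.
move=> [L [q [L0 q0 h]]]; exists L, q; split=> // x y Xx Xy xq yq.
by rewrite -opprD normrN; exact: h.
Qed.

Lemma lip_near_mulmx {a b c} (g : 'cV[R]_n -> 'M[R]_(a, b)) (h : 'cV[R]_n -> 'M[R]_(b, c)) :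
  X x0 -> lip_near g -> lip_near h -> lip_near (fun x => g x *m h x).
Proof.
move=> Xx0 hg hh; have [Mg [qg [Mg0 qg0 bg]]] := lip_near_bound Xx0 hg.
have [Mh [qh [Mh0 qh0 bh]]] := lip_near_bound Xx0 hh.
have [L [q [L0 q0 lg]]] := hg; have [M [r [M0 r0 lh]]] := hh.
exists (b%:R * (Mg * M + L * Mh)), (Num.min (Num.min qg qh) (Num.min q r)); split.
- by rewrite mulr_ge0// addr_ge0// mulr_ge0.
- by rewrite !lt_min qg0 qh0 q0.
- move=> x y Xx Xy; rewrite !lt_min => /andP[/andP[x1 x2] /andP[x3 x4]] /andP[/andP[y1 y2] /andP[y3 y4]].
  have -> : g x *m h x - g y *m h y = g x *m (h x - h y) + (g x - g y) *m h y.
    by rewrite mulmxBr mulmxBl addrA subrK.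
  rewrite (le_trans (ler_normD _ _))// (le_trans (lerD (mulmx_norm _ _) (mulmx_norm _ _)))//.
  rewrite mulrDr mulrDl; apply: lerD.
    rewrite -!mulrA ler_wpM2l// ler_pM//; [exact: bg | exact: lh].
  rewrite -!mulrA ler_wpM2l// [Mh * _]mulrC mulrA ler_pM//; [exact: lg | exact: bh].
Qed.

Lemma lip_near_trmx {a b} (g : 'cV[R]_n -> 'M[R]_(a, b)) : lip_near g -> lip_near (fun x => (g x)^T).
Proof.
move=> [L [q [L0 q0 h]]]; exists L, q; split=> // x y Xx Xy xq yq.
by rewrite -linearB trmx_norm; exact: h.
Qed.

Lemma lip_near_mx {a b} (g : 'cV[R]_n -> 'M[R]_(a, b)) :
  (forall j, lip_near (fun x => col j (g x))) -> lip_near g.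
Proof.
move=> h.
have {h} h j : exists Lq : R * R, [/\ 0 <= Lq.1, 0 < Lq.2 & forall x y, X x -> X y -> `|x - x0| < Lq.2 ->
    `|y - x0| < Lq.2 -> `|col j (g x) - col j (g y)| <= Lq.1 * `|x - y|].
  by have [L [q hh]] := h j; exists (L, q).
have [Lq hLq] := choice h.
pose L := \sum_j (Lq j).1.
have Lj j : (Lq j).1 <= L.
  rewrite /L (bigD1 j)//= lerDl sumr_ge0// => i _; by have [] := hLq i.
have L0 : 0 <= L by apply: sumr_ge0 => j _; have [] := hLq j.
have [q q0 hq] : exists2 q : R, 0 < q & forall j, q <= (Lq j).2.
  have : \forall q \near (0 : R)^'+, forall j, q <= (Lq j).2.
    have hF : Filter (0 : R)^'+ by exact: at_right_proper_filter.
    have hj j : \forall q \near (0 : R)^'+, q <= (Lq j).2.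
      by have [_ h' _] := hLq j; exact: nbhs_right_le.
    exact: (filter_forall hF hj).
  move=> hh; near (0 : R)^'+ => q; exists q; first by near: q; exact: nbhs_right_gt.
  by near: q.
exists L, q; split=> // x y Xx Xy xq yq; apply/mx_norm_leP; first by rewrite mulr_ge0.
move=> i j; have [_ _ /(_ x y Xx Xy)] := hLq j.
rewrite !(lt_le_trans _ (hq j))// => /(_ isT isT) hh.
have := le_trans (mx_entry_le _ i 0) hh; rewrite !mxE => h2; apply: (le_trans h2).
by rewrite ler_wpM2r.
Unshelve. all: by end_near. Qed.

Lemma lip_near_C1 {W : normedModType R} (g : 'cV[R]_n -> W) : Ck setT 1 g -> lip_near g.
Proof.
move=> gC1; have [q q0 h] := strictly_differentiable openT gC1 (I : setT x0) ltr01.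
have dg : differentiable g x0 by case: gC1 => dg _; exact: dg.
have [k k0 hk] := linear_lipschitz (diff_continuous dg).
exists (k + 1), q; split=> //; first by rewrite addr_ge0// ltW.
move=> x y _ _ xq yq; have := h x y xq yq; rewrite mul1r deriveE// => h1.
rewrite -(subrK ('d g x0 (x - y)) (g x - g y)) (le_trans (ler_normD _ _))//.
by rewrite mulrDl mul1r addrC lerD.
Qed.

Lemma lip_near_param {W : normedModType R} (p : 'cV[R]_n -> R) (a b L M : R) (g : R -> W) :
  0 <= L -> 0 <= M -> (forall x, X x -> a <= p x <= b) ->
  (forall x y, X x -> X y -> `|p x - p y| <= L * `|x - y|) ->
  (forall s t, a <= s <= b -> a <= t <= b -> `|g s - g t| <= M * `|s - t|) ->
  lip_near (fun x => g (p x)).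
Proof.
move=> L0 M0 pr pl gl; exists (M * L), 1; split; rewrite ?mulr_ge0//.
move=> x y Xx Xy _ _; apply: (le_trans (gl _ _ (pr x Xx) (pr y Xy))).
by rewrite -mulrA ler_wpM2l//; exact: pl.
Qed.

Lemma lip_near_entry {a b} (g : 'cV[R]_n -> 'M[R]_(a, b)) i j : lip_near g -> lip_near (fun x => g x i j).
Proof.
move=> [L [q [L0 q0 h]]]; exists L, q; split=> // x y Xx Xy xq yq.
by apply: le_trans (h x y Xx Xy xq yq); apply: le_trans (mx_entry_le _ i j); rewrite !mxE.
Qed.

End LocalLipschitz.

Section MoreAsymptotics.
Context {R : realType} {T : Type} (F : set_system T) {FF : Filter F}.

Lemma scalar_tends {k} (g : T -> R) (l : R) : (forall r, 0 < r -> \forall x \near F, `|g x - l| <= r) ->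
  tends F (fun x => (g x)%:M : 'M[R]_k) l%:M.
Proof.
move=> h r r0; apply: filterS (h r r0) => x hx.
apply/mx_norm_leP => [|i j]; first exact: ltW.
by rewrite !mxE; case: eqP => _; rewrite ?mulr1n// !mulr0n subrr normr0 ltW.
Qed.

Lemma big_O_tends0 {N m n} (e : T -> 'cV[R]_N) (g : T -> 'M[R]_(m, n)) : tends F e 0 -> big_O F e g -> tends F g 0.
Proof.
move=> he [C C0 hg] r r0; have C1 : 0 < C + 1 by rewrite ltr_wpDl.
apply: filterS2 (he _ (divr_gt0 r0 C1)) hg => x; rewrite !subr0 => h1 h2.
apply: (le_trans h2); apply: (@le_trans _ _ ((C + 1) * `|e x|)); first by rewrite ler_wpM2r// lerDl.
by rewrite mulrC -ler_pdivlMr.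
Qed.

Lemma tends_unique {m n} (g : T -> 'M[R]_(m, n)) a b : ProperFilter F -> tends F g a -> tends F g b -> a = b.
Proof.
move=> PF ha hb; apply/eqP; rewrite -subr_eq0 -normr_le0; apply/ler_addgt0Pr => r r0.
have r20 : 0 < r / 2 by rewrite divr_gt0.
have [x [h1 h2]] := filter_ex (filterI (ha _ r20) (hb _ r20)).
have -> : a - b = (g x - b) - (g x - a) by apply/matrixP => i j; rewrite !mxE; ring.
by rewrite add0r (le_trans (ler_normB _ _))//; lra.
Qed.

Lemma bform_mull {n} (A M : 'M[R]_n) (u v : 'cV[R]_n) : bform (A^T *m M) u v = bform M (A *m u) v.
Proof. by rewrite /bform trmx_mul !mulmxA. Qed.

Lemma bform_mulr {n} (A M : 'M[R]_n) (u v : 'cV[R]_n) : bform (M *m A) u v = bform M u (A *m v).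
Proof. by rewrite /bform !mulmxA. Qed.

End MoreAsymptotics.

Section ClosedLoopEstimates.
Context {R : realType} {n m : nat}.
Variables (f : 'cV[R]_n -> 'cV[R]_n) (B : 'cV[R]_n -> 'M[R]_(n, m)).
Variables (sa sw : R) (xs : R -> 'cV[R]_n) (us : R -> 'cV[R]_m) (rho : R -> R).
Variables (r : nat) (X Ha T Hw : set 'cV[R]_n) (p : 'cV[R]_n -> R).
Variables (K : R -> 'M[R]_(m, n)) (Rm : R -> 'M[R]_n).
Hypothesis hsys : control_system f B.
Hypothesis ltab : sa < sw.
Hypothesis xsC2 : Ck_on `[sa, sw]%classic 2 xs.
Hypothesis usC1 : Ck_on `[sa, sw]%classic 1 us.
Hypothesis rhoC1 : Ck_on `[sa, sw]%classic 1 rho.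
Hypothesis rho_ends : rho sa = 0 /\ rho sw = 0.
Hypothesis dynamics : forall s, s \in `[sa, sw] ->
  rho s *: derive_on `[sa, sw]%classic xs s = f (xs s) + B (xs s) *m us s.
Hypothesis hproj : projection_operator sa sw xs r X Ha T Hw p.
Hypothesis hK : smooth_on `[sa, sw]%classic K.
Hypothesis hRC1 : Ck_on `[sa, sw]%classic 1 Rm.
Hypothesis hRpos : forall s, s \in `[sa, sw] -> posdef (Rm s).

Local Notation S := (`[sa, sw]%classic).
Local Notation U := (T°).
Local Notation Fc := (derive_on `[sa, sw]%classic xs).
Local Notation Rd := (derive_on `[sa, sw]%classic Rm).
Local Notation e := (err xs p).
Local Notation F := (closed_loop f B xs us K p).
Local Notation V := (lyap xs p Rm).
Local Notation A := (Acl f B xs us K).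
Local Notation Xfilter s0 := (within X (nbhs (xs s0))).
Local Notation Ufilter s0 := (tube_filter xs T s0).

Lemma f_C1 : Ck setT 1 f.
Proof. by case: hsys => h _ _; exact: Ck_pred. Qed.

Lemma B_C1 i : Ck setT 1 (fun x => col i (B x)).
Proof. by case: hsys => _ h _; apply: Ck_pred; exact: h. Qed.

Lemma K_C1 : Ck_on S 1 K. Proof. exact: hK 1%N. Qed.

Lemma C1_cont_in {W : normedModType R} (g : R -> W) s : Ck_on S 1 g -> sa <= s <= sw -> cont_in S g s.
Proof. by move=> /Ck_on_pred /within_contP h ss; apply: h; rewrite /= in_itv. Qed.

Lemma lip_near_of_param {W : normedModType R} x0 (g : R -> W) : Ck_on S 1 g -> lip_near X x0 (fun x => g (p x)).
Proof.
move=> gC1; have [L L0 hL] := proj_lip hproj; have [M M0 hM] := C1_lipschitz gC1.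
exact: (@lip_near_param _ _ X x0 W p sa sw L M g (ltW L0) (ltW M0) (@proj_range_le _ _ _ _ _ _ _ _ _ _ _ hproj) hL hM).
Qed.

Lemma err_lip_near x0 : lip_near X x0 e.
Proof.
apply: lip_nearD; first exact: lip_near_id.
by apply: lip_nearN; apply: lip_near_of_param; exact: Ck_on_pred.
Qed.

Lemma closed_loop_lip_near x0 : X x0 -> lip_near X x0 F.
Proof.
move=> Xx0; apply: lip_nearD; first exact: lip_near_C1 f_C1.
apply: lip_near_mulmx => //.
  by apply: lip_near_mx => j; apply: lip_near_C1; exact: B_C1.
apply: lip_nearD; first exact: lip_near_of_param.
by apply: lip_near_mulmx => //; [exact: (lip_near_of_param _ K_C1) | exact: err_lip_near].
Qed.

Lemma lyap_lip_near x0 : X x0 -> lip_near X x0 V.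
Proof.
move=> Xx0; apply: lip_near_entry; apply: lip_near_mulmx => //; last exact: err_lip_near.
apply: lip_near_mulmx => //; last exact: lip_near_of_param.
by apply: lip_near_trmx; exact: err_lip_near.
Qed.

Lemma lyap_locally_lipschitz : locally_lipschitz X V.
Proof.
move=> x Xx; have [L [q [L0 q0 h]]] := lyap_lip_near Xx.
exists (ball x q); first exact: nbhsx_ballx.
exists L; split; first exact: num_real.
move=> M LM [y z] /= [[Xy yq] [Xz zq]].
apply: (@le_trans _ _ (L * `|y - z|)); last by rewrite ler_wpM2r// ltW.
by apply: h => //; [move: yq | move: zq]; rewrite -ball_normE /= distrC.
Qed.

Lemma lyap_cont x : X x -> forall q, 0 < q -> \forall y \near x, X y -> `|V y - V x| <= q.
Proof.
move=> Xx q q0; have [L [d [L0 d0 h]]] := lyap_lip_near Xx.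
have L1 : 0 < L + 1 by rewrite ltr_wpDl.
apply: filterS2 (near_dist x d0) (near_dist x (divr_gt0 q0 L1)) => y y1 y2 Xy.
apply: (le_trans (h y x Xy Xx y1 _)); first by rewrite subrr normr0.
move: y2; rewrite ltr_pdivlMr// => /ltW y2; apply: le_trans y2.
by rewrite mulrC ler_wpM2l// lerDl.
Qed.

Section AtPoint.
Variable s0 : R.
Hypothesis s0ab : sa <= s0 <= sw.

Let x0 := xs s0.
Let FX : Filter (Xfilter s0). Proof. exact: within_filter. Qed.
Let FU : ProperFilter (Ufilter s0). Proof. exact: (tube_filter_proper ltab xsC2 hproj s0ab). Qed.

Lemma X_to_U (P : 'cV[R]_n -> Prop) : (\forall x \near Xfilter s0, P x) -> \forall x \near Ufilter s0, P x.
Proof.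
rewrite near_withinE => h; apply/tube_filterP; apply: filterS h => x h Ux.
exact: h (tube_subX hproj Ux).
Qed.

Lemma increment_small {k} (g : 'cV[R]_n -> 'cV[R]_k) : Ck setT 1 g ->
  small_o (Xfilter s0) e (fun x => g x - g (xs (p x)) - jac g x0 *m e x).
Proof.
move=> gC1 q q0; have [d d0 hd] := strictly_differentiable openT gC1 (I : setT x0) q0.
have dg : differentiable g x0 by case: gC1 => dg _; exact: dg.
rewrite near_withinE.
apply: filterS2 (near_dist x0 d0) (orbit_pt_tends xsC2 hproj s0ab d0) => x x1 [_ x2] Xx.
by rewrite jac_mul//; exact: hd.
Qed.

Lemma param_tendsX {k l} (g : R -> 'M[R]_(k, l)) : Ck_on S 1 g ->
  tends (Xfilter s0) (fun x => g (p x)) (g s0).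
Proof. by move=> gC1; apply: (param_tends hproj (@subset_refl _ X) s0ab); exact: C1_cont_in. Qed.

Lemma rho_tendsX q : 0 < q -> \forall x \near Xfilter s0, `|rho (p x) - rho s0| <= q.
Proof.
move=> q0; have /nbhs_ballP[d /= d0 hd] := C1_cont_in rhoC1 s0ab q0.
have := p_tends hproj s0ab d0; rewrite near_withinE; apply: filterS => x hx Xx.
apply: hd; first by rewrite /ball /= distrC; exact: hx.
by apply: memS; exact: (proj_range_le hproj).
Qed.

Lemma err_tends0 : tends (Xfilter s0) e 0.
Proof.
move=> q q0; have q20 : 0 < q / 2 by rewrite divr_gt0.
rewrite near_withinE.
apply: filterS2 (near_dist x0 q20) (orbit_pt_tends xsC2 hproj s0ab q20) => x x1 [_ x2] Xx.
rewrite subr0 /err; have -> : x - xs (p x) = (x - x0) - (xs (p x) - x0).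
  by apply/colP => i; rewrite !mxE; ring.
by rewrite (le_trans (ler_normB _ _))//; lra.
Qed.

Lemma B_tends : tends (Xfilter s0) B (B x0).
Proof.
apply: tends_mxP => i j q q0.
have /differentiable_continuous/cvgrPdist_le/(_ q q0) : differentiable (fun x => col j (B x)) x0.
  by case: (B_C1 j) => dB _; exact: dB.
rewrite near_withinE; apply: filterS => x hx _.
by have := le_trans (mx_entry_le _ i 0) hx; rewrite !mxE distrC.
Qed.

Lemma mulmx_sum_col {k} (M : 'M[R]_(n, k)) (u : 'cV[R]_k) : M *m u = \sum_i u i 0 *: col i M.
Proof.
by apply/colP => j; rewrite mxE summxE; apply: eq_bigr => i _; rewrite !mxE mulrC.
Qed.

(** At the base point [rho F] is replaced by [f + B u]. What remains are increments of [f] and of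
    the columns of [B], linearized by strict differentiability, and the feedback term; freezing
    [us (p x)] and [B x *m K (p x)] at [s0] costs [o (|e|)]. The expansion holds on tube and caps
    alike. *)
Lemma closed_loop_expansion :
  small_o (Xfilter s0) e (fun x => F x - rho (p x) *: Fc (p x) - A s0 *m e x).
Proof.
pose J i := jac (fun y => col i (B y)) x0.
have h1 := increment_small f_C1.
have h2 : small_o (Xfilter s0) e (fun x => \sum_i
    ((us (p x) i 0)%:M *m (col i (B x) - col i (B (xs (p x))) - J i *m e x) +
     ((us (p x) i 0)%:M - (us s0 i 0)%:M) *m (J i *m e x))).
  apply: small_o_sum => i.
  have t1 : tends (Xfilter s0) (fun x => (us (p x) i 0)%:M : 'M[R]_n) (us s0 i 0)%:M.
    apply: scalar_tends => q q0; apply: filterS (param_tendsX usC1 q0) => x hx.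
    by have := le_trans (mx_entry_le _ i 0) hx; rewrite !mxE.
  apply: small_oD; first exact: small_o_mulmx t1 (increment_small (B_C1 i)).
  apply: small_o_sub t1 _; apply: big_O_mulmx (tends_cst _) (big_O_self _).
have h3 : small_o (Xfilter s0) e (fun x => (B x *m K (p x)) *m e x - (B x0 *m K s0) *m e x).
  apply: small_o_swap (big_O_self _); apply: tends_mulmx; first exact: B_tends.
  exact: param_tendsX K_C1.
apply: small_o_eq (small_oD (small_oD h1 h2) h3).
rewrite near_withinE; apply: filterE => x Xx.
have -> : rho (p x) *: Fc (p x) = f (xs (p x)) + B (xs (p x)) *m us (p x).
  by apply: dynamics; rewrite in_itv /=; exact: (proj_range_le hproj).
rewrite /closed_loop /feedback /Acl /Alin -/x0.
have -> : \sum_i ((us (p x) i 0)%:M *m (col i (B x) - col i (B (xs (p x))) - J i *m e x) +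
     ((us (p x) i 0)%:M - (us s0 i 0)%:M) *m (J i *m e x)) =
     B x *m us (p x) - B (xs (p x)) *m us (p x) - (\sum_i us s0 i 0 *: J i) *m e x.
  rewrite (mulmx_sum_col (B x)) (mulmx_sum_col (B (xs (p x)))) mulmx_suml -!sumrB; apply: eq_bigr => i _.
  rewrite mulmxBl !mul_scalar_mx -scalemxAl !scalerBr; by apply/colP => k; rewrite !mxE; ring.
rewrite !mulmxDl (mulmxDr (B x) (us (p x))) mulmxA.
set a1 := f x; set a2 := f (xs (p x)); set a3 := jac f x0 *m e x; set a4 := B x *m us (p x).
set a5 := B (xs (p x)) *m us (p x); set a6 := _ *m e x; set a7 := B x *m K (p x) *m e x.
set a8 := B x0 *m K s0 *m e x.
by apply/colP => k; rewrite !mxE; ring.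
Qed.

Lemma end_expansion : rho s0 = 0 -> forall (M : 'M[R]_n) (q : R), 0 < q ->
  \forall x \near Xfilter s0, p x = s0 ->
   `|bform M (F x) (e x) + bform M (e x) (F x) - bform ((A s0)^T *m M + M *m A s0) (e x) (e x)| <= q * `|e x| ^+ 2.
Proof.
move=> rho0 M q q0; have q20 : 0 < q / 2 by rewrite divr_gt0.
pose G x := F x - rho (p x) *: Fc (p x).
have Gs : small_o (Xfilter s0) e (fun x => G x - A s0 *m e x) := closed_loop_expansion.
have Ae : big_O (Xfilter s0) e (fun x => A s0 *m e x) by apply: big_O_mulmx (tends_cst _) (big_O_self _).
have GO : big_O (Xfilter s0) e G.
  have := big_OD (small_o_bigO Gs) Ae => -[C C0 hC].
  by exists C => //; apply: filterS hC => x; rewrite subrK.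
have e0 : small_o (Xfilter s0) e (fun x => e x - e x).
  by move=> q' q'0; apply: filterE => x; rewrite subrr normr0 mulr_ge0// ltW.
have h1 : \forall x \near Xfilter s0, `|bform M (G x) (e x) - bform M (A s0 *m e x) (e x)| <= q / 2 * `|e x| ^+ 2.
  exact: (@bform_small R _ _ FX n e (fun=> M) M G e _ e (tends_cst M) GO (big_O_self e) Gs e0 _ q20).
have h2 : \forall x \near Xfilter s0, `|bform M (e x) (G x) - bform M (e x) (A s0 *m e x)| <= q / 2 * `|e x| ^+ 2.
  exact: (@bform_small R _ _ FX n e (fun=> M) M e G e _ (tends_cst M) (big_O_self e) GO e0 Gs _ q20).
apply: filterS2 h1 h2 => x k1 k2 px.
have GF : G x = F x by rewrite /G px rho0 scale0r subr0.
rewrite GF in k1 k2; rewrite bformDm bform_mull bform_mulr.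
have -> : bform M (F x) (e x) + bform M (e x) (F x) - (bform M (A s0 *m e x) (e x) + bform M (e x) (A s0 *m e x)) =
  (bform M (F x) (e x) - bform M (A s0 *m e x) (e x)) + (bform M (e x) (F x) - bform M (e x) (A s0 *m e x)) by ring.
by rewrite (le_trans (ler_normD _ _))//; lra.
Qed.

End AtPoint.
End ClosedLoopEstimates.

(** * Expansion of the Lyapunov derivative *)

Lemma sum3_close {R : realFieldType} (a b c a' b' c' q z : R) : `|a - a'| <= q / 3 * z ->
  `|b - b'| <= q / 3 * z -> `|c - c'| <= q / 3 * z -> `|a + b + c - (a' + b' + c')| <= q * z.
Proof.
move=> h1 h2 h3; have -> : a + b + c - (a' + b' + c') = (a - a') + (b - b') + (c - c') by ring.
rewrite (le_trans (ler_normD _ _))// (le_trans (lerD (ler_normD _ _) (lexx _)))//; lra.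
Qed.

Section TubeDecay.
Context {R : realType} {n m : nat}.
Variables (f : 'cV[R]_n -> 'cV[R]_n) (B : 'cV[R]_n -> 'M[R]_(n, m)).
Variables (sa sw : R) (xs : R -> 'cV[R]_n) (us : R -> 'cV[R]_m) (rho : R -> R).
Variables (r : nat) (X Ha T Hw : set 'cV[R]_n) (p : 'cV[R]_n -> R).
Variables (K : R -> 'M[R]_(m, n)) (Rm Qp : R -> 'M[R]_n).
Hypothesis hsys : control_system f B.
Hypothesis ltab : sa < sw.
Hypothesis xsC2 : Ck_on `[sa, sw]%classic 2 xs.
Hypothesis usC1 : Ck_on `[sa, sw]%classic 1 us.
Hypothesis rhoC1 : Ck_on `[sa, sw]%classic 1 rho.
Hypothesis rho_ends : rho sa = 0 /\ rho sw = 0.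
Hypothesis dynamics : forall s, s \in `[sa, sw] ->
  rho s *: derive_on `[sa, sw]%classic xs s = f (xs s) + B (xs s) *m us s.
Hypothesis hproj : projection_operator sa sw xs r X Ha T Hw p.
Hypothesis hK : smooth_on `[sa, sw]%classic K.
Hypothesis hRC1 : Ck_on `[sa, sw]%classic 1 Rm.

Local Notation S := (`[sa, sw]%classic).
Local Notation U := (T°).
Local Notation Fc := (derive_on `[sa, sw]%classic xs).
Local Notation Rd := (derive_on `[sa, sw]%classic Rm).
Local Notation P := (Porb xs T p).
Local Notation e := (err xs p).
Local Notation F := (closed_loop f B xs us K p).
Local Notation V := (lyap xs p Rm).
Local Notation A := (Acl f B xs us K).
Local Notation E := (Eperp sa sw xs T p).
Local Notation Rp := (fun t => (E t)^T *m Rm t *m E t).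
Local Notation Xfilter s0 := (within X (nbhs (xs s0))).
Local Notation Ufilter s0 := (tube_filter xs T s0).

Hypothesis Qp_pos : forall s, s \in `[sa, sw] -> posdef (Qp s).
Hypothesis perp : forall s, s \in `[sa, sw] ->
  (E s)^T *m ((A s)^T *m Rp s + Rp s *m A s + rho s *: derive_on S Rp s + Qp s) *m E s = 0.

Definition proj_rate x : R := (grad_row p x *m F x) 0 0.
Definition err_rate x : 'cV[R]_n := F x - Fc (p x) *m (grad_row p x *m F x).
Definition lyap_rate x : R := bform (Rm (p x)) (err_rate x) (e x) +
  bform (Rm (p x)) (e x) (err_rate x) + bform (proj_rate x *: Rd (p x)) (e x) (e x).

Lemma hderiv_entry {k l} J (g : R -> 'M[R]_(k, l)) t d i j : hderiv J g t d ->
  hderiv J (fun t => g t i j) t (d i j).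
Proof. by move=> /hderiv_mxP. Qed.

Lemma mulmx11 {k} (v : 'cV[R]_k) (M : 'M[R]_1) : v *m M = M 0 0 *: v.
Proof. by apply/colP => i; rewrite !mxE big_ord1 !ord1 mulrC. Qed.

Lemma proj_rate_along x : U x -> derivative_along F p x (proj_rate x).
Proof.
move=> Ux J phi t k phix h; have dp := proj_diff hproj Ux.
have := hderiv_diff (g := p) h; rewrite phix => /(_ dp).
by rewrite -deriveE// derive_scale// /proj_rate grad_mul.
Qed.

Lemma lyap_rate_along x : U x -> derivative_along F V x (lyap_rate x).
Proof.
move=> Ux J phi t k phix h; have hp := proj_rate_along Ux phix h.
have pS : \forall u \near t, J u -> S (p (phi u)).
  have UN : nbhs (phi t) U by rewrite phix; apply: open_nbhs_nbhs; split=> //; exact: tube_open.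
  have /nbhs_ballP[q /= q0 hq] := UN.
  have q20 : 0 < q / 2 by rewrite divr_gt0.
  apply: filterS (hderiv_cont h q20) => u hu Ju; apply: memS.
  have Uu : U (phi u).
    by apply: hq; rewrite -ball_normE /= distrC (le_lt_trans (hu Ju))// ltr_pdivrMr// ltr_pMr// ltr1n.
  by have /andP[/ltW -> /ltW ->] := proj_tube_lt hproj Uu.
have pt : sa <= p (phi t) <= sw by rewrite phix; have /andP[/ltW -> /ltW ->] := proj_tube_lt hproj Ux.
have hxs := hderiv_comp hp pS (xs_hderiv xsC2 pt).
have hR := hderiv_comp hp pS (C1_hderiv hRC1 pt).
have he := hderivB h hxs.
have hV := hderiv_entry 0 0 (hderiv_mulmx (hderiv_mulmx (hderiv_trmx he) hR) he).
suff <- : (((k *: F x - (k * proj_rate x) *: Fc (p (phi t)))^T *m Rm (p (phi t)) +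
    (phi t - xs (p (phi t)))^T *m ((k * proj_rate x) *: Rd (p (phi t)))) *m (phi t - xs (p (phi t))) +
    (phi t - xs (p (phi t)))^T *m Rm (p (phi t)) *m (k *: F x - (k * proj_rate x) *: Fc (p (phi t)))) 0 0
    = k * lyap_rate x by exact: hV.
rewrite phix -/(e x) -scalerA -scalerBr -scalerA /lyap_rate /err_rate mulmx11 -/(proj_rate x).
set v := F x - _; rewrite mulmxDl mxE [X in X + _]mxE -!/(bform _ _ _).
by rewrite bformZl bformZr bformZm; ring.
Qed.

Section AtPoint.
Variable s0 : R.
Hypothesis s0ab : sa <= s0 <= sw.

Let x0 := xs s0.
Let FX : Filter (Xfilter s0). Proof. exact: within_filter. Qed.
Let PF : ProperFilter (Ufilter s0). Proof. exact: (tube_filter_proper ltab xsC2 hproj s0ab). Qed.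
Let FU : Filter (Ufilter s0). Proof. exact: PF. Qed.

Lemma small_o_mulmxB {a b c} (M : 'cV[R]_n -> 'M[R]_(a, b)) M0 (g g0 : 'cV[R]_n -> 'M[R]_(b, c)) :
  tends (Ufilter s0) M M0 -> small_o (Ufilter s0) e (fun x => g x - g0 x) -> big_O (Ufilter s0) e g0 ->
  small_o (Ufilter s0) e (fun x => M x *m g x - M0 *m g0 x).
Proof.
move=> hM hg h0; apply: small_o_eq (small_oD (small_o_mulmx hM hg) (small_o_swap hM h0)).
by apply: filterE => x; rewrite mulmxBr addrA subrK.
Qed.

Let eself : big_O (Ufilter s0) e e. Proof. exact: big_O_self. Qed.

Let tcst {k l} (M : 'M[R]_(k, l)) : tends (Ufilter s0) (fun=> M) M. Proof. exact: tends_cst. Qed.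

Let G x := F x - rho (p x) *: Fc (p x).

Lemma drift_expansion : small_o (Ufilter s0) e (fun x => G x - A s0 *m e x).
Proof.
move=> q q0; apply: (X_to_U hproj).
exact: (closed_loop_expansion hsys xsC2 usC1 dynamics hproj hK s0ab q0).
Qed.

Lemma big_O_lin {k} (M : 'M[R]_(k, n)) : big_O (Ufilter s0) e (fun x => M *m e x).
Proof. by apply: big_O_mulmx (tends_cst _) (big_O_self _). Qed.

Lemma rho_tends {k} : tends (Ufilter s0) (fun x => (rho (p x))%:M : 'M[R]_k) (rho s0)%:M.
Proof.
by apply: scalar_tends => q q0; apply: (X_to_U hproj); exact: (rho_tendsX rhoC1 hproj s0ab).
Qed.

Section Hessian.
Variable H : 'M[R]_n.
Hypothesis H_err : small_o (Ufilter s0) e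
  (fun x => (grad_row p x)^T - (grad_row p (xs (p x)))^T - H^T *m e x).
Hypothesis H_val : sa < s0 < sw -> forall i j, H i j = 'D_(delta_mx i 0) ('D_(delta_mx j 0) p) x0.

(** The linear part in [e] of [p' - rho (p)]: the drift seen by [P], plus the change of the gradient
    of [p] between the base point and [x], acting on the motion [rho F] along the curve. *)
Definition rate_slope : 'rV[R]_n := rho s0 *: ((Fc s0)^T *m H^T) + P s0 *m A s0.

Lemma proj_rate_expansion : small_o (Ufilter s0) e
  (fun x => grad_row p x *m F x - (rho (p x))%:M - rate_slope *m e x).
Proof.
have h1 := small_o_mulmxB (Porb_tends ltab xsC2 hproj s0ab) drift_expansion (big_O_lin _).
have FT : tends (Ufilter s0) (fun x => Fc (p x)) (Fc s0) by apply: (Fc_tends xsC2 hproj _ s0ab); exact: (tube_subX hproj).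
have h2 := small_o_mulmxB (@tends_mulmx _ _ _ FU _ _ _ _ _ _ _ rho_tends (@tends_trmx _ _ _ FU _ _ _ _ FT)) H_err (big_O_lin _).
apply: small_o_eq (small_oD h1 h2); apply/tube_filterP; apply: filterE => x Ux.
have gt := grad_tangent ltab xsC2 hproj (proj_tube_lt hproj Ux).
(* At the base point the gradient of [p] maps the tangent to [1]; this is how the term [rho (p x)]
   separates off. *)
have MG : (rho (p x))%:M *m (Fc (p x))^T *m ((grad_row p x)^T - (grad_row p (xs (p x)))^T) =
   rho (p x) *: (grad_row p x *m Fc (p x)) - (rho (p x))%:M.
  rewrite mul_scalar_mx -scalemxAl mulmxBr.
  rewrite -(trmx_mul (grad_row p x)) -(trmx_mul (grad_row p (xs (p x)))) gt trmx1.
  set M := _ *m _.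
  by apply/matrixP => i j; rewrite !ord1 !mxE !eqxx !mulr1n; ring.
transitivity (grad_row p x *m G x - P s0 *m (A s0 *m e x) + (rho (p x) *: (grad_row p x *m Fc (p x)) -
    (rho (p x))%:M - (rho s0)%:M *m (Fc s0)^T *m (H^T *m e x))); first by congr (_ + (_ - _)); exact: MG.
have -> : F x = G x + rho (p x) *: Fc (p x) by rewrite /G subrK.
rewrite (mulmxDr (grad_row p x) (G x)) -scalemxAr /rate_slope (mulmxDl (rho s0 *: _)) -scalemxAl.
rewrite mul_scalar_mx -scalemxAl !mulmxA.
set a1 := _ *m G x; set a2 := P s0 *m _ *m _; set a3 := rho (p x) *: _; set a4 := _%:M; set a5 := rho s0 *: _.
by apply/matrixP => i j; rewrite !mxE; ring.
Qed.

Lemma proj_rate_bigO : big_O (Ufilter s0) e (fun x => grad_row p x *m F x - (rho (p x))%:M).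
Proof.
have [C C0 hC] := big_OD (small_o_bigO proj_rate_expansion) (big_O_lin rate_slope).
by exists C => //; apply: filterS hC => x; rewrite subrK.
Qed.

Definition err_slope : 'M[R]_n := A s0 - Fc s0 *m rate_slope.

Lemma err_rate_expansion : small_o (Ufilter s0) e (fun x => err_rate x - err_slope *m e x).
Proof.
have FT : tends (Ufilter s0) (fun x => Fc (p x)) (Fc s0) by apply: (Fc_tends xsC2 hproj _ s0ab); exact: (tube_subX hproj).
have h1 := drift_expansion; have h2 := small_o_mulmxB FT proj_rate_expansion (big_O_lin _).
apply: small_o_eq (small_oD h1 (small_oN h2)); apply: filterE => x.
rewrite /G /err_rate /err_slope (mulmxBr (Fc (p x))) mul_mx_scalar mulmxBl !mulmxA.
by apply/colP => i; rewrite !mxE; ring.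
Qed.

Definition lyap_slope : 'M[R]_n :=
  err_slope^T *m Rm s0 + Rm s0 *m err_slope + rho s0 *: Rd s0.

Lemma err_small_o0 : small_o (Ufilter s0) e (fun x => e x - e x).
Proof. by move=> q q0; apply: filterE => x; rewrite subrr normr0 mulr_ge0// ltW. Qed.

Lemma lyap_rate_expansion q : 0 < q -> \forall x \near Ufilter s0,
  `|lyap_rate x - bform lyap_slope (e x) (e x)| <= q * `|e x| ^+ 2.
Proof.
move=> q0; have q30 : 0 < q / 3 by rewrite divr_gt0.
have RT : tends (Ufilter s0) (fun x => Rm (p x)) (Rm s0).
  by apply: (param_tends hproj _ s0ab (C1_cont_in hRC1 s0ab)); exact: (tube_subX hproj).
have dT : tends (Ufilter s0) (fun x => proj_rate x *: Rd (p x)) (rho s0 *: Rd s0).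
  have t1 : tends (Ufilter s0) (fun x => (proj_rate x)%:M : 'M[R]_n) (rho s0)%:M.
    have e0 : tends (Ufilter s0) e 0.
      by move=> q' q'0; apply: (X_to_U hproj); exact: (err_tends0 xsC2 hproj s0ab q'0).
    have w0 := @big_O_tends0 _ _ _ FU _ _ _ _ _ e0 proj_rate_bigO.
    have := @tendsD _ _ _ FU _ _ _ _ _ _ w0 rho_tends; rewrite add0r => t1.
    apply: scalar_tends => q' q'0; apply: filterS (t1 q' q'0) => x; rewrite subrK => h.
    have -> : proj_rate x - rho s0 = (grad_row p x *m F x - (rho s0)%:M) 0 0.
      by rewrite /proj_rate; set M := _ *m _; rewrite !mxE mulr1n.
    exact: le_trans (mx_entry_le _ 0 0) h.
  have t2 : tends (Ufilter s0) (fun x => Rd (p x)) (Rd s0).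
    by apply: (param_tends hproj _ s0ab (C1_cont_derive hRC1 s0ab)); exact: (tube_subX hproj).
  have := @tends_mulmx _ _ _ FU _ _ _ _ _ _ _ t1 t2; rewrite mul_scalar_mx => t3 q' q'0.
  by apply: filterS (t3 q' q'0) => x; rewrite mul_scalar_mx.
have EO : big_O (Ufilter s0) e err_rate.
  have [C C0 hC] := big_OD (small_o_bigO err_rate_expansion) (big_O_lin err_slope).
  by exists C => //; apply: filterS hC => x; rewrite subrK.
have h1 := @bform_small R _ _ FU n e _ _ err_rate e _ e RT EO eself err_rate_expansion err_small_o0 _ q30.
have h2 := @bform_small R _ _ FU n e _ _ e err_rate e _ RT eself EO err_small_o0 err_rate_expansion _ q30.
have h3 := @bform_small R _ _ FU n e _ _ e e e e dT eself eself err_small_o0 err_small_o0 _ q30.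
apply: filterS3 h1 h2 h3 => x k1 k2 k3.
rewrite /lyap_rate /lyap_slope !bformDm bform_mull bform_mulr.
exact: (sum3_close k1 k2 k3).
Qed.

Lemma Porb_interior s : sa < s < sw -> P s = grad_row p (xs s).
Proof.
move=> ss; have ss' : sa <= s <= sw by case/andP: ss => /ltW -> /ltW ->.
have PF' := tube_filter_proper ltab xsC2 hproj ss'.
have h := Porb_tends ltab xsC2 hproj ss'.
apply: (@tends_unique _ _ _ _ _ _ _ _ _ PF' h) => q q0.
apply: (@tends_mxP _ _ _ _ _ _ _ _ _ q q0) => i j q' q'0.
have := C1_continuous_derive (delta_mx j 0) (proj_C1 hproj) (tube_orbit hproj ss) q'0.
by rewrite tube_filterP; apply: filterS => x hx _; rewrite !mxE.
Qed.

Lemma Hessian_sym : sa < s0 < sw -> H^T = H.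
Proof.
move=> ss; apply/matrixP => i j; rewrite mxE (H_val ss i j) (H_val ss j i).
by apply: derive_comm (proj_C2 hproj) (tube_orbit hproj ss); exact: tube_open.
Qed.

(** The gradient of [p] is differentiated along the curve entry by entry, giving the Hessian applied
    to the tangent. *)
Lemma Porb_hderiv : sa < s0 < sw -> hderiv S P s0 ((Fc s0)^T *m H).
Proof.
move=> ss; have hx := xs_hderiv xsC2 s0ab.
have hg : hderiv S (fun t => grad_row p (xs t)) s0 ((Fc s0)^T *m H).
  apply/hderiv_mxP => i j.
  have dj : differentiable ('D_(delta_mx j 0) p) (xs s0).
    by case: (proj_DC1 hproj (delta_mx j 0)) => h _; apply: h; exact: (tube_orbit hproj ss).
  have := hderiv_diff (g := 'D_(delta_mx j 0) p) hx dj; rewrite -deriveE// (derive_basis _ dj) => h.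
  have -> : ((Fc s0)^T *m H) i j = \sum_k Fc s0 k 0 *: 'D_(delta_mx k 0) ('D_(delta_mx j 0) p) (xs s0).
    by rewrite mxE; apply: eq_bigr => k _; rewrite mxE ord1 H_val.
  apply: (hderiv_near h); first by rewrite !mxE.
  by apply: filterE => t St; split=> //; rewrite !mxE.
apply: (hderiv_near hg); first by rewrite Porb_interior.
have /andP[s1 s2] := ss.
have near_s : \forall t \near s0, sa < t < sw.
  apply: filterS2 (near_dist s0 (_ : 0 < s0 - sa)) (near_dist s0 (_ : 0 < sw - s0)); rewrite ?subr_gt0// => t.
  by rewrite !ltr_norml => /andP[t1 _] /andP[_ t2]; apply/andP; split; lra.
by apply: filterS near_s => t st St; split=> //; rewrite Porb_interior.
Qed.

(** On the kernel of [P] the projector [E] acts as the identity, so hypothesis 2 may be tested on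
    [w] itself. There [err_slope] equals [E A] minus [rho] times a Hessian term along the tangent,
    and the derivative of [R_perp] supplies exactly that term through the derivative of [E]; hence
    the two expressions agree. *)
Lemma lyap_slope_perp (w : 'cV[R]_n) : P s0 *m w = 0 ->
  bform lyap_slope w w = - bform (Qp s0) w w.
Proof.
move=> Pw; have Ew : E s0 *m w = w by rewrite /Eperp mulmxBl mul1mx -mulmxA Pw mulmx0 subr0.
have sS : s0 \in `[sa, sw] by rewrite in_itv.
have EA : E s0 *m (A s0 *m w) = A s0 *m w - Fc s0 *m (P s0 *m A s0 *m w).
  by rewrite /Eperp mulmxBl mul1mx !mulmxA.
have id0 : bform ((A s0)^T *m Rp s0 + Rp s0 *m A s0 + rho s0 *: derive_on S Rp s0 + Qp s0) w w = 0.
  have := congr1 (fun M => bform M w w) (perp sS).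
  by rewrite bform_mulr Ew bform_mull Ew => ->; rewrite /bform mulmx0 mul0mx mxE.
have Rpl u v : bform (Rp s0) u v = bform (Rm s0) (E s0 *m u) (E s0 *m v).
  by rewrite bform_mulr bform_mull.
have Lw : err_slope *m w = E s0 *m (A s0 *m w) - rho s0 *: (Fc s0 *m ((Fc s0)^T *m H^T *m w)).
  rewrite EA /err_slope /rate_slope (mulmxBl (A s0)) -(mulmxA (Fc s0)) (mulmxDl (rho s0 *: _)) (mulmxDr (Fc s0)) -scalemxAl -scalemxAr.
  by apply/colP => i; rewrite !mxE; ring.
have dR : rho s0 * bform (derive_on S Rp s0) w w = rho s0 * (bform (Rd s0) w w -
   bform (Rm s0) (Fc s0 *m ((Fc s0)^T *m H^T *m w)) w - bform (Rm s0) w (Fc s0 *m ((Fc s0)^T *m H^T *m w))).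
  (* At the ends both sides carry the factor [rho s0 = 0]; inside, the projector is genuinely
     differentiated. *)
  have [ends|inner] := end_or_interior s0ab.
    have -> : rho s0 = 0 by case: rho_ends; case: ends => ->.
    by rewrite !mul0r.
  congr (_ * _); have hF := C1_hderiv (proj2 xsC2) s0ab.
  have hE := hderivB (hderiv_cst S (1%:M : 'M[R]_n) s0) (hderiv_mulmx hF (Porb_hderiv inner)).
  have hR := C1_hderiv hRC1 s0ab.
  have hRp := hderiv_mulmx (hderiv_mulmx (hderiv_trmx hE) hR) hE.
  rewrite (derive_onE ltab s0ab hRp) -/(E s0) (Hessian_sym inner).
  (* [D] is the derivative of the projector. Its part containing the derivative of the tangent ends
     in [P] and vanishes on [w]; only the derivative of [P] survives. *)
  set D := 0 - _.
  have Dw : D *m w = - (Fc s0 *m ((Fc s0)^T *m H *m w)).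
    by rewrite /D sub0r mulNmx mulmxDl -!mulmxA Pw mulmx0 add0r.
  by rewrite mulmxDl -!mulmxA !bformDm !bform_mull !bform_mulr Ew Dw bformNl bformNr -!mulmxA; ring.
move: id0; rewrite 3!bformDm (bform_mull (A s0)) (bform_mulr (A s0)) !Rpl Ew bformZm dR.
rewrite /lyap_slope 2!bformDm bform_mull bform_mulr Lw bformZm.
set a := E s0 *m _; set b := Fc s0 *m _.
rewrite bformDl bformDr bformNl bformNr bformZl bformZr.
move: (bform (Rm s0) a w) (bform (Rm s0) w a) (bform (Rm s0) b w) (bform (Rm s0) w b) (bform (Rd s0) w w)
  (bform (Qp s0) w w) => x1 x2 y1 y2 z q; lra.
Qed.

(* The hypothesis on [Qp] only determines [lyap_slope] on the kernel of [P s0]; this suffices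
   because [e x] is tangent to that kernel up to [o (|e x|)]. *)
Lemma tube_decay : exists c C : R, [/\ 0 < c, 0 < C &
  \forall x \near Ufilter s0, - C * `|e x| ^+ 2 <= lyap_rate x <= - c * `|e x| ^+ 2].
Proof.
have sS : s0 \in `[sa, sw] by rewrite in_itv.
have [c0 c00 hc] := posdef_lower (Qp_pos sS).
(* Three approximations, each costing a quarter of [c0], leave a decay constant of [c0 / 4]. *)
have eta0 : 0 < c0 / 4 by rewrite divr_gt0.
have E_err : small_o (Ufilter s0) e (fun x => e x - E s0 *m e x).
  have := @small_o_mulmx _ _ _ FU _ _ _ _ _ _ _ _ (tcst (Fc s0)) (Porb_err ltab xsC2 hproj s0ab).
  apply: small_o_eq; apply: filterE => x.
  by rewrite /Eperp mulmxBl mul1mx mulmxA; apply/colP => i; rewrite !mxE; ring.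
have PE : P s0 *m E s0 = 0.
  by rewrite /Eperp mulmxBr mulmx1 mulmxA (Porb_tangent ltab xsC2 hproj s0ab) mul1mx subrr.
have h1 := lyap_rate_expansion eta0.
have h2 := @bform_small R _ _ FU n e _ _ e e _ _ (tcst lyap_slope) eself eself E_err E_err _ eta0.
have h3 := @bform_small R _ _ FU n e _ _ e e _ _ (tcst (Qp s0)) eself eself E_err E_err _ eta0.
exists (c0 / 4), (n%:R ^+ 2 * `|Qp s0| + c0); split=> //; first by rewrite ltr_wpDl// mulr_ge0// exprn_ge0.
apply: filterS3 h1 h2 h3 => x.
rewrite (lyap_slope_perp (w := E s0 *m e x)); last first.
  by rewrite mulmxA PE mul0mx.
have := bform_norm (Qp s0) (e x) (e x); have := hc (e x).
have z0 : 0 <= `|e x| ^+ 2 by rewrite exprn_ge0.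
rewrite -[_ * `|e x| * `|e x|]mulrA -expr2.
move: z0; set z := `|e x| ^+ 2; set k := _ * `|Qp s0|.
set a1 := bform lyap_slope _ _; set a2 := bform (Qp s0) (e x) _; set a3 := bform (Qp s0) (E s0 *m e x) _.
rewrite !ler_norml => z0 k1 /andP[k2 k3] /andP[h1 h2] /andP[h3 h4] /andP[h5 h6].
by apply/andP; split; lra.
Qed.

End Hessian.

Lemma rate_bound : exists2 C : R, 0 <= C &
  \forall x \near Ufilter s0, `|proj_rate x - rho (p x)| <= C * `|e x|.
Proof.
have [H H_err _] := grad_err ltab xsC2 hproj s0ab.
have hO : big_O (Ufilter s0) e (fun x => grad_row p x *m F x - (rho (p x))%:M) by exact: (proj_rate_bigO H_err).
have [C C0 hC] := hO; exists C => //; apply: filterS hC => x h.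
have -> : proj_rate x - rho (p x) = (grad_row p x *m F x - (rho (p x))%:M) 0 0.
  by rewrite /proj_rate; set M := _ *m _; rewrite !mxE mulr1n.
exact: le_trans (mx_entry_le _ 0 0) h.
Qed.

Lemma lyap_rate_decay : exists c C : R, [/\ 0 < c, 0 < C &
  \forall x \near Ufilter s0, - C * `|e x| ^+ 2 <= lyap_rate x <= - c * `|e x| ^+ 2].
Proof.
by have [H H_err H_val] := grad_err ltab xsC2 hproj s0ab; exact: (tube_decay H_err H_val).
Qed.

(** [V] with the parameter frozen at [s0]: a quadratic polynomial, differentiable along every
    differentiable curve, that agrees with [V] on the level [p = s0]. *)
Definition end_form y : R := bform (Rm s0) (y - x0) (y - x0).

Definition end_rate x : R := bform (Rm s0) (F x) (x - x0) + bform (Rm s0) (x - x0) (F x).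

Lemma end_form_along x : derivative_along F end_form x (end_rate x).
Proof.
move=> J phi t k phix h; have he := hderivB h (hderiv_cst J x0 t); rewrite subr0 in he.
have hV := hderiv_entry 0 0 (hderiv_mulmx (hderiv_mulmx (hderiv_trmx he) (hderiv_cst J (Rm s0) t)) he).
suff <- : ((((k *: F x)^T *m Rm s0 + (phi t - x0)^T *m 0) *m (phi t - x0) + (phi t - x0)^T *m Rm s0 *m (k *: F x)) : 'M[R]_1) 0 0
    = k * end_rate x by exact: hV.
by rewrite mulmx0 addr0 mxE phix -!/(bform _ _ _) bformZl bformZr /end_rate; ring.
Qed.

Lemma end_decay Q : rho s0 = 0 -> posdef Q -> (A s0)^T *m Rm s0 + Rm s0 *m A s0 = - Q ->
  exists c C : R, [/\ 0 < c, 0 < C & \forall x \near Xfilter s0, p x = s0 ->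
    - C * `|e x| ^+ 2 <= end_rate x <= - c * `|e x| ^+ 2].
Proof.
move=> rho0 Qpos QE; have [c0 c00 hc] := posdef_lower Qpos.
have eta0 : 0 < c0 / 2 by rewrite divr_gt0.
exists (c0 / 2), (n%:R ^+ 2 * `|Q| + c0); split=> //; first by rewrite ltr_wpDl// mulr_ge0// exprn_ge0.
have h := @end_expansion _ _ _ f B sa sw xs us rho r X Ha T Hw p K hsys xsC2 usC1 dynamics hproj hK s0 s0ab rho0 (Rm s0) _ eta0.
apply: filterS h => x h px; have := h px; rewrite QE bformNm opprK.
have -> : end_rate x = bform (Rm s0) (F x) (e x) + bform (Rm s0) (e x) (F x) by rewrite /end_rate /err px.
have := bform_norm Q (e x) (e x); have := hc (e x).
have z0 : 0 <= `|e x| ^+ 2 by rewrite exprn_ge0.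
rewrite -[_ * `|e x| * `|e x|]mulrA -expr2.
move: z0; set z := `|e x| ^+ 2; set k := _ * `|Q|; set a1 := bform _ (F x) _; set a2 := bform _ _ (F x); set a3 := bform Q _ _.
rewrite !ler_norml => z0 k1 /andP[k2 k3] /andP[h1 h2].
by apply/andP; split; lra.
Qed.

End AtPoint.

End TubeDecay.

(** * Uniform constants *)

Lemma near_distP {R : realType} {n : nat} (x0 : 'cV[R]_n) (P : set 'cV[R]_n) : nbhs x0 P -> exists2 q : R, 0 < q & forall x, `|x - x0| < q -> P x.
Proof.
move=> /nbhs_ballP[q /= q0 hq]; exists q => // x xq; apply: hq.
by rewrite -ball_normE /= distrC.
Qed.

Section TubeConstants.
Context {R : realType} {n m : nat}.
Variables (f : 'cV[R]_n -> 'cV[R]_n) (B : 'cV[R]_n -> 'M[R]_(n, m)).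
Variables (sa sw : R) (xs : R -> 'cV[R]_n) (us : R -> 'cV[R]_m) (rho : R -> R).
Variables (r : nat) (X Ha T Hw : set 'cV[R]_n) (p : 'cV[R]_n -> R).
Variables (K : R -> 'M[R]_(m, n)) (Rm Qp : R -> 'M[R]_n) (Qa Qw : 'M[R]_n).
Hypothesis hsys : control_system f B.
Hypothesis ltab : sa < sw.
Hypothesis xsC2 : Ck_on `[sa, sw]%classic 2 xs.
Hypothesis usC1 : Ck_on `[sa, sw]%classic 1 us.
Hypothesis rhoC1 : Ck_on `[sa, sw]%classic 1 rho.
Hypothesis rho_ends : rho sa = 0 /\ rho sw = 0.
Hypothesis dynamics : forall s, s \in `[sa, sw] ->
  rho s *: derive_on `[sa, sw]%classic xs s = f (xs s) + B (xs s) *m us s.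
Hypothesis hproj : projection_operator sa sw xs r X Ha T Hw p.
Hypothesis hK : smooth_on `[sa, sw]%classic K.
Hypothesis hRC1 : Ck_on `[sa, sw]%classic 1 Rm.
Hypothesis hRpos : forall s, s \in `[sa, sw] -> posdef (Rm s).

Local Notation S := (`[sa, sw]%classic).
Local Notation U := (T°).
Local Notation e := (err xs p).
Local Notation F := (closed_loop f B xs us K p).
Local Notation V := (lyap xs p Rm).
Local Notation A := (Acl f B xs us K).
Local Notation E := (Eperp sa sw xs T p).
Local Notation Rp := (fun t => (E t)^T *m Rm t *m E t).

Hypothesis Qa_pos : posdef Qa.
Hypothesis Qw_pos : posdef Qw.
Hypothesis lyap_a : (A sa)^T *m Rm sa + Rm sa *m A sa = - Qa.
Hypothesis lyap_w : (A sw)^T *m Rm sw + Rm sw *m A sw = - Qw.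
Hypothesis Qp_pos : forall s, s \in `[sa, sw] -> posdef (Qp s).
Hypothesis perp : forall s, s \in `[sa, sw] ->
  (E s)^T *m ((A s)^T *m Rp s + Rp s *m A s + rho s *: derive_on S Rp s + Qp s) *m E s = 0.

(** Since [Q] survives decreasing [c] and increasing [C], the constants may be replaced by [d] and
    [d^-1], and the compactness of the interval yields one [d]. *)
Lemma orbit_uniform (Q : R -> R -> 'cV[R]_n -> 'cV[R]_n -> Prop) :
  (forall c C c' C' x y, 0 < c' -> c' <= c -> C <= C' -> Q c C x y -> Q c' C' x y) ->
  (forall s0, sa <= s0 <= sw -> exists c C q : R, [/\ 0 < c, 0 < C, 0 < q &
     forall x y, `|x - xs s0| < q -> `|y - xs s0| < q -> Q c C x y]) ->
  exists d c C, [/\ 0 < d, 0 < c, 0 < C & forall s x y, sa <= s <= sw ->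
     `|x - xs s| < d -> `|y - xs s| < d -> Q c C x y].
Proof.
move=> mono loc; have [M M0 hM] := xs_lipschitz xsC2.
have [d d0 hd] : exists2 d : R, 0 < d & forall s, sa <= s <= sw ->
    forall x y, `|x - xs s| < d -> `|y - xs s| < d -> Q d d^-1 x y.
  apply: uniform_on_itv => s0 s0ab; have [c [C [q [c0 C0 q0 hQ]]]] := loc s0 s0ab.
  have q20 : 0 < q / 2 by rewrite divr_gt0.
  exists (Num.min (Num.min c C^-1) (Num.min (q / 2) (q / 2 / M))).
    by rewrite !lt_min c0 invr_gt0 C0 q20 divr_gt0.
  move=> s d sab; rewrite !lt_min => /andP[_ /andP[_ sq]] d0 /andP[/andP[dc dC] /andP[dq _]] x y xd yd.
  have near_s0 z : `|z - xs s| < d -> `|z - xs s0| < q.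
    move=> zd; have -> : z - xs s0 = (z - xs s) + (xs s - xs s0) by rewrite addrA subrK.
    rewrite (le_lt_trans (ler_normD _ _))//; have := hM s s0 sab s0ab.
    by move: sq; rewrite ltr_pdivlMr// => sq h; lra.
  apply: (mono c C) => //; [exact: ltW | | by apply: hQ; exact: near_s0].
  by rewrite -[C]invrK lef_pV2 ?posrE ?invr_gt0// ltW.
by exists d, d, d^-1; split=> //; rewrite ?invr_gt0// => s x y sab; exact: hd.
Qed.

Lemma gramian_bounds : exists c C : R, [/\ 0 < c, 0 < C & forall s v, sa <= s <= sw ->
  c * `|v| ^+ 2 <= bform (Rm s) v v <= C * `|v| ^+ 2].
Proof.
have [d d0 hd] : exists2 d : R, 0 < d & forall s, sa <= s <= sw ->
    forall v, d * `|v| ^+ 2 <= bform (Rm s) v v <= d^-1 * `|v| ^+ 2.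
  apply: uniform_on_itv => s0 s0ab.
  have [c c0 hc] : exists2 c : R, 0 < c & forall v, c * `|v| ^+ 2 <= bform (Rm s0) v v.
    by apply: posdef_lower; apply: hRpos; rewrite in_itv.
  pose N : R := n%:R ^+ 2 + 1.
  have N0 : 0 < N by rewrite ltr_wpDl// exprn_ge0.
  have q0 : 0 < c / 2 / N by rewrite !divr_gt0.
  have /nbhs_ballP[q1 /= q10 hq1] := C1_cont_in hRC1 s0ab q0.
  pose C := N * `|Rm s0| + c.
  have C0 : 0 < C by rewrite ltr_wpDl// mulr_ge0// ltW.
  exists (Num.min q1 (Num.min (c / 2) C^-1)); first by rewrite !lt_min q10 divr_gt0//= invr_gt0.
  move=> s d sab; rewrite !lt_min => /andP[sq _] d0 /and3P[_ dc dC] v.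
  have hs : `|Rm s - Rm s0| <= c / 2 / N.
    by apply: hq1; [rewrite /ball /= distrC | exact: memS].
  have b1 := bform_norm (Rm s0) v v; have b2 := bform_norm (Rm s - Rm s0) v v.
  have b3 := hc v; rewrite -[_ * `|v| * `|v|]mulrA -expr2 in b1.
  rewrite -[_ * `|v| * `|v|]mulrA -expr2 in b2.
  have z0 : 0 <= `|v| ^+ 2 by rewrite exprn_ge0.
  have -> : bform (Rm s) v v = bform (Rm s0) v v + bform (Rm s - Rm s0) v v.
    by rewrite bformDm bformNm; ring.
  have k1 : n%:R ^+ 2 * `|Rm s - Rm s0| <= c / 2.
    apply: (@le_trans _ _ (N * (c / 2 / N))); last by rewrite mulrC divfK// gt_eqF.
    by apply: ler_pM => //; rewrite lerDl.
  have k2 : n%:R ^+ 2 * `|Rm s - Rm s0| * `|v| ^+ 2 <= c / 2 * `|v| ^+ 2 by rewrite ler_wpM2r.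
  have k3 : n%:R ^+ 2 * `|Rm s0| * `|v| ^+ 2 <= N * `|Rm s0| * `|v| ^+ 2.
    by rewrite !ler_wpM2r// lerDl.
  have k4 : d * `|v| ^+ 2 <= c / 2 * `|v| ^+ 2 by rewrite ler_wpM2r// ltW.
  have k5 : C * `|v| ^+ 2 <= d^-1 * `|v| ^+ 2.
    by rewrite ler_wpM2r// -[C]invrK lef_pV2 ?posrE ?invr_gt0// ltW.
  have k6 : 0 <= c * `|v| ^+ 2 by rewrite mulr_ge0// ltW.
  move: b1 b2; rewrite !ler_norml => /andP[b11 b12] /andP[b21 b22].
  move: k5; rewrite /C mulrDl => k5.
  by apply/andP; split; lra.
by exists d, d^-1; split=> //; rewrite ?invr_gt0// => s v sab; exact: hd.
Qed.

(** The local estimates to be made uniform, in a form monotone in the constants; the second point is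
    carried along for the Lipschitz bound on the field. *)
Definition tube_point (c C : R) (x y : 'cV[R]_n) : Prop := [/\ X x /\ [\/ U x, p x = sa | p x = sw],
  `|F x| <= C /\ `|F x - F y| <= C * `|x - y|,
  U x -> `|proj_rate f B xs us p K x - rho (p x)| <= C * `|e x|,
  U x -> decay_bounds p xs c C x (lyap_rate f B sa sw xs us p K Rm x) &
  p x = sa \/ p x = sw -> exists W dV,
    [/\ forall y, X y -> p y = p x -> W y = V y, derivative_along F W x dV & decay_bounds p xs c C x dV]].

Lemma decay_bounds_le c C c' C' x w : c' <= c -> C <= C' -> decay_bounds p xs c C x w -> decay_bounds p xs c' C' x w.
Proof.
move=> cc CC /andP[h1 h2]; have z0 : 0 <= `|e x| ^+ 2 by rewrite exprn_ge0.
apply/andP; split.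
  by apply: le_trans h1; rewrite ler_wpM2r// lerN2.
by apply: (le_trans h2); rewrite ler_wpM2r// lerN2.
Qed.

Lemma tube_point_le c C c' C' x y : 0 < c' -> c' <= c -> C <= C' -> tube_point c C x y -> tube_point c' C' x y.
Proof.
move=> _ cc CC [h1 [h2 h3] h4 h5 h6]; split=> //.
- split; first exact: le_trans h2 CC.
  by apply: (le_trans h3); rewrite ler_wpM2r.
- by move=> Ux; apply: (le_trans (h4 Ux)); rewrite ler_wpM2r.
- by move=> Ux; apply: decay_bounds_le (h5 Ux).
- move=> /h6[W [dV [k1 k2 k3]]]; exists W, dV; split=> //.
  exact: decay_bounds_le k3.
Qed.

Section Local.
Variable s0 : R.
Hypothesis s0ab : sa <= s0 <= sw.

Lemma near_cases : \forall x \near xs s0, X x /\ [\/ U x, p x = sa | p x = sw].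
Proof.
have [ends|inner] := end_or_interior s0ab; last first.
  have Us := tube_orbit hproj inner.
  apply: filterS2 (orbit_nbhs hproj s0ab) (open_nbhs_nbhs (conj (@tube_open _ _ T) Us)) => x Xx Ux.
  by split=> //; constructor 1.
have [q q0 hq] := tube_near_end ltab hproj ends.
apply: filterS (near_dist (xs s0) q0) => x /hq[Xx hU]; split=> //.
have [px|/eqP/hU Ux] := eqVneq (p x) s0; last by constructor 1.
by case: ends px => ->; [constructor 2 | constructor 3].
Qed.

Lemma near_far s1 : s1 != s0 -> \forall x \near xs s0, X x -> p x <> s1.
Proof.
move=> s01; have d0 : 0 < `|s1 - s0| by rewrite normr_gt0 subr_eq0.
by apply: filterS (p_tends hproj s0ab d0) => x hx Xx px; move: (hx Xx); rewrite px ltxx.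
Qed.

(** When [s1] differs from [s0], the level [p = s1] stays away from [xs s0] and the claim is
    vacuous, with constants [1]; both ends can thus be treated at every point of the orbit. *)
Lemma near_end_decay s1 Q : s1 = sa \/ s1 = sw -> posdef Q -> (A s1)^T *m Rm s1 + Rm s1 *m A s1 = - Q ->
  exists c C : R, [/\ 0 < c, 0 < C & \forall x \near xs s0, X x -> p x = s1 -> exists W dV,
    [/\ forall y, X y -> p y = p x -> W y = V y, derivative_along F W x dV & decay_bounds p xs c C x dV]].
Proof.
move=> ends Qpos QE; have [s01|/near_far far] := eqVneq s1 s0; last first.
  by exists 1, 1; split=> //; apply: filterS far => x hx Xx /(hx Xx).
have rho0 : rho s0 = 0 by rewrite -s01; case: rho_ends; case: ends => ->.
rewrite s01 in QE; have [c [C [c0 C0 h]]] := end_decay hsys xsC2 usC1 dynamics hproj hK s0ab rho0 Qpos QE.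
exists c, C; split=> //; rewrite s01; apply: filterS h => x h px.
exists (end_form xs Rm s0), (end_rate f B xs us p K Rm s0 x); split.
- by move=> y Xy py; rewrite /end_form /lyap /err py px.
- exact: end_form_along.
- exact: h.
Qed.

Lemma near_tube_point : exists c C q : R, [/\ 0 < c, 0 < C, 0 < q &
  forall x y, `|x - xs s0| < q -> `|y - xs s0| < q -> tube_point c C x y].
Proof.
have Xs := orbit_memX hproj s0ab.
have [L [q1 [L0 q10 hL]]] := closed_loop_lip_near hsys xsC2 usC1 hproj hK Xs.
have [M [q2 [M0 q20 hM]]] := lip_near_bound Xs (closed_loop_lip_near hsys xsC2 usC1 hproj hK Xs).
have [C1 C10 h1] := rate_bound hsys ltab xsC2 usC1 rhoC1 dynamics hproj hK s0ab.
have [c2 [C2 [c20 C20 h2]]] := lyap_rate_decay hsys ltab xsC2 usC1 rhoC1 rho_ends dynamics hproj hK hRC1 Qp_pos perp s0ab.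
have [c3 [C3 [c30 C30 h3]]] := near_end_decay (or_introl erefl) Qa_pos lyap_a.
have [c4 [C4 [c40 C40 h4]]] := near_end_decay (or_intror erefl) Qw_pos lyap_w.
rewrite tube_filterP in h1; rewrite tube_filterP in h2.
have [q3 q30 hq3] := near_distP near_cases.
have [q4 q40 hq4] := near_distP h1; have [q5 q50 hq5] := near_distP h2.
have [q6 q60 hq6] := near_distP h3; have [q7 q70 hq7] := near_distP h4.
pose c := Num.min c2 (Num.min c3 c4); pose C := L + M + C1 + C2 + C3 + C4.
have cc : [/\ c <= c2, c <= c3 & c <= c4] by rewrite /c !ge_min !lexx !orbT.
have [cc2 cc3 cc4] := cc.
have [CL CM] : L <= C /\ M <= C by rewrite /C; split; lra.
have [CC1 CC2 CC3 CC4] : [/\ C1 <= C, C2 <= C, C3 <= C & C4 <= C] by rewrite /C; split; lra.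
exists c, C, (Num.min (Num.min q1 q2) (Num.min (Num.min q3 q4) (Num.min q5 (Num.min q6 q7)))); split.
- by rewrite !lt_min c20 c30.
- by apply: (lt_le_trans C20).
- by rewrite !lt_min q10 q20 q30 q40 q50 q60.
move=> x y; rewrite !lt_min => /and3P[/andP[x1 x2] /andP[x3 x4] /and3P[x5 x6 x7]] /and3P[/andP[y1 y2] /andP[y3 _] _].
have cx := hq3 x x3; have [Xx _] := cx.
have h1x := hq4 x x4; have h2x := hq5 x x5; have h3x := hq6 x x6; have h4x := hq7 x x7.
have [Xy _] := hq3 y y3; split=> //.
- split; first exact: le_trans (hM x Xx x2) CM.
  by apply: (le_trans (hL x y Xx Xy x1 y1)); rewrite ler_wpM2r.
- by move=> /h1x h; apply: (le_trans h); rewrite ler_wpM2r.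
- by move=> /h2x; exact: decay_bounds_le.
- case=> px; [have := h3x Xx px | have := h4x Xx px] => -[W [dV [k1 k2 k3]]];
    by exists W, dV; split=> //; apply: decay_bounds_le k3.
Qed.

End Local.

Lemma tube_estimates_exist : exists c C d, tube_estimates X F p xs sa sw V rho U c C d.
Proof.
have [d [c1 [C1 [d0 c10 C10 h]]]] := orbit_uniform tube_point_le near_tube_point.
have [c2 [C2 [c20 C20 hV]]] := gramian_bounds.
have [L L0 hL] := proj_lip hproj; have [M M0 hM] := xs_lipschitz xsC2.
pose c := Num.min c1 c2; pose C := C1 + C2 + L + M.
have [cc1 cc2] : c <= c1 /\ c <= c2 by rewrite /c !ge_min !lexx !orbT.
have CC : [/\ C1 <= C, C2 <= C, L <= C & M <= C] by rewrite /C; split; lra.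
have [CC1 CC2 CL CM] := CC.
have c0 : 0 < c by rewrite lt_min c10.
have tp s x y : sa <= s <= sw -> `|x - xs s| < d -> `|y - xs s| < d -> tube_point c C x y.
  by move=> ss xd yd; apply: tube_point_le (h s x y ss xd yd).
have tp1 x : in_tube xs sa sw d x -> tube_point c C x x by move=> [s ss xd]; exact: (tp s).
exists c, C, d; split=> //.
- exact: lt_le_trans C10 CC1.
- exact: (proj_range_le hproj).
- by move=> x y Xx Xy; apply: (le_trans (hL x y Xx Xy)); rewrite ler_wpM2r.
- by move=> s t ss tt; apply: (le_trans (hM s t ss tt)); rewrite ler_wpM2r.
- exact: (proj_orbit_le hproj).
- move=> x Xx; have /andP[h1 _] := hV (p x) (e x) (proj_range_le hproj Xx).
  by apply: le_trans h1; rewrite ler_wpM2r// exprn_ge0.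
- move=> x Xx; have /andP[_ h1] := hV (p x) (e x) (proj_range_le hproj Xx).
  by apply: (le_trans h1); rewrite ler_wpM2r// exprn_ge0.
- by move=> x Xx q q0; exact: (lyap_cont xsC2 hproj hRC1 Xx q0).
- move=> x [s ss xd]; have q0 : 0 < d - `|x - xs s| by rewrite subr_gt0.
  apply: filterS (near_dist x q0) => y yx.
  have yd : `|y - xs s| < d.
    rewrite -(subrK x y) -addrA (le_lt_trans (ler_normD _ _))//; lra.
  by have [[]] := tp s y y ss yd yd.
- by move=> x /tp1[[]].
- move=> x /tp1[_ _ h1 h2 _] Ux.
  exists (proj_rate f B xs us p K x), (lyap_rate f B sa sw xs us p K Rm x); split.
  + exact: (proj_rate_along hproj Ux).
  + exact: (lyap_rate_along xsC2 hproj hRC1 Ux).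
  + exact: h1.
  + exact: h2.
- by move=> x /tp1[_ _ _ _ h1]; exact: h1.
- by move=> s x y ss xd yd; have [_ [_ h1]] := tp s x y ss xd yd.
- by move=> x /tp1[_ []].
Qed.

End TubeConstants.

(** * Boundaries of the caps *)

Section LevelSets.
Context {R : realType} {n : nat}.
Variables (sa sw : R) (xs : R -> 'cV[R]_n) (r : nat) (X Ha T Hw : set 'cV[R]_n) (p : 'cV[R]_n -> R).
Hypothesis ltab : sa < sw.
Hypothesis xsC2 : Ck_on `[sa, sw]%classic 2 xs.
Hypothesis hproj : projection_operator sa sw xs r X Ha T Hw p.

Local Notation U := (T°).

Section AtEnd.
Variable s0 : R.
Hypothesis ends : s0 = sa \/ s0 = sw.

Let s0ab : sa <= s0 <= sw. Proof. by case: ends => ->; rewrite lexx ltW. Qed.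

(** The limit gradient at an end is nonzero because it maps the tangent to [1], so some coordinate
    [j] matters. In a cone around the inward direction of this coordinate the height does not
    decrease, and [tube_ray] with speed [0] keeps the segment in the tube. *)
Lemma level_cone : exists q L k : R, exists j : 'I_n, [/\ 0 < q, 0 <= L, `|k| = 1 &
  forall (x y : 'cV[R]_n) (d : R), U x -> `|x - xs s0| < q -> `|y - xs s0| < q -> 0 <= d ->
    (forall i, i != j -> `|y i 0 - x i 0| <= d) -> L * d <= k * (y j 0 - x j 0) -> U y].
Proof.
pose P0 := Porb xs T p s0.
have [j Pj] : exists j, P0 0 j != 0.
  apply: contrapT => h; have := Porb_tangent ltab xsC2 hproj s0ab.
  have -> : Porb xs T p s0 = 0.
    apply/rowP => j; rewrite mxE; apply/eqP; apply: contrapT => /negP hj.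
    by apply: h; exists j.
  by rewrite mul0mx => /matrixP/(_ 0 0); rewrite !mxE eqxx => /eqP; rewrite eq_sym oner_eq0.
(* Near the end the [j]-th partial derivative keeps its sign and has modulus at least [b], and all
   partial derivatives are at most [M]. The opening [n%:R * M / b] lets coordinate [j] outweigh the
   others. *)
pose b := `|P0 0 j| / 2; pose M := `|P0| + b.
have b0 : 0 < b by rewrite divr_gt0 ?normr_gt0.
have M0 : 0 <= M by rewrite addr_ge0// ltW.
pose sg := Num.sg (P0 0 j); pose tau := @end_side R sa s0.
have sg2 : sg * sg = 1 by rewrite /sg -expr2 sqr_sg Pj.
have sgn : `|sg| = 1 by rewrite normr_sg Pj.
have [q1 q10 hq1] := tube_near_end ltab hproj ends.
have [q2 q20 hq2] := near_distP (proj1 (tube_filterP _ _ _ _) (Porb_tends ltab xsC2 hproj s0ab b0)).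
exists (Num.min q1 q2), (n%:R * M / b), (tau * sg), j; split.
- by rewrite lt_min q10.
- by rewrite divr_ge0 ?mulr_ge0// ltW.
- by rewrite normrM sgn mulr1 /tau end_side_norm.
move=> x y d Ux xq yq d0 hd hj; pose w := y - x.
have inq t : 0 <= t <= 1 -> `|x + t *: w - xs s0| < Num.min q1 q2.
  move=> /andP[t0 t1].
  have -> : x + t *: w - xs s0 = (1 - t) *: (x - xs s0) + t *: (y - xs s0).
    by rewrite /w; apply/colP => i; rewrite !mxE; ring.
  rewrite (le_lt_trans (ler_normD _ _))// !normrZ (ger0_norm t0) ger0_norm ?subr_ge0//.
  set a := `|x - _| in xq *; set c := `|y - _| in yq *; set q := Num.min _ _ in xq yq *.
  have [->|t1'] := eqVneq t 1; first by rewrite subrr mul0r add0r mul1r.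
  have t1'' : t < 1 by rewrite lt_neqAle t1'.
  have : (1 - t) * a < (1 - t) * q by rewrite ltr_pM2l// subr_gt0.
  have : t * c <= t * q by rewrite ler_wpM2l// ltW.
  by rewrite !mulrBl !mul1r; lra.
have inq1 t : 0 <= t <= 1 -> `|x + t *: w - xs s0| < q1 /\ `|x + t *: w - xs s0| < q2.
  by move=> /inq; rewrite lt_min => /andP[].
have slope z : `|z - xs s0| < q2 -> U z -> 0 <= tau * 'D_w p z.
  move=> zq Uz; have g_near i : `|'D_(delta_mx i 0) p z - P0 0 i| <= b.
    by have := le_trans (mx_entry_le _ 0 i) (hq2 z zq Uz); rewrite !mxE.
  have g_bound i : `|'D_(delta_mx i 0) p z| <= M.
    rewrite -(subrK (P0 0 i) ('D_(delta_mx i 0) p z)) (le_trans (ler_normD _ _))//.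
    by rewrite /M addrC lerD// mx_entry_le.
  rewrite (derive_basis _ (proj_diff hproj Uz)) (bigD1 j)//= mulrDr.
  have k1 : n%:R * M * d <= tau * (w j 0 *: 'D_(delta_mx j 0) p z).
    have -> : tau * (w j 0 *: 'D_(delta_mx j 0) p z) =
        (tau * sg * (y j 0 - x j 0)) * (sg * 'D_(delta_mx j 0) p z).
      rewrite /w !mxE /GRing.scale /= -[LHS]mul1r -sg2; ring.
    have k2 : b <= sg * 'D_(delta_mx j 0) p z.
      have -> : sg * 'D_(delta_mx j 0) p z = `|P0 0 j| + sg * ('D_(delta_mx j 0) p z - P0 0 j).
        by rewrite normrEsg -/sg; ring.
      have := g_near j; have := normrM sg ('D_(delta_mx j 0) p z - P0 0 j); rewrite sgn mul1r => <-.
      by rewrite ler_norml => /andP[+ _]; rewrite /b; lra.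
    apply: (@le_trans _ _ (n%:R * M / b * d * b)).
      by rewrite [leRHS]mulrAC divfK// gt_eqF.
    by apply: ler_pM => //; [rewrite mulr_ge0// divr_ge0 ?mulr_ge0// ltW | exact: ltW].
  have k3 : `|tau * \sum_(i | i != j) w i 0 *: 'D_(delta_mx i 0) p z| <= n%:R * M * d.
    rewrite normrM /tau end_side_norm mul1r (le_trans (ler_norm_sum _ _ _))//.
    apply: (@le_trans _ _ (\sum_(i < n) M * d)); last by rewrite sumr_const card_ord -mulrA mulr_natl.
    rewrite [leRHS](bigD1 j)//= ler_wpDl// ?mulr_ge0//; apply: ler_sum => i ij.
    by rewrite normrM mulrC ler_pM// /w !mxE; exact: hd.
  by move: k3; rewrite ler_norml => /andP[k3 _]; lra.
have yE : y = x + 1 *: w by rewrite scale1r /w addrC subrK.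
have h : end_height sa p s0 x + 0 * 1 <= end_height sa p s0 (x + 1 *: w).
  apply: (tube_ray hproj ends) => // t /inq1[t1 t2]; first exact: hq1.
  by move=> Ut; exact: slope.
rewrite mul0r addr0 -yE in h; apply: (hq1 y _).2.
  by move: yq; rewrite lt_min => /andP[].
by apply: (@end_height_neq _ _ sa); apply: lt_le_trans h; exact: (end_height_gt0 hproj ends).
Qed.

(** At other points of the level near the end, [p] is locally constant and [V] coincides locally
    with the smooth [end_form]; only here can the derivative of [V] fail to exist. *)
Definition level_boundary (a : R) : set 'cV[R]_n :=
  [set x | [/\ `|x - xs s0| < a, p x = s0 & ~ \forall y \near x, p y = s0]].

(* By [level_cone] the set is a Lipschitz graph over the coordinates other than [j]. *)
Lemma level_boundary_null : exists2 a, 0 < a & lebesgue_null (level_boundary a).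
Proof.
have [q [L [k [j [q0 L0 k1 hU]]]]] := level_cone.
have [q1 q10 hq1] := tube_near_end ltab hproj ends.
pose a := Num.min (q / 2) (q1 / 2).
have a0 : 0 < a by rewrite lt_min !divr_gt0.
(* If [y] lay strictly inside the cone at [x], it would also lie in the cone at a nearby point [x']
   with [p x' <> s0]. Such points exist arbitrarily close to [x] and belong to the tube, so [y]
   would be in the tube, against [p y = s0]. *)
have core x y d : level_boundary a x -> level_boundary a y -> 0 <= d ->
    (forall i, i != j -> `|y i 0 - x i 0| <= d) -> k * (y j 0 - x j 0) <= L * d.
  move=> [xa px xn] [ya py _] d0 hd; rewrite leNgt; apply/negP => gap.
  apply: xn; pose g := k * (y j 0 - x j 0) - L * d.
  have g0 : 0 < g by rewrite subr_gt0.
  have L1 : 0 < 1 + L by rewrite ltr_pwDl.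
  (* Replacing [x] by [x'] narrows the gap by at most [(1 + L) * |x' - x|]: once through coordinate
     [j], and [L] times through the others. *)
  have eta0 : 0 < Num.min a (g / (1 + L)) by rewrite lt_min a0 divr_gt0.
  apply: filterS (near_dist x eta0) => x'; rewrite lt_min => /andP[x'a x'g].
  apply: contrapT => px'.
  move: xa ya x'a; rewrite !lt_min => /andP[xa1 xa2] /andP[ya1 _] /andP[x'a1 x'a2].
  have x's : `|x' - xs s0| <= `|x' - x| + `|x - xs s0|.
    have -> : x' - xs s0 = (x' - x) + (x - xs s0) by rewrite addrA subrK.
    exact: ler_normD.
  have Ux' : U x' by apply: (hq1 x' _).2 => //; lra.
  have Uy : U y.
    apply: (hU x' y (d + `|x' - x|)) => //; try lra.
    - by rewrite addr_ge0.
    - move=> i ij; have -> : y i 0 - x' i 0 = (y i 0 - x i 0) - (x' - x) i 0 by rewrite !mxE; ring.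
      by rewrite (le_trans (ler_normB _ _))// lerD ?hd// mx_entry_le.
    - have -> : k * (y j 0 - x' j 0) = k * (y j 0 - x j 0) - k * (x' - x) j 0 by rewrite !mxE; ring.
      have h1 : `|k * (x' - x) j 0| <= `|x' - x| by rewrite normrM k1 mul1r mx_entry_le.
      move: h1 x'g; rewrite ltr_pdivlMr// ler_norml /g => /andP[h1 h2] x'g; lra.
  have := proj_tube_lt hproj Uy; rewrite py; case: ends => ->; rewrite ltxx ?andbF//.
exists a => //; apply: (lebesgue_null_graph a0 L0 (x0 := xs s0) (j := j)).
- move=> x [xa _ _] i; have := le_lt_trans (mx_entry_le _ i 0) xa; rewrite !mxE ltr_norml; lra.
- move=> x y d Nx Ny d0 hd.
  have hd' i : i != j -> `|y i 0 - x i 0| <= d by move=> /hd; rewrite distrC.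
  have h1 := core x y d Nx Ny d0 hd'; have h2 := core y x d Ny Nx d0 hd.
  have -> : `|x j 0 - y j 0| = `|k * (x j 0 - y j 0)| by rewrite normrM k1 mul1r.
  by rewrite ler_norml; apply/andP; split; lra.
Qed.

End AtEnd.
End LevelSets.

Lemma hderiv_derive1 {R : realType} (g : R -> R) (t d : R) : hderiv setT g t d ->
  derivable g t 1 /\ derive1 g t = d.
Proof.
move=> h; have lim_d : h^-1 *: (g (h + t) - g t) @[h --> 0^'] --> d.
  apply/cvgrPdist_le => e e0; have [q q0 hq] : exists2 q : R, 0 < q & forall u, `|u - t| < q -> setT u ->
      `|g u - g t - (u - t) *: d| <= e * `|u - t|.
    by have /nbhs_ballP[q /= q0 hq] := h e e0; exists q => // u uq; apply: hq; rewrite /ball /= distrC.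
  near=> u; have u0 : u != 0 by near: u; exact: nbhs_dnbhs_neq.
  have uq : `|u + t - t| < q by rewrite addrK; near: u; exact: dnbhs0_lt.
  have := hq (u + t) uq I; rewrite addrK /GRing.scale /= => k.
  have -> : d - u^-1 * (g (u + t) - g t) = - (u^-1 * (g (u + t) - g t - u * d)) by field.
  by rewrite normrN normrM normfV mulrC ler_pdivrMr ?normr_gt0.
split.
- apply/cvg_ex; exists d; have -> : (fun h : R => h^-1 *: ((g \o shift t) (h *: 1) - g t)) = (fun h => h^-1 *: (g (h + t) - g t)).
    by apply/funext => u; rewrite /= /GRing.scale /= mulr1.
  exact: lim_d.
- by rewrite /derive1; apply: (@cvg_lim R^o) lim_d; exact: norm_hausdorff.
Unshelve. all: by end_near. Qed.

(** * Decrease of [V] outside the exceptional set *)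

Section Decrease.
Context {R : realType} {n : nat}.
Variables (X : set 'cV[R]_n) (F : 'cV[R]_n -> 'cV[R]_n) (p : 'cV[R]_n -> R)
  (xs : R -> 'cV[R]_n) (sa sw : R) (V : 'cV[R]_n -> R) (rho : R -> R)
  (U : set 'cV[R]_n) (c C d : R).
Hypothesis E : tube_estimates X F p xs sa sw V rho U c C d.

Local Notation e := (err xs p).

Lemma time_decrease (a : R) x : 0 < a -> X x -> V x < safe_level c d -> V x < c * a ^+ 2 ->
  ~ level_boundary xs p sa a x -> ~ level_boundary xs p sw a x ->
  time_derivative_le X F V x (- (c / C) * V x).
Proof.
move=> a0 Xx Vx Vxa Na Nw.
have od := safe_dist E Xx Vx; have d0 := tube_d0 E; have c0 := tube_c0 E; have C0 := tube_C0 E.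
have xT : in_tube xs sa sw d x.
  by apply: (in_tube_V E Xx); exact: lt_trans Vx (safe_level_lt E).
split; first by apply: (local_solution E); apply: (lt_trans od); lra.
move=> tau phi tau0 sol phi0.
have I0 : 0 \in `](- tau), tau[ by rewrite in_itv /= oppr_lt0 tau0.
have [_ /hderivP hphi] := sol 0 I0; rewrite phi0 in hphi.
have hphi1 : hderiv [set` `](- tau), tau[] phi 0 (1 *: F x) by rewrite scale1r.
have phi_near (Q : 'cV[R]_n -> Prop) : (\forall y \near x, Q y) -> \forall t \near (0 : R), t \in `](- tau), tau[ -> Q (phi t).
  move=> /near_distP[q q0 hq]; have q20 : 0 < q / 2 by rewrite divr_gt0.
  apply: filterS (hderiv_cont hphi q20) => t ht tI; apply: hq.
  by rewrite -phi0 (le_lt_trans (ht tI))// ltr_pdivrMr// ltr_pMr// ltr1n.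
have near0 : \forall t \near (0 : R), t \in `](- tau), tau[.
  by apply: filterS (near_dist (0 : R) tau0) => t; rewrite subr0 ltr_norml in_itv.
suff [dV hV bV] : exists2 dV, hderiv setT (V \o phi) 0 dV & decay_bounds p xs c C x dV.
  have [h1 h2] := hderiv_derive1 hV; split=> //; rewrite h2.
  have /andP[_ b2] := bV; apply: (le_trans b2); rewrite !mulNr lerN2.
  have := tube_V_upper E Xx => h3; rewrite -mulrA ler_wpM2l ?(ltW c0)//.
  by rewrite mulrC ler_pdivrMr// mulrC.
have [Ux|nU] := pselect (U x).
  have [ds [dV [_ hV _ bV]]] := tube_deriv E xT Ux; exists dV => //.
  have := hV _ _ _ _ phi0 hphi1; rewrite mul1r => h.
  by apply: (hderiv_near h) => //; apply: filterS near0 => t tI _.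
have ends : p x = sa \/ p x = sw by case: (tube_cases E xT) => // ?; [left | right].
have [W [dV [WV hW bW]]] := tube_deriv_end E xT ends; exists dV => //.
(* A small value of [V] puts [x] within [a] of the end of the orbit, so if [p] were not locally
   constant, [x] would lie in an excluded boundary. *)
have p_near : \forall y \near x, p y = p x.
  have ex : `|x - xs (p x)| < a by exact: (err_small E Xx Vxa a0).
  by case: ends => pe; apply: contrapT => hn; [apply: Na | apply: Nw]; rewrite /level_boundary /= -pe.
have := hW _ _ _ _ phi0 hphi1; rewrite mul1r => h.
apply: (hderiv_near h); first by rewrite /= phi0 WV.
apply: filterS2 near0 (filterI (phi_near _ p_near) (phi_near _ (tube_X E xT))) => t tI [h1 h2] _; split=> //=.
by apply: WV; [exact: h2 | exact: h1].
Qed.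

End Decrease.

Theorem theorem10 (R : realType) (n m : nat) (hmn : (m <= n)%N)
  (f : 'cV[R]_n -> 'cV[R]_n) (B : 'cV[R]_n -> 'M[R]_(n, m))
  (hsys : control_system f B)
  (xa : 'cV[R]_n) (ua : 'cV[R]_m) (xw : 'cV[R]_n) (uw : 'cV[R]_m) (sa sw : R)
  (xs : R -> 'cV[R]_n) (us : R -> 'cV[R]_m) (rho : R -> R)
  (hman : ptp_maneuver f B xa ua xw uw sa sw xs us rho)
  (r : nat) (X Ha T Hw : set 'cV[R]_n) (p : 'cV[R]_n -> R)
  (hproj : projection_operator sa sw xs r X Ha T Hw p)
  (K : R -> 'M[R]_(m, n)) (hK : smooth_on `[sa, sw] K)
  (Rm : R -> 'M[R]_n) (hRC1 : Ck_on `[sa, sw] 1 Rm)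
  (hRpos : forall s, s \in `[sa, sw] -> posdef (Rm s))
  (hends : exists Qa Qw : 'M[R]_n,
    [/\ posdef Qa, posdef Qw,
        (Acl f B xs us K sa)^T *m Rm sa + Rm sa *m Acl f B xs us K sa = - Qa
      & (Acl f B xs us K sw)^T *m Rm sw + Rm sw *m Acl f B xs us K sw = - Qw])
  (hperp : exists Qp : R -> 'M[R]_n,
    [/\ smooth_on `[sa, sw] Qp,
        forall s, s \in `[sa, sw] -> posdef (Qp s)
      & forall s, s \in `[sa, sw] ->
        let A := Acl f B xs us K s in
        let E := Eperp sa sw xs T p in
        let Rp := fun t => (E t)^T *m Rm t *m E t in
        (E s)^T *m (A^T *m Rp s + Rp s *m A + rho s *: derive_on `[sa, sw] Rp s + Qp s)
          *m E s = 0]) :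
  let F := closed_loop f B xs us K p in
  let orb := maneuver_orbit sa sw xs in
  let V := lyap xs p Rm in
  [/\ asymptotically_stable X F xw,
      invariant_set X F orb /\ exponentially_stable_set X F orb
    & locally_lipschitz X V /\
      exists mu nu : R, [/\ 0 < mu, 0 < nu &
        exists2 N : set 'cV[R]_n, lebesgue_null N &
          forall x, X x -> V x < nu -> ~ N x ->
            time_derivative_le X F V x (- mu * V x)]].
Proof.
move=> F orb V; have [Qa [Qw [Qa_pos Qw_pos lyap_a lyap_w]]] := hends.
have [Qp [_ Qp_pos perp]] := hperp.
have [_ _ _ ltab xsC2 _ usC1 rhoC1 _ [xsw usw] [rho_a rho_w] rho_gt0 _ dyn] := hman.
have ws : sa <= sw <= sw by rewrite lexx ltW.
have [c [C [d E]]] := tube_estimates_exist hsys ltab xsC2 usC1 rhoC1 (conj rho_a rho_w) dyn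
  hproj hK hRC1 hRpos Qa_pos Qw_pos lyap_a lyap_w Qp_pos perp.
have c0 := tube_c0 E; have C0 := tube_C0 E.
have F_sw : F (xs sw) = 0.
  have wS : sw \in `[sa, sw] by rewrite in_itv.
  rewrite /F /closed_loop /feedback /err (proj_orbit_le hproj ws) subrr mulmx0 addr0.
  by rewrite -dyn// rho_w scale0r.
split.
- rewrite -xsw; by apply: (end_asymptotically_stable E) => //; exact: (Ck_on_pred rhoC1).
- split; [exact: (orbit_invariant E) | exact: (orbit_exponentially_stable E)].
split; first exact: (lyap_locally_lipschitz xsC2 hproj hRC1).
have [a1 a10 N1] := level_boundary_null ltab xsC2 hproj (or_introl erefl).
have [a2 a20 N2] := level_boundary_null ltab xsC2 hproj (or_intror erefl).
pose a := Num.min a1 a2; have a0 : 0 < a by rewrite lt_min a10.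
(* The first level provides local solutions and membership in the tube; the second keeps the points
   of the end levels inside the balls where their boundaries are known to be null. *)
exists (c / C), (Num.min (safe_level c d) (c * a ^+ 2)); split.
- by rewrite divr_gt0.
- by rewrite lt_min (safe_level_gt0 E) mulr_gt0// exprn_gt0.
exists (level_boundary xs p sa a1 `|` level_boundary xs p sw a2); first exact: lebesgue_nullU.
move=> x Xx; rewrite lt_min => /andP[V1 V2] Nx.
apply: (time_decrease E a0 Xx V1 V2) => -[xa' px nx]; apply: Nx; [left | right]; split=> //;
  by apply: (lt_le_trans xa'); rewrite ge_min lexx ?orbT.
Qed.
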